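(* Let $f:\mathbb{R}^d\to\mathbb{R}$ be convex and $\beta$-smooth with a minimizer $w^\star$ and minimum value $f^\star$, and run AdaSGD (as defined in the context) for $T$ steps with parameters $\eta,\gamma>0$ using a stochastic gradient oracle with bounded affine noise with parameters $\sigma_0,\sigma_1\ge0$. Then for any $\delta\in(0,1/4)$, with probability at least $1-\delta$: (i) $\displaystyle f\Big(\frac1T\sum_{t=1}^T w_t\Big)-f^\star \le O\Big(\big(\tfrac{D^2}{\eta}+\eta\big)+D\sqrt{\log\tfrac1\delta}\Big)\frac{\sigma_0}{\sqrt T} + O\Big(\tfrac{\gamma d_1^2}{\eta}+\beta(1+\sigma_1^2)\big(\tfrac{D^2}{\eta}+\eta\big)^2+\beta\sigma_1^2D^2\log\tfrac1\delta\Big)\frac1T$; (ii) $\|w_t-w^\star\|\le D$ for all $1\le t\le T+1$, where $d_1=\|w_1-w^\star\|$, $$D^2=\tilde O\Big(d_1^2+\eta^2\big(1+\sigma_1^2+\gamma^{-2}(\sigma_0^2+\beta\sigma_1^2F)+\gamma^{-4}(\sigma_0^4+\beta^2\sigma_1^4F^2)\big)\Big),\qquad F=\tilde O\big(f(w_1)-f^\star+\eta\sigma_0+\eta^2\beta\sigma_1^2+\eta^2\beta\big).$$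
   Context: $\|\cdot\|$ is the Euclidean norm and $\log$ the base-2 logarithm. $\beta$-smooth: $\|\nabla f(x)-\nabla f(y)\|\le\beta\|x-y\|$. Oracle: queried at $w$, returns random $g(w)$ with $\mathbb{E}[g(w)\mid w]=\nabla f(w)$ and, with probability one, $\|g(w)-\nabla f(w)\|^2\le\sigma_0^2+\sigma_1^2\|\nabla f(w)\|^2$. AdaSGD: arbitrary $w_1\in\mathbb{R}^d$; for $t=1,\dots,T$, $g_t=g(w_t)$ is a fresh oracle answer ($\mathbb{E}[g_t\mid g_1,\dots,g_{t-1}]=\nabla f(w_t)$), $\eta_t=\eta/\sqrt{\gamma^2+\sum_{s=1}^t\|g_s\|^2}$, $w_{t+1}=w_t-\eta_tg_t$. $O(\cdot)$ hides absolute constants and $\tilde O(\cdot)$ additionally hides logarithmic factors. *)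

(* Defs.v *)
From HB Require Import structures.
From mathcomp Require Import all_boot all_order all_algebra.
From mathcomp Require Import all_classical all_reals all_analysis.
Set Implicit Arguments. Unset Strict Implicit. Unset Printing Implicit Defensive.
Import Order.TTheory GRing.Theory Num.Theory.
Import numFieldNormedType.Exports.
Local Open Scope classical_set_scope.
Local Open Scope ring_scope.

Section Defs.
Variables (R : realType) (d : nat).

Definition dotv (u v : 'rV[R]_d) : R := \sum_(i < d) u 0 i * v 0 i.
Definition enorm (u : 'rV[R]_d) : R := Num.sqrt (dotv u u).

Definition log2 (x : R) : R := ln x / ln 2.

Definition gradf (f : 'rV[R]_d -> R) (w : 'rV[R]_d) : 'rV[R]_d :=
  \row_(i < d) ('d f w (delta_mx 0 i : 'rV[R]_d)).

Definition convex_fun (f : 'rV[R]_d -> R) : Prop :=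
  forall (x y : 'rV[R]_d) (t : R), 0 <= t <= 1 ->
    f ((1 - t) *: x + t *: y) <= (1 - t) * f x + t * f y.

Definition smooth_fun (beta : R) (f : 'rV[R]_d -> R) : Prop :=
  (forall x, differentiable f x) /\
  forall x y, enorm (gradf f x - gradf f y) <= beta * enorm (x - y).

Definition ada_eta (eta gamma : R) (g : nat -> 'rV[R]_d) (t : nat) : R :=
  eta / Num.sqrt (gamma ^+ 2 + \sum_(1 <= s < t.+1) enorm (g s) ^+ 2).

(* AdaSGD iterates, 1-indexed: ada_w .. 1 = w1,
   ada_w .. t.+1 = ada_w .. t - eta_t *: g_t  (t >= 1).
   (ada_w .. 0 is a junk value equal to w1.) *)
Fixpoint ada_w (eta gamma : R) (w1 : 'rV[R]_d) (g : nat -> 'rV[R]_d) (t : nat)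
  : 'rV[R]_d :=
  match t with
  | 0 => w1
  | t'.+1 =>
      match t' with
      | 0 => w1
      | _ => ada_w eta gamma w1 g t' - ada_eta eta gamma g t' *: g t'
      end
  end.

End Defs.

(* The sigma-algebra generated by the oracle answers g_1, ..., g_{t-1}
   (all coordinates), on the sample space Omega. *)
Definition past_sets (R : realType) (d : nat) (Omega : Type)
  (g : nat -> Omega -> 'rV[R]_d) (t : nat) : set (set Omega) :=
  [set A | exists (s : nat) (i : 'I_d) (B : set R),
     [/\ (1 <= s < t)%N, measurable B & A = [set x | B ((g s x) 0 i)]]].

(* Main.v *)
Require Import Defs.
From HB Require Import structures.
From mathcomp Require Import all_boot all_order all_algebra.
From mathcomp Require Import all_classical all_reals all_analysis measurable_realfun.
From mathcomp Require Import ring lra zify.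
Set Implicit Arguments.
Unset Strict Implicit.
Unset Printing Implicit Defensive.
Import Order.TTheory GRing.Theory Num.Theory.
Import numFieldNormedType.Exports.
Local Open Scope classical_set_scope.
Local Open Scope ring_scope.

(** Every update satisfies [|eta_t g_t| <= eta], so all logarithms of
    accumulated gradients are a priori [O(L)].  Since [eta_t] depends on [g_t],
    it is replaced by predictable surrogates whose error telescopes against
    [sum |g_t|^2 / G_t = O(L)].  Convexity and smoothness give first that
    [f(w_t) - f* <= F] (descent inequality), then that [|w_t - w*| <= D]
    (expansion of the squared distance), and finally the regret bound.  In each
    case the remaining martingale is truncated by the predictable event that the
    bound holds so far, and the bound then propagates by induction on a single
    event of high probability.

    All martingales are controlled through [E (prod_s (1 + X_s)) = 1] and
    [exp (x - 2 x^2) <= 1 + x] for [x >= -1/2]: the compensator is the empirical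
    quadratic variation, which is essential for the distances, where
    [sum sigma_0^2 / G_t] need not be bounded but [sum |xi_t|^2 / G_t] is. *)

(** * Euclidean space and smooth convex functions *)

(** An empirical compensator helps only if something pays for the quadratic variation. In the
    descent inequality, half of the predictable drift [eta_val t * |grad t|^2] is kept back for it.
    For the distances, the variation is a multiple of the sum of |xi_t|^2 / (G_{t-1} + |grad_t|^2).
    A fourth martingale, the cross term of |g_t|^2 = |grad_t|^2 + 2 <grad_t, xi_t> + |xi_t|^2, shows
    that past noise exceeds G_{t-1} by at most O(l) times the noise level, whence that sum is
    logarithmic in T. In the regret, the payment is a quarter of the sum of the suboptimality gaps
    together with a term D sigma_0 sqrt T.

    The radii F and D are fixed beforehand and have to reproduce themselves. Increments truncated at
    F grow like sqrt F and those truncated at D like D, so both conditions have the form r^2 <= a +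
    b r, and AM-GM closes them.

    The regret needs no surrogate: dividing the distance recursion by eta_t removes the step size
    from the noise term. The confidence level [l] is absorbed there by [eta * l <= D]. *)

Section Euclid.
Variables (R : realType) (d : nat).
Implicit Types (u v w : 'rV[R]_d) (a b : R).

Lemma dotvC u v : dotv u v = dotv v u.
Proof. by apply: eq_bigr => i _; rewrite mulrC. Qed.

Lemma dotvDl u v w : dotv (u + v) w = dotv u w + dotv v w.
Proof. by rewrite -big_split; apply: eq_bigr => i _; rewrite mxE mulrDl. Qed.

Lemma dotvZl a u v : dotv (a *: u) v = a * dotv u v.
Proof. by rewrite mulr_sumr; apply: eq_bigr => i _; rewrite mxE mulrA. Qed.

Lemma dotvNl u v : dotv (- u) v = - dotv u v.
Proof. by rewrite -scaleN1r dotvZl mulN1r. Qed.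

Lemma dotvDr u v w : dotv u (v + w) = dotv u v + dotv u w.
Proof. by rewrite dotvC dotvDl !(dotvC _ u). Qed.

Lemma dotvZr a u v : dotv u (a *: v) = a * dotv u v.
Proof. by rewrite dotvC dotvZl dotvC. Qed.

Lemma dotvNr u v : dotv u (- v) = - dotv u v.
Proof. by rewrite dotvC dotvNl dotvC. Qed.

Lemma dot0v v : dotv 0 v = 0.
Proof. by rewrite -(scale0r 0) dotvZl mul0r. Qed.

Lemma dotv_ge0 u : 0 <= dotv u u.
Proof. by apply: sumr_ge0 => i _; rewrite -expr2 sqr_ge0. Qed.

Lemma dotv_eq0 u : dotv u u = 0 -> u = 0.
Proof.
move=> /eqP; rewrite psumr_eq0 => [/allP h|i _]; last by rewrite -expr2 sqr_ge0.
apply/rowP => i; rewrite mxE; apply/eqP.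
by move: (h i (mem_index_enum i)); rewrite -expr2 sqrf_eq0.
Qed.

Lemma enorm_ge0 u : 0 <= enorm u.
Proof. exact: sqrtr_ge0. Qed.

Lemma sqr_enorm u : enorm u ^+ 2 = dotv u u.
Proof. by rewrite sqr_sqrtr ?dotv_ge0. Qed.

Lemma enorm0 : enorm (0 : 'rV[R]_d) = 0.
Proof. by rewrite /enorm dot0v sqrtr0. Qed.

Lemma enorm_eq0 u : enorm u = 0 -> u = 0.
Proof. by move=> h; apply: dotv_eq0; rewrite -sqr_enorm h expr0n. Qed.

Lemma cauchy_schwarz u v : dotv u v ^+ 2 <= dotv u u * dotv v v.
Proof.
have [v0|vn0] := eqVneq (dotv v v) 0.
  by rewrite (dotv_eq0 v0) dot0v dotvC dot0v expr0n mulr0.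
have vp : 0 < dotv v v by rewrite lt_neqAle eq_sym vn0 dotv_ge0.
have := dotv_ge0 (dotv v v *: u - dotv u v *: v).
rewrite !(dotvDl, dotvDr, dotvNl, dotvNr, dotvZl, dotvZr) (dotvC v u).
set x := dotv v v in vp *; set y := dotv u v; set z := dotv u u => h.
have {h} : 0 <= x * (z * x - y ^+ 2) by nra.
by rewrite pmulr_rge0 // subr_ge0.
Qed.

Lemma dotv_le u v : `|dotv u v| <= enorm u * enorm v.
Proof.
rewrite -(@ler_pXn2r _ 2) ?nnegrE ?mulr_ge0 ?enorm_ge0//.
by rewrite real_normK ?num_real// exprMn !sqr_enorm cauchy_schwarz.
Qed.

Lemma enormD u v : enorm (u + v) <= enorm u + enorm v.
Proof.
rewrite -(@ler_pXn2r _ 2) ?nnegrE ?addr_ge0 ?enorm_ge0//.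
rewrite sqr_enorm !(dotvDl, dotvDr) (dotvC v u) -!sqr_enorm.
have := dotv_le u v; rewrite ler_norml => /andP[_ h].
by nra.
Qed.

Lemma enormZ a u : enorm (a *: u) = `|a| * enorm u.
Proof.
by rewrite /enorm dotvZl dotvZr mulrA -expr2 sqrtrM ?sqr_ge0// sqrtr_sqr.
Qed.

Lemma enormN u : enorm (- u) = enorm u.
Proof. by rewrite -scaleN1r enormZ normrN1 mul1r. Qed.

Lemma coord_le_enorm u i : `|u 0 i| <= enorm u.
Proof.
rewrite -(@ler_pXn2r _ 2) ?nnegrE ?enorm_ge0// sqr_enorm real_normK ?num_real//.
rewrite /dotv (bigD1 i)//= -expr2 lerDl.
by apply: sumr_ge0 => j _; rewrite -expr2 sqr_ge0.
Qed.

Lemma coord_dist_le_enorm u v i : `|u 0 i - v 0 i| <= enorm (u - v).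
Proof. by have := coord_le_enorm (u - v) i; rewrite !mxE. Qed.

End Euclid.

Section ConvexSmooth.
Variables (R : realType) (d : nat) (f : 'rV[R]_d -> R) (beta : R).
Hypotheses (cf : convex_fun f) (beta0 : 0 <= beta) (sf : smooth_fun beta f).
Implicit Types (x y v w : 'rV[R]_d).

Lemma diff_dotv x v : 'd f x v = dotv (gradf f x) v.
Proof.
rewrite {1}[v]row_sum_delta linear_sum /dotv; apply: eq_bigr => i _.
by rewrite linearZ /= mxE mulrC.
Qed.

Local Opaque gradf.

(** By convexity the difference quotient of [f] along [y - x], at a step [h] in (0, 1], is at most
    [f y - f x]; [h] then tends to 0 from the right. *)
Lemma convex_grad_le x y : f x + dotv (gradf f x) (y - x) <= f y.
Proof.
have df := sf.1 x.
rewrite -diff_dotv -(deriveE _ df).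
have hD : h^-1 *: (f (h *: (y - x) + x) - f x) @[h --> 0^'] --> 'D_(y - x) f x.
  exact/diff_derivable.
have hR := cvg_dnbhs_at_right hD.
rewrite -lerBrDl -(cvg_lim (@norm_hausdorff _ R^o) hR).
apply: limr_le; first by apply/cvg_ex; eexists; exact: hR.
near=> h.
have h0 : 0 < h by [].
have h1 : h <= 1 by near: h; exact: nbhs_right_le.
rewrite [_ *: _]mulrC ler_pdivrMr // mulrC.
have := @cf x y h; rewrite (ltW h0) h1 => /(_ isT).
have -> : (1 - h) *: x + h *: y = h *: (y - x) + x.
  by rewrite scalerBl scale1r scalerBr [LHS]addrC addrA addrAC.
by move=> ?; nra.
Unshelve. all: by end_near. Qed.

(** Convexity at [y] bounds [f y - f x] by [dotv (gradf f y) (y - x)], and the Lipschitz gradient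
    moves the base point to [x]. This avoids integrating along the segment and costs the factor
    [beta] in place of [beta / 2]. *)
Lemma smooth_le x y :
  f y <= f x + dotv (gradf f x) (y - x) + beta * enorm (y - x) ^+ 2.
Proof.
have := convex_grad_le y x.
have h1 := le_trans (ler_norm _) (dotv_le (gradf f y - gradf f x) (y - x)).
have h2 := ler_wpM2r (enorm_ge0 (y - x)) (sf.2 y x).
have := le_trans h1 h2.
clear h1 h2.
move: (gradf f x) (gradf f y) (opprB x y) => gx gy e.
have {}e : dotv gy (y - x) = - dotv gy (x - y) by rewrite -e dotvNr.
have e2 : dotv (gy - gx) (y - x) = dotv gy (y - x) - dotv gx (y - x).
  by rewrite dotvDl dotvNl.
rewrite e2 e.
move: (dotv gx _) (dotv gy _) (enorm _) (f x) (f y) => *.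
by rewrite expr2; lra.
Qed.

Variable wstar : 'rV[R]_d.
Hypothesis minf : forall w, f wstar <= f w.

Lemma gradf_min : gradf f wstar = 0.
Proof.
apply: dotv_eq0; apply/eqP; rewrite eq_le dotv_ge0 andbT.
(* A gradient step of this length would go below the minimum unless the gradient vanishes;
   [beta + 1] makes the step meaningful for [beta = 0] too. *)
set s := (2 * (beta + 1))^-1.
have := le_trans (minf _) (smooth_le wstar (wstar - s *: gradf f wstar)).
rewrite [_ - _ - _]addrC addKr dotvNr dotvZr enormN enormZ exprMn sqr_enorm.
rewrite real_normK ?num_real//.
set z := dotv _ _ => h.
have b0 := beta0.
have s0 : 0 < s by rewrite invr_gt0; lra.
have hs : s * (2 * (beta + 1)) = 1 by apply: mulVf; apply: lt0r_neq0; lra.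
have h2 : s * ((1 - beta * s) * z) <= 0 by move: (f wstar) h => *; lra.
rewrite pmulr_rle0 // in h2.
have h3 : 0 < 1 - beta * s by nra.
by rewrite pmulr_rle0 // in h2.
Qed.

Lemma enorm_gradf_le x : enorm (gradf f x) <= beta * enorm (x - wstar).
Proof. by have := sf.2 x wstar; rewrite gradf_min subr0. Qed.

(** By [smooth_le], a gradient step of length 1 / (2 beta) gains |grad|^2 / (4 beta), and the value
    cannot fall below the minimum. For [beta = 0] the gradient is zero. *)
Lemma sqr_enorm_gradf_le x : enorm (gradf f x) ^+ 2 <= 4 * beta * (f x - f wstar).
Proof.
have [b0|bn0] := eqVneq beta 0.
  have := enorm_gradf_le x; rewrite b0 mul0r mulr0 mul0r.
  move=> /(conj (enorm_ge0 (gradf f x)))/andP/le_anti <-.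
  by rewrite expr0n.
have bp : 0 < beta by rewrite lt_neqAle eq_sym bn0.
have := le_trans (minf _) (smooth_le x (x - (2 * beta)^-1 *: gradf f x)).
rewrite [_ - _ - _]addrC addKr dotvNr dotvZr enormN enormZ exprMn -sqr_enorm.
rewrite real_normK ?num_real//.
set z := enorm _ ^+ 2 => h.
have -> : z = 4 * beta * ((2 * beta)^-1 * z - beta * ((2 * beta)^-1 ^+ 2 * z)).
  by field.
by rewrite ler_pM2l; lra.
Qed.

Lemma convex_avg_le (w : nat -> 'rV[R]_d) (n : nat) :
  f (n.+1%:R^-1 *: \sum_(1 <= t < n.+2) w t)
    <= n.+1%:R^-1 * \sum_(1 <= t < n.+2) f (w t).
Proof.
elim: n => [|n IH]; first by rewrite !big_nat1 invr1 scale1r mul1r.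
rewrite big_nat_recr//= [X in _ <= _ * X]big_nat_recr//=.
set S := \sum_(1 <= t < n.+2) w t in IH *.
set S' := \sum_(1 <= t < n.+2) f (w t) in IH *.
have n0 : n.+1%:R != 0 :> R by rewrite pnatr_eq0.
have m0 : n.+2%:R != 0 :> R by rewrite pnatr_eq0.
have nE : n.+2%:R = n.+1%:R + 1 :> R by rewrite -natr1.
have aux : (1 - n.+2%:R^-1) / n.+1%:R = n.+2%:R^-1 :> R.
  by move: n0 m0; rewrite nE; move: (n.+1%:R : R) => a a0 a1; field; rewrite ?a0 ?a1.
have := @cf (n.+1%:R^-1 *: S) (w n.+2) (n.+2%:R^-1).
rewrite invr_ge0 ler0n invf_le1 ?ltr0n// ler1n => /(_ isT).
rewrite scalerA aux -scalerDr => h; apply: (le_trans h).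
have hp : 0 <= 1 - n.+2%:R^-1 :> R.
  by rewrite subr_ge0 invf_le1 ?ltr0n// ler1n.
have h2 := ler_wpM2l hp IH.
by rewrite mulrDr lerD2r (le_trans h2)// mulrA aux.
Qed.

(** [|u|] is the maximum norm, which defines the topology on rows. The crude factor, positive also
    for [d = 0], suffices for continuity. *)
Lemma enorm_le_norm (u : 'rV[R]_d) : enorm u <= d.+1%:R * `|u|.
Proof.
rewrite -(@ler_pXn2r _ 2) ?nnegrE ?enorm_ge0 ?mulr_ge0// sqr_enorm exprMn.
apply: (@le_trans _ _ (\sum_(i < d) `|u| ^+ 2)).
  apply: ler_sum => i _; rewrite -expr2 -(real_normK (num_real _)).
  rewrite ler_pXn2r ?nnegrE//.
  by rewrite [leRHS]mx_normrE; exact: (le_bigmax _ (fun ij => `|u ij.1 ij.2|) (0, i)).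
rewrite sumr_const card_ord -[leLHS]mulr_natl ler_wpM2r ?sqr_ge0//.
by rewrite -natrX ler_nat; lia.
Qed.

Lemma continuous_gradf i : continuous (fun x => gradf f x 0 i).
Proof.
move=> x; apply/(@cvgrPdist_le _ R^o _ (nbhs x) (nbhs_filter x)) => e e0 /=.
have b1 : 0 < beta + 1 by rewrite ltr_wpDl.
apply/nbhs_ballP; exists (((beta + 1) * d.+1%:R)^-1 * e) => /=.
  by rewrite mulr_gt0// invr_gt0 mulr_gt0.
move=> y; rewrite mx_norm_ball /ball_ /= => /ltW hxy.
rewrite ler_pdivlMl ?mulr_gt0// -mulrA in hxy; apply: le_trans hxy.
apply: (le_trans (coord_dist_le_enorm _ _ _)); apply: (le_trans (sf.2 x y)).
have h1 := enorm_le_norm (x - y); have h2 := enorm_ge0 (x - y).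
apply: (@le_trans _ _ ((beta + 1) * enorm (x - y))); last by rewrite ler_pM2l.
by rewrite ler_wpM2r// lerDl.
Qed.

End ConvexSmooth.

(** * Conditional means and concentration *)

Section Measurability.
Variables (R : realType) (dO : measure_display) (Omega : measurableType dO).

Lemma measurable_floor_eq (u : Omega -> R) (k : int) :
  measurable_fun setT u -> measurable [set x | Num.floor (u x) = k].
Proof.
move=> mu.
have mf : measurable_fun setT (fun r : R => (Num.floor r)%:~R : R).
  apply: nondecreasing_measurable => // a b ab.
  by rewrite ler_int; exact: le_floor.
have := measurableT_comp mf mu => /(_ measurableT [set k%:~R] (measurable_set1 _)).
rewrite setTI; congr measurable; apply/seteqP; split => x /=.
  by move=> /eqP; rewrite eqr_int => /eqP.
by move=> ->.
Qed.

Lemma measurable_sum_nat (h : nat -> Omega -> R) (n : nat) :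
  (forall s, (1 <= s <= n)%N -> measurable_fun setT (h s)) ->
  measurable_fun setT (fun x => \sum_(1 <= s < n.+1) h s x).
Proof.
elim: n => [|n IH] mh; first by under eq_fun do rewrite big_geq//; exact: measurable_cst.
under eq_fun do rewrite big_nat_recr//=.
apply: measurable_funD; last by apply: mh; rewrite leqnn.
by apply: IH => s /andP[s1 sn]; apply: mh; rewrite s1 leqW.
Qed.

Lemma floor_div_dist (m : nat) (r : R) :
  `|r - (Num.floor (m.+1%:R * r))%:~R / m.+1%:R| <= m.+1%:R^-1.
Proof.
have m0 : 0 < m.+1%:R :> R by rewrite ltr0n.
have := floor_itv (m.+1%:R * r) => /andP[h1 h2].
have -> : r - (Num.floor (m.+1%:R * r))%:~R / m.+1%:R
  = (m.+1%:R * r - (Num.floor (m.+1%:R * r))%:~R) / m.+1%:R.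
  by field; rewrite lt0r_neq0.
rewrite normrM [X in _ * X]ger0_norm ?invr_ge0 ?ler0n//.
rewrite ler_pdivrMr// mulVf ?lt0r_neq0//.
rewrite ger0_norm ?subr_ge0//.
by move: h2; rewrite intrD => h2; lra.
Qed.

(** Only the coordinates of [u] are known to be measurable. Rounding them down to a grid of mesh 1 /
    (n + 1) gives a map with countably many values, each taken on a measurable set; by continuity
    [h] of the rounded maps converges pointwise. *)
Lemma measurable_continuous_rV (d : nat) (h : 'rV[R]_d -> R) (u : Omega -> 'rV[R]_d) :
  continuous h -> (forall i, measurable_fun setT (fun x => u x 0 i)) ->
  measurable_fun setT (h \o u).
Proof.
move=> ch mu.
pose un (n : nat) (k : 'rV[int]_d) : 'rV[R]_d := \row_i ((k 0 i)%:~R / n.+1%:R).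
pose kn (n : nat) x : 'rV[int]_d := \row_i Num.floor (n.+1%:R * u x 0 i).
apply: (@measurable_fun_cvg _ _ _ _ (fun n x => h (un n (kn n x)))).
  move=> n _ B mB; rewrite setTI.
  pose A (k : 'rV[int]_d) := if h (un n k) \in B then
    \bigcap_(i in [set: 'I_d]) [set x | Num.floor (n.+1%:R * u x 0 i) = k 0 i]
    else set0.
  have -> : (fun x => h (un n (kn n x))) @^-1` B = \bigcup_k A k.
    apply/seteqP; split => x /=.
      move=> Bx; exists (kn n x) => //; rewrite /A mem_set// => i _ /=.
      by rewrite mxE.
    move=> [k _]; rewrite /A; case: ifPn => // /set_mem Bk hk.
    suff -> : kn n x = k by [].
    by apply/rowP => i; rewrite mxE; exact: hk.
  apply: countable_bigcupT_measurable => [|k]; first exact: countableP.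
  rewrite /A; case: ifP => // _; apply: fin_bigcap_measurable => // i _.
  by apply: measurable_floor_eq; exact: measurable_funM.
move=> x _; apply: (continuous_cvg _ (ch (u x))).
apply/cvg_ballP => e e0; near=> n; rewrite mx_norm_ball /ball_ /=.
apply: (@le_lt_trans _ _ n.+1%:R^-1); last first.
  by near: n; exact: near_infty_natSinv_lt (PosNum e0).
rewrite [leLHS]mx_normrE; apply/bigmax_leP; split; first by rewrite invr_ge0.
by move=> [i j] _ /=; rewrite !mxE ord1; exact: floor_div_dist.
Unshelve. all: by end_near. Qed.

End Measurability.

(** * Orthogonality of centred variables to functions of the past *)

Section ConditionalMean.
Variables (R : realType) (dO : measure_display) (Omega : measurableType dO).
Variables (P : probability Omega R) (G : set (set Omega)).
Hypothesis sG : forall A, <<s G >> A -> measurable A.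

Lemma measurable_sub_sigma (W : Omega -> R) :
  measurable_fun (setT : set (g_sigma_algebraType G)) W ->
  measurable_fun (setT : set Omega) W.
Proof. by move=> mW _ B mB; apply: sG; exact: mW. Qed.

Lemma bounded_le (W : Omega -> R) (B : R) :
  (forall x, `|W x| <= B) -> [bounded W x | x in (setT : set Omega)].
Proof.
move=> WB; exists B; split; first exact: num_real.
by move=> M /ltW BM x _; exact: le_trans (WB x) BM.
Qed.

Lemma integrable_bounded (W : Omega -> R) (B : R) : measurable_fun setT W ->
  (forall x, `|W x| <= B) -> P.-integrable setT (EFin \o W).
Proof.
move=> mW WB; apply: (measurable_bounded_integrable measurableT _ mW).
  by apply: (le_lt_trans (probability_le1 P measurableT)); rewrite ltry.
exact: bounded_le WB.
Qed.

Lemma integrable_bM (V W : Omega -> R) (B : R) :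
  P.-integrable setT (EFin \o V) -> measurable_fun setT W ->
  (forall x, `|W x| <= B) -> P.-integrable setT (fun x => (W x * V x)%:E).
Proof.
move=> iV mW WB.
by have := integrableMr measurableT mW (bounded_le WB) iV.
Qed.

(* The identity for indicators extends to W by uniform approximation with the
   step functions floor(m W) / m. *)
Lemma integral_adapted_eq0 (V W : Omega -> R) (B : R) :
  P.-integrable setT (EFin \o V) ->
  (forall A, <<s G >> A -> (\int[P]_(x in A) (V x)%:E = 0)%E) ->
  measurable_fun (setT : set (g_sigma_algebraType G)) W ->
  (forall x, `|W x| <= B) ->
  (\int[P]_x (W x * V x)%:E = 0)%E.
Proof.
move=> iV V0 mW WB.
have mV : measurable_fun setT V by exact/measurable_EFinP/(measurable_int P iV).
have B0 : 0 <= B by exact: le_trans (WB point).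
have zero (A : set Omega) (c : R) : <<s G >> A ->
    P.-integrable setT (fun x => (c * \1_A x * V x)%:E) /\
    (\int[P]_x (c * \1_A x * V x)%:E = 0)%E.
  move=> sA; have mA := sG sA.
  have mi : measurable_fun setT (fun x => \1_A x : R) by exact: measurable_indic.
  have iA : P.-integrable setT (fun x => (\1_A x * V x)%:E).
    apply: (@integrable_bM _ _ 1) => // x.
    by rewrite ger0_norm ?indicE ?ler0n// lern1 leq_b1.
  split.
    have := integrableZl measurableT c iA.
    by apply: eq_integrable => // x _; rewrite -EFinM mulrA.
  under eq_integral do rewrite -mulrA EFinM.
  rewrite integralZl//.
  have -> : (\int[P]_x (\1_A x * V x)%:E = \int[P]_(x in A) (V x)%:E)%E.
    rewrite [RHS]integral_mkcond; apply: eq_integral => x _.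
    rewrite patchE indicE; case: ifP => _; by rewrite ?mul1r ?mul0r.
  by rewrite V0// mule0.
have appr (m : nat) : (`|\int[P]_x (W x * V x)%:E| <=
    m.+1%:R^-1%:E * \int[P]_x `|(V x)%:E|)%E.
  (* The shift by [B] makes all floors nonnegative and [N] exceeds them, so the step function is a
     finite combination of indicators of events of the past. *)
  pose N := `|Num.floor (m.+1%:R * (2 * B))|%N.+1.
  pose W' x : R := \sum_(j < N) (j%:R / m.+1%:R - B) *
    \1_[set x | Num.floor (m.+1%:R * (W x + B)) = j%:Z] x.
  have W'E x : W' x = (Num.floor (m.+1%:R * (W x + B)))%:~R / m.+1%:R - B.
    have /andP[Wl Wu] : - B <= W x <= B by rewrite -ler_norml.
    have z0 : 0 <= m.+1%:R * (W x + B) by rewrite mulr_ge0//; lra.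
    have zu : m.+1%:R * (W x + B) <= m.+1%:R * (2 * B) by rewrite ler_pM2l//; lra.
    have := le_floor zu; have := z0; rewrite -floor_ge0.
    rewrite /W'; set fl := Num.floor (_ * (W x + B)) => fl0 flu.
    have aN : (`|fl| < N)%N by rewrite /N; lia.
    rewrite (bigD1 (Ordinal aN))//= big1 => [|j jn].
      rewrite addr0 indicE mem_set/=; last by rewrite -/fl; lia.
      by rewrite mulr1; congr (_ / _ - _); rewrite -[LHS]mulrz_nat; congr (_%:~R); lia.
    rewrite indicE memNset ?mulr0//= => e; move/eqP: jn; apply.
    by apply: val_inj => /=; rewrite /fl e; lia.
  have [iW' zW'] : P.-integrable setT (fun x => (W' x * V x)%:E) /\
    (\int[P]_x (W' x * V x)%:E = 0)%E.
    have mA j : <<s G >> [set x | Num.floor (m.+1%:R * (W x + B)) = j%:Z].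
      apply: (@measurable_floor_eq _ _ (g_sigma_algebraType G)).
      by apply: measurable_funM => //; exact: measurable_funD.
    rewrite /W'; clear W'E W'; elim: N => [|n [iIH IH]].
      split; first by under eq_fun do rewrite big_ord0 mul0r; exact: integrable0.
      by under eq_integral do rewrite big_ord0 mul0r; exact: integral0.
    have [i1 I1] := zero _ (n%:R / m.+1%:R - B) (mA n).
    split.
      have := integrableD measurableT iIH i1; apply: eq_integrable => // x _.
      by rewrite /= -EFinD -mulrDl big_ord_recr.
    under eq_integral do rewrite big_ord_recr mulrDl EFinD.
    by rewrite integralD// IH I1 adde0.
  have mW0 := measurable_sub_sigma mW.
  have iWV := integrable_bM iV mW0 WB.
  have iD := integrableB measurableT iWV iW'.
  have -> : (\int[P]_x (W x * V x)%:E =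
      \int[P]_x ((W x * V x)%:E - (W' x * V x)%:E))%E.
    by rewrite integralB// zW' sube0.
  apply: (le_trans (le_abse_integral _ measurableT (measurable_int _ iD))).
  rewrite -ge0_integralZl//; last exact/measurableT_comp/measurable_EFinP.
  apply: ge0_le_integral => //.
  - exact/measurableT_comp/(measurable_int _ iD).
  - by apply: measurable_funeM; exact/measurableT_comp/measurable_EFinP.
  move=> x _; rewrite -EFinB -mulrBl /= normrM -EFinM lee_fin ler_wpM2r//.
  rewrite W'E opprB addrA; exact: floor_div_dist.
have iWV := integrable_bM iV (measurable_sub_sigma mW) WB.
have fI := integrable_fin_num measurableT iWV.
have fV := integrable_fin_num measurableT (integrable_abse iV).
rewrite -(fineK fI); congr EFin; apply/eqP; rewrite -normr_eq0; apply/eqP.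
apply/le_anti/andP; split => //; rewrite leNgt; apply/negP => a0.
move: appr; rewrite -(fineK fI) -(fineK fV).
set a := `|fine _| in a0; set r := fine (\int[P]_x (abse \o (EFin \o V)) x)%E => appr.
have {}appr m : a * m.+1%:R <= r.
  have := appr m; rewrite /= -EFinM lee_fin -/a => h.
  by rewrite -ler_pdivlMr ?ltr0n// mulrC.
have r0 : 0 <= r by rewrite (le_trans _ (appr 0%N))// mulr1 ltW.
have := archi_boundP (divr_ge0 r0 (ltW a0)); rewrite ltr_pdivrMr// => h.
have := le_lt_trans (appr (Num.bound (r / a))) h.
by rewrite mulrC ltr_pM2r// ltr_nat ltnNge leqnSn.
Qed.

End ConditionalMean.

(** The inequality e^z >= 1 + z at z = 2 y^2 - y reduces the claim to (1 + y)(1 - y + 2 y^2) = 1 +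
    y^2 (1 + 2 y) >= 1. *)
Lemma expR_le_1D (R : realType) (y : R) :
  - 2^-1 <= y -> expR (y - 2 * y ^+ 2) <= 1 + y.
Proof.
move=> h; have h1 := expR_ge1Dx (2 * y ^+ 2 - y).
have y1 : 0 < 1 + y by lra.
rewrite -[y - _]opprB expRN invf_ple ?posrE ?expR_gt0//.
apply: le_trans h1; rewrite -[_^-1]mul1r ler_pdivrMr//.
have h2 : 0 <= 1 + 2 * y by lra.
have := mulr_ge0 (sqr_ge0 y) h2.
by rewrite !expr2 => *; lra.
Qed.

(** * Exponential inequality with the empirical quadratic variation *)

Section Concentration.
Variables (R : realType) (dO : measure_display) (Omega : measurableType dO).
Variables (P : probability Omega R) (G : nat -> set (set Omega)) (T : nat).
Variable V : nat -> Omega -> R.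
Hypothesis mV : forall n, (1 <= n <= T)%N -> measurable_fun setT (V n).
Hypothesis bV : forall n x, `|V n x| <= 2^-1.
Hypothesis aV : forall n s, (1 <= n <= T)%N -> (1 <= s < n)%N ->
  measurable_fun (setT : set (g_sigma_algebraType (G n))) (V s).
Hypothesis oV : forall n (W : Omega -> R) (B : R), (1 <= n <= T)%N ->
  measurable_fun (setT : set (g_sigma_algebraType (G n))) W ->
  (forall x, `|W x| <= B) -> (\int[P]_x (W x * V n x)%:E = 0)%E.

Let Z n x : R := \prod_(1 <= s < n.+1) (1 + V s x).

Let Z0 : Z 0%N = cst 1.
Proof. by apply/funext => x; rewrite /Z big_geq. Qed.

Let ZS n : Z n.+1 = (fun x => Z n x * (1 + V n.+1 x)).
Proof. by apply/funext => x; rewrite /Z big_nat_recr. Qed.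

Let Z_ge0 n x : 0 <= Z n x.
Proof.
apply: prodr_ge0 => s _; have := bV s x; rewrite ler_norml => /andP[h _].
by move: (V s x) h => v h; lra.
Qed.

Let Z_le n x : `|Z n x| <= 2 ^+ n.
Proof.
rewrite ger0_norm//.
elim: n => [|n IH]; first by rewrite /Z big_geq.
rewrite /Z big_nat_recr//= exprSr -/(Z n x).
apply: ler_pM => //; have := bV n.+1 x; rewrite ler_norml => /andP[];
  move: (V n.+1 x) => v *; lra.
Qed.

Let Z_meas n : (n <= T)%N -> measurable_fun setT (Z n).
Proof.
elim: n => [|n IH] nT; first by rewrite Z0.
rewrite ZS.
by apply: measurable_funM; [exact/IH/ltnW|apply: measurable_funD => //; exact: mV].
Qed.

(** [Z n] is bounded and measurable for the past of time [n + 1], so [oV] kills the integral of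
    [Z n * V n.+1]. *)
Let integral_Z n : (n <= T)%N -> (\int[P]_x (Z n x)%:E = 1)%E.
Proof.
elim: n => [|n IH] nT.
  rewrite Z0.
  rewrite -[LHS]/(\int[P]_x (cst 1%E x))%E.
  rewrite integral_cst//= mul1e. exact: probability_setT.
have n1 : (1 <= n.+1 <= T)%N by rewrite nT.
have mZ := Z_meas (ltnW nT).
have aZ : measurable_fun (setT : set (g_sigma_algebraType (G n.+1))) (Z n).
  suff h m : (m <= n)%N ->
      measurable_fun (setT : set (g_sigma_algebraType (G n.+1))) (Z m) by exact: h.
  elim: m => [|m IHm] mn; first by rewrite Z0.
  rewrite ZS; apply: measurable_funM; first exact: (IHm (ltnW mn)).
  by apply: measurable_funD; [exact: measurable_cst|exact: (@aV n.+1 m.+1 n1 mn)].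
have ZV0 := oV n1 aZ (Z_le n).
have iZ := integrable_bounded P mZ (Z_le n).
have iZV := integrable_bM (integrable_bounded P (mV n1) (bV n.+1)) mZ (Z_le n).
transitivity (\int[P]_x ((Z n x)%:E + (Z n x * V n.+1 x)%:E))%E.
  by apply: eq_integral => x _; rewrite ZS mulrDr mulr1 EFinD.
by rewrite (integralD measurableT iZ iZV) ZV0 adde0; exact: (IH (ltnW nT)).
Qed.

(** Applied to each factor, [expR_le_1D] gives [Z n >= expR l] on the event; Markov's inequality and
    the mean 1 of [Z n] conclude. *)
Lemma product_concentration (l : R) n : (n <= T)%N ->
  (P [set x | (l < \sum_(1 <= s < n.+1) (V s x - 2 * V s x ^+ 2))%R]
    <= (expR (- l))%:E)%E.
Proof.
move=> nT.
have mZ := Z_meas nT.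
have := @le_integral_abse _ _ _ P _ measurableT (EFin \o Z n) (expR l).
have -> : (\int[P]_x `|(EFin \o Z n) x| = 1)%E.
  by rewrite -(integral_Z nT); apply: eq_integral => x _ /=; rewrite ger0_norm.
move=> /(_ _ (expR_gt0 l)) mk.
have {}mk := mk (proj2 (measurable_EFinP _ _) mZ).
have sub : [set x | l < \sum_(1 <= s < n.+1) (V s x - 2 * V s x ^+ 2)] `<=`
    setT `&` [set x | ((expR l)%:E <= `|(EFin \o Z n) x|)%E].
  move=> x /= /ltW lx; split => //.
  rewrite lee_fin ger0_norm//.
  apply: (@le_trans _ _ (expR (\sum_(1 <= s < n.+1) (V s x - 2 * V s x ^+ 2)))).
    by rewrite ler_expR.
  rewrite expR_sum; apply: ler_prod => s _; rewrite expR_ge0/= expR_le_1D//.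
  by have := bV s x; rewrite ler_norml => /andP[].
have mset : measurable (setT `&` [set x | ((expR l)%:E <= `|(EFin \o Z n) x|)%E]).
  apply: emeasurable_fun_c_infty => //.
  by apply: measurableT_comp => //; exact/measurable_EFinP.
have m1 : measurable [set x | l < \sum_(1 <= s < n.+1) (V s x - 2 * V s x ^+ 2)].
  have mS : measurable_fun setT (fun x => \sum_(1 <= s < n.+1) (V s x - 2 * V s x ^+ 2)).
    apply: measurable_sum_nat => s /andP[s1 sn].
    have mVs : measurable_fun setT (V s) by apply: mV; rewrite s1 (leq_trans sn).
    apply: measurable_funB => //; apply: measurable_funM => //.
    exact: measurable_funX.
  have := measurable_fun_ltr (@measurable_cst _ _ _ _ setT l) mS.
  move=> /(_ measurableT [set true] I).
  by rewrite setTI.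
apply: (le_trans (le_measure P _ _ sub)); rewrite ?inE//.
by rewrite expRN -[leRHS]mule1 lee_pdivlMl ?expR_gt0.
Qed.

End Concentration.

(** * Real inequalities *)

Section RealInequalities.
Variable R : realType.
Implicit Types (a b c : nat -> R).

Lemma distV_le (A B X : R) : 0 < A -> 0 < B ->
  `|A ^+ 2 - B ^+ 2| <= X * (A + B) -> `|B^-1 - A^-1| <= X / (A * B).
Proof.
move=> A0 B0 h.
have AB : 0 < A + B by rewrite addr_gt0.
have -> : B^-1 - A^-1 = (A - B) / (A * B).
  by field; rewrite !gt_eqF.
rewrite normrM [X in _ * X <= _]gtr0_norm ?invr_gt0 ?mulr_gt0//.
rewrite ler_pM2r ?invr_gt0 ?mulr_gt0// -(ler_pM2r AB).
by rewrite -{1}(gtr0_norm AB) -normrM -subr_sqr.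
Qed.

(** The price of exchanging the true step size for the surrogate in the descent inequality: [G] is
    the past sum, [al] the norm of g_t, [nu] that of the gradient. Half of the predictable drift is
    given up; the rest is a ratio whose sum over time is logarithmic. *)
Lemma decorrelation_le (G al nu s0 s1 : R) : 0 < G -> 0 <= al -> 0 <= nu ->
  0 <= s0 -> 0 <= s1 -> al ^+ 2 <= 2 * (s0 ^+ 2 + (1 + s1 ^+ 2) * nu ^+ 2) ->
  `|(Num.sqrt (G + (s0 ^+ 2 + (1 + s1 ^+ 2) * nu ^+ 2)))^-1
      - (Num.sqrt (G + al ^+ 2))^-1| * (nu * al)
  <= 2^-1 * nu ^+ 2 / Num.sqrt (G + (s0 ^+ 2 + (1 + s1 ^+ 2) * nu ^+ 2))
     + (s0 + 2 * (1 + s1) * nu) * (al ^+ 2 / (G + al ^+ 2)).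
Proof.
move=> G0 al0 nu0 s00 s10 hal.
set H2 := s0 ^+ 2 + _ in hal *.
have H20 : 0 <= H2 by rewrite addr_ge0 ?sqr_ge0// mulr_ge0 ?sqr_ge0// addr_ge0 ?sqr_ge0.
set A := Num.sqrt (G + al ^+ 2); set B := Num.sqrt (G + H2).
pose H := Num.sqrt H2.
have A2 : A ^+ 2 = G + al ^+ 2 by rewrite sqr_sqrtr// addr_ge0 ?sqr_ge0// ltW.
have B2 : B ^+ 2 = G + H2 by rewrite sqr_sqrtr// addr_ge0// ltW.
have HH : H ^+ 2 = H2 by rewrite sqr_sqrtr.
have A0 : 0 < A by rewrite sqrtr_gt0 ltr_pwDl ?sqr_ge0.
have B0 : 0 < B by rewrite sqrtr_gt0 ltr_pwDl.
have H0 : 0 <= H by exact: sqrtr_ge0.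
have HB : H <= B by rewrite ler_wsqrtr// lerDr ltW.
have Hs : H <= s0 + (1 + s1) * nu.
  rewrite -(@ler_pXn2r _ 2) ?nnegrE ?addr_ge0 ?mulr_ge0 ?addr_ge0// HH /H2.
  have := mulr_ge0 (mulr_ge0 s00 nu0) (addr_ge0 ler01 s10).
  have := mulr_ge0 s10 (sqr_ge0 nu).
  by rewrite !expr2 => *; lra.
have s0B : s0 <= B.
  apply: le_trans HB; rewrite -(@ler_pXn2r _ 2) ?nnegrE// HH /H2 lerDl.
  by rewrite mulr_ge0 ?sqr_ge0// addr_ge0 ?sqr_ge0.
have s1B : (1 + s1) * nu <= 2 * B.
  apply: (@le_trans _ _ (2 * H)); last by rewrite ler_pM2l.
  rewrite -(@ler_pXn2r _ 2) ?nnegrE ?addr_ge0 ?mulr_ge0 ?addr_ge0//.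
  rewrite [leRHS]exprMn HH /H2 [leLHS]exprMn.
  have h1 : (1 + s1) ^+ 2 <= 4 * (1 + s1 ^+ 2).
    by have := sqr_ge0 (1 - s1); have := sqr_ge0 s1; rewrite !expr2 => *; lra.
  have := ler_wpM2r (sqr_ge0 nu) h1; have := sqr_ge0 s0.
  by move: (s0 ^+ 2) (nu ^+ 2) => *; rewrite expr2; lra.
have d : `|B^-1 - A^-1| <= H / (A * B).
  apply: distV_le => //; rewrite A2 B2.
  have -> : G + al ^+ 2 - (G + H2) = al ^+ 2 - H2 by lra.
  apply: (@le_trans _ _ H2).
    by rewrite ler_norml; have := sqr_ge0 al; move: (al ^+ 2) hal => *; lra.
  by rewrite -HH expr2 ler_wpM2l// (le_trans HB)// lerDr ltW.
apply: (le_trans (ler_wpM2r (mulr_ge0 nu0 al0) d)).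
rewrite -A2 -expr_div_n.
have -> : H / (A * B) * (nu * al) = H * B^-1 * (al / A) * nu.
  by field; rewrite !gt_eqF.
have y0 : 0 < B^-1 by rewrite invr_gt0.
have sy : s0 * B^-1 <= 1 by rewrite ler_pdivrMr// mul1r.
have ty : (1 + s1) * nu * B^-1 <= 2 by rewrite ler_pdivrMr.
have x0 : 0 <= al / A by rewrite divr_ge0// ltW.
move: (al / A) (B^-1) x0 y0 sy ty => x y x0 y0 sy ty.
apply: (@le_trans _ _ ((s0 + (1 + s1) * nu) * y * x * nu)).
  by rewrite ler_wpM2r// ler_wpM2r// ler_wpM2r// ltW.
(* With x = al / A and y = 1 / B, it remains to bound (s0 + (1 + s1) nu) x y nu. AM-GM on each
   summand leaves y nu^2 / 4, twice; the remaining squares lose their factor y by s0 y <= 1 and (1 +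
   s1) nu y <= 2. *)
have e1 := mulr_ge0 (ltW y0) (sqr_ge0 (nu / 2 - s0 * x)).
have e2 := mulr_ge0 (mulr_ge0 (ltW y0) (sqr_ge0 nu)) (sqr_ge0 (2^-1 - (1 + s1) * x)).
have e3 := ler_wpM2r (mulr_ge0 s00 (sqr_ge0 x)) sy.
have e4 := ler_wpM2r (mulr_ge0 (mulr_ge0 (addr_ge0 ler01 s10) nu0) (sqr_ge0 x)) ty.
move: e1 e2 e3 e4; move: (1 + s1) => s; rewrite !expr2.
by move=> *; lra.
Qed.

(** The surrogate contains no noise parameter, so A^2 - B^2 = (al - nu)(al + nu) is controlled by
    the actual noise [ze]. With al <= A and nu <= B the error is a product (al / A)(ze / B), split
    by AM-GM into two empirical ratios. *)
Lemma decorrelation_dist_le (G al nu ze : R) : 0 < G -> 0 <= al -> 0 <= nu ->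
  `|al - nu| <= ze ->
  2 * (`|(Num.sqrt (G + nu ^+ 2))^-1 - (Num.sqrt (G + al ^+ 2))^-1| * al)
  <= al ^+ 2 / (G + al ^+ 2) + ze ^+ 2 / (G + nu ^+ 2).
Proof.
move=> G0 al0 nu0 h.
set A := Num.sqrt (G + al ^+ 2); set B := Num.sqrt (G + nu ^+ 2).
have A2 : A ^+ 2 = G + al ^+ 2 by rewrite sqr_sqrtr// addr_ge0 ?sqr_ge0// ltW.
have B2 : B ^+ 2 = G + nu ^+ 2 by rewrite sqr_sqrtr// addr_ge0 ?sqr_ge0// ltW.
have A0 : 0 < A by rewrite sqrtr_gt0 ltr_pwDl ?sqr_ge0.
have B0 : 0 < B by rewrite sqrtr_gt0 ltr_pwDl ?sqr_ge0.
have aA : al <= A.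
  by rewrite -(@ler_pXn2r _ 2) ?nnegrE// ?(ltW A0)// A2 lerDr ltW.
have nB : nu <= B.
  by rewrite -(@ler_pXn2r _ 2) ?nnegrE// ?(ltW B0)// B2 lerDr ltW.
have ze0 : 0 <= ze by exact: le_trans h.
have d : `|B^-1 - A^-1| <= ze / (A * B).
  apply: distV_le => //; rewrite A2 B2.
  have -> : G + al ^+ 2 - (G + nu ^+ 2) = (al - nu) * (al + nu) by rewrite !expr2; ring.
  rewrite normrM [X in _ * X]ger0_norm ?addr_ge0//.
  by rewrite ler_pM// ?addr_ge0// lerD.
rewrite -A2 -B2 -!expr_div_n.
apply: (@le_trans _ _ (2 * ((al / A) * (ze / B)))).
  rewrite ler_pM2l//; apply: (le_trans (ler_wpM2r al0 d)).
  suff -> : ze / (A * B) * al = al / A * (ze / B) by [].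
  by field; rewrite !gt_eqF.
move: (al / A) (ze / B) => x y.
by have := sqr_ge0 (x - y); rewrite !expr2 => *; lra.
Qed.

Lemma ln_le_sub1 (x : R) : 0 < x -> ln x <= x - 1.
Proof.
move=> x0; have := expR_ge1Dx (ln x); rewrite lnK ?posrE//.
by move: (ln x) => *; lra.
Qed.

Lemma ratio_le_ln (b a : R) : 0 < b -> 0 <= a -> a / (b + a) <= ln (b + a) - ln b.
Proof.
move=> b0 a0; have ba0 : 0 < b + a by rewrite ltr_pwDl.
have := ln_le_sub1 (divr_gt0 b0 ba0); rewrite ln_div ?posrE//.
have -> : b / (b + a) - 1 = - (a / (b + a)) by field; rewrite gt_eqF.
by move: (ln b) (ln _) (a / _) => *; lra.
Qed.

Lemma sum_ratio_le_ln a (b0 : R) n : 0 < b0 -> (forall s, 0 <= a s) ->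
  \sum_(1 <= s < n.+1) a s / (b0 + \sum_(1 <= r < s.+1) a r)
  <= ln (b0 + \sum_(1 <= r < n.+1) a r) - ln b0.
Proof.
move=> b00 a0; elim: n => [|n IH]; first by rewrite !big_geq// addr0 subrr.
rewrite big_nat_recr//= [X in ln (_ + X)]big_nat_recr//=.
rewrite [X in _ / (_ + X)]big_nat_recr//= !addrA.
set S := b0 + _ in IH *.
have S0 : 0 < S by rewrite ltr_pwDl// sumr_ge0.
have := ratio_le_ln S0 (a0 n.+1).
move: IH; move: (ln _) (ln _) (ln _) => *; lra.
Qed.

Lemma sqrt_ratio_le (b a : R) : 0 <= b -> 0 <= a ->
  a / Num.sqrt (b + a) <= 2 * (Num.sqrt (b + a) - Num.sqrt b).
Proof.
move=> b0 a0.
have [->|ba] := eqVneq a 0; first by rewrite mul0r addr0 subrr mulr0.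
have a1 : 0 < a by rewrite lt_neqAle eq_sym ba.
set A := Num.sqrt (b + a); set B := Num.sqrt b.
have A0 : 0 < A by rewrite sqrtr_gt0 ltr_wpDl.
rewrite ler_pdivrMr//.
have A2 : A ^+ 2 = b + a by rewrite sqr_sqrtr// addr_ge0.
have B2 : B ^+ 2 = b by rewrite sqr_sqrtr.
have := sqr_ge0 (A - B); move: A2 B2; rewrite !expr2 => *; lra.
Qed.

Lemma sqrtD_le (x y : R) : 0 <= x -> 0 <= y ->
  Num.sqrt (x + y) <= Num.sqrt x + Num.sqrt y.
Proof.
move=> x0 y0; rewrite -(@ler_pXn2r _ 2) ?nnegrE ?addr_ge0 ?sqrtr_ge0//.
rewrite sqr_sqrtr ?addr_ge0// sqrrD !sqr_sqrtr//.
have := mulr_ge0 (sqrtr_ge0 x) (sqrtr_ge0 y).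
by move: (_ * _) => *; rewrite mulr2n; lra.
Qed.

Lemma sum_sqrt_ratio_le a (b0 : R) n : 0 <= b0 -> (forall s, 0 <= a s) ->
  \sum_(1 <= s < n.+1) a s / Num.sqrt (b0 + \sum_(1 <= r < s.+1) a r)
  <= 2 * (Num.sqrt (b0 + \sum_(1 <= r < n.+1) a r) - Num.sqrt b0).
Proof.
move=> b00 a0; elim: n => [|n IH]; first by rewrite !big_geq// addr0 subrr mulr0.
rewrite big_nat_recr//= [X in Num.sqrt (_ + X) - _]big_nat_recr//=.
rewrite [X in _ / Num.sqrt (_ + X)]big_nat_recr//= !addrA.
set S := b0 + _ in IH *.
have S0 : 0 <= S by rewrite addr_ge0// sumr_ge0.
have := sqrt_ratio_le S0 (a0 n.+1).
move: (Num.sqrt S) (Num.sqrt (S + _)) (Num.sqrt b0) (\sum_(1 <= i < n.+1) _ / _) IH.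
by move: (a n.+1) => *; lra.
Qed.

(** Used with [c] the squared noise, [b] the squared gradient and [G] the sum of past squared oracle
    answers. As past noise exceeds [G s] by at most [K * v], each denominator dominates, up to the
    factor [Q], the running sum of [c] shifted by [K * v]. The ratios then telescope
    logarithmically. *)
Lemma sum_noise_ratio_le (b c G : nat -> R) (v g2 K : R) n :
  0 < g2 -> g2 <= v -> 1 <= K ->
  (forall s, 0 <= b s) -> (forall s, 0 <= c s) -> (forall s, g2 <= G s) ->
  (forall s, (1 <= s <= n)%N -> c s <= v) ->
  (forall s, (1 <= s <= n)%N -> \sum_(1 <= r < s) c r <= G s + K * v) ->
  \sum_(1 <= s < n.+1) c s / (G s + b s)
  <= 2 * (1 + 2 * K * (v / g2)) * ln (1 + n%:R).
Proof.
move=> g0 gv K1 b0 c0 Gg cv cG.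
have v0 : 0 < v by exact: lt_le_trans gv.
have Kv : 0 < K * v by rewrite mulr_gt0// (lt_le_trans ltr01).
set Q := 2 * _.
have Q0 : 0 <= Q.
  rewrite mulr_ge0// addr_ge0// mulr_ge0 ?divr_ge0 ?(ltW v0) ?(ltW g0)//.
  by rewrite mulr_ge0// (le_trans ler01).
apply: (@le_trans _ _ (Q * \sum_(1 <= s < n.+1) c s / (K * v + \sum_(1 <= r < s.+1) c r))).
  rewrite mulr_sumr big_nat_cond [leRHS]big_nat_cond.
  apply: ler_sum => s; rewrite andbT => /andP[s1 sn].
  have s1n : (1 <= s <= n)%N by rewrite s1.
  have Gs0 : 0 < G s by exact: lt_le_trans (Gg s).
  have S0 : 0 < K * v + \sum_(1 <= r < s.+1) c r by rewrite ltr_pwDl// sumr_ge0.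
  rewrite mulrCA ler_wpM2l// ler_pdivlMr// ler_pdivrMl; last by rewrite ltr_pwDl.
  rewrite big_nat_recr//=.
  have h1 := cG s s1n; have h2 := cv s s1n.
  have h3 : v <= K * v by rewrite ler_peMl// ltW.
  have h4 : K * v <= K * (v / g2) * G s.
    rewrite -mulrA ler_pM2l ?(lt_le_trans ltr01)// mulrAC ler_pdivlMr// ler_pM2l//.
  have h5 : G s * Q <= (G s + b s) * Q by rewrite ler_wpM2r// lerDl.
  apply: le_trans h5; rewrite /Q.
  move: (\sum_(1 <= r < s) c r) h1 h2 h3 h4; move: (v / g2) (K * v) => *; lra.
rewrite ler_wpM2l//.
apply: (le_trans (sum_ratio_le_ln _ Kv c0)).
rewrite -ln_div ?posrE//; last by rewrite ltr_pwDl// sumr_ge0.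
rewrite ler_ln ?posrE; last 2 first.
- by rewrite divr_gt0// ltr_pwDl// sumr_ge0.
- by rewrite ltr_pwDl.
rewrite ler_pdivrMr// mulrDl mul1r lerD2l.
apply: (@le_trans _ _ (\sum_(1 <= r < n.+1) v)).
  rewrite big_nat_cond [leRHS]big_nat_cond.
  by apply: ler_sum => s; rewrite andbT => sn; apply: cv.
rewrite sumr_const_nat subn1/= -[leLHS]mulr_natl ler_wpM2l//.
by rewrite ler_peMl// ltW.
Qed.

(** Here [x ^+ 2] is the sum of the gaps, [r] is sqrt T, [sa] the root of the sum of squared oracle
    answers and U = D^2 / eta + eta, which dominates [D] and [D * l]. The term 3 U y x costs x^2 / 4
    + 9 U^2 y^2 and a second x^2 / 4 is already present; doubling the remaining half gives 13 = 2 (2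
    + 4 + 1/2) and 86 = 2 (9 + 2 + 32). *)
Lemma regret_algebra (beta s0 s1 eta D l r x y sa c : R) :
  0 <= beta -> 0 <= s0 -> 0 <= s1 -> 0 < eta -> 0 <= D -> 0 <= l -> 0 <= r -> 0 <= sa ->
  beta * (1 + s1 ^+ 2) = y ^+ 2 -> sa <= 2 * s0 * r + 3 * (y * x) ->
  eta * l <= D -> eta <= D ->
  x ^+ 2 <= (2 * eta)^-1 * (c + D ^+ 2 * sa) + eta / 2 * (2 * sa)
    + ((2 * D * (2 * s0 * r + beta * s1 * D) + 32 * beta * s1 ^+ 2 * D ^+ 2) * l
       + (D * s0 * r / 2 + x ^+ 2 / 4)) ->
  x ^+ 2 <= c / eta + 13 * (D ^+ 2 / eta + eta) * s0 * r
    + 86 * (beta * (1 + s1 ^+ 2)) * (D ^+ 2 / eta + eta) ^+ 2.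
Proof.
move=> b0 s00 s10 e0 D0 l0 r0 sa0 yE saE elD eD main.
set U := D ^+ 2 / eta + eta.
have De0 : 0 <= D ^+ 2 / eta by rewrite divr_ge0 ?sqr_ge0// ltW.
have DU : D <= U.
  rewrite (@le_trans _ _ (D ^+ 2 / eta))// ?lerDl ?(ltW e0)// ler_pdivlMr//.
  by rewrite expr2 ler_wpM2l.
have DlU : D * l <= U.
  rewrite (@le_trans _ _ (D ^+ 2 / eta))// ?lerDl ?(ltW e0)// ler_pdivlMr//.
  by rewrite expr2 -mulrA ler_wpM2l// mulrC.
have U0 : 0 <= U by exact: le_trans DU.
have DDlU : D ^+ 2 * l <= U ^+ 2.
  by rewrite !expr2 -mulrA; apply: ler_pM => //; exact: mulr_ge0.
have m1 : (2 * eta)^-1 * (c + D ^+ 2 * sa) = 2^-1 * (c / eta) + 2^-1 * (D ^+ 2 / eta * sa).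
  by field; rewrite gt_eqF.
have m2 : 2^-1 * (D ^+ 2 / eta * sa) + eta * sa <= U * sa.
  by have := mulr_ge0 De0 sa0; rewrite /U; move: (D ^+ 2 / eta) => *; lra.
have m3 := ler_wpM2l U0 saE.
have m4 := sqr_ge0 (2^-1 * x - 3 * U * y).
have m5 : D * l * (s0 * r) <= U * (s0 * r) by rewrite ler_wpM2r// mulr_ge0.
have m6 : D * (s0 * r) <= U * (s0 * r) by rewrite ler_wpM2r// mulr_ge0.
have bs : beta * s1 <= beta * (1 + s1 ^+ 2).
  rewrite ler_wpM2l//; have := sqr_ge0 (s1 - 2^-1); rewrite !expr2 => *; lra.
have bs2 : beta * s1 ^+ 2 <= beta * (1 + s1 ^+ 2) by rewrite ler_wpM2l// lerDr.
have Dl0 : 0 <= D ^+ 2 * l by rewrite mulr_ge0 ?sqr_ge0.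
have m7 : beta * s1 * (D ^+ 2 * l) <= beta * (1 + s1 ^+ 2) * U ^+ 2.
  by apply: ler_pM => //; exact: mulr_ge0.
have m8 : beta * s1 ^+ 2 * (D ^+ 2 * l) <= beta * (1 + s1 ^+ 2) * U ^+ 2.
  by apply: ler_pM => //; rewrite mulr_ge0 ?sqr_ge0.
move: main; rewrite m1.
move: m2 m3 m4 m7 m8; rewrite yE; move: (D ^+ 2 / eta) (c / eta) => p q.
move: (s1 ^+ 2) => s2; clear m1 saE De0 DDlU.
move: U0 m5 m6; clearbody U => U0 m5 m6; rewrite !expr2 => *; lra.
Qed.

Lemma path_sum_algebra (r x y s0 : R) : 0 <= r -> 0 <= x -> 0 <= y -> 0 <= s0 ->
  2 * (r ^+ 2 * s0 ^+ 2) + 8 * y ^+ 2 * x ^+ 2 <= (2 * s0 * r + 3 * (y * x)) ^+ 2.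
Proof.
move=> r0 x0 y0 s00.
have p1 := sqr_ge0 (r * s0); have p2 := sqr_ge0 (y * x).
have p3 := mulr_ge0 (mulr_ge0 s00 r0) (mulr_ge0 y0 x0).
by move: p1 p2 p3; rewrite !expr2 => *; lra.
Qed.

End RealInequalities.

(** * The iteration along one path *)

Ltac nonneg h1 h2 :=
  repeat first [ exact h1 | exact h2 | assumption | exact: ler0n | exact: ler01
    | apply: sqr_ge0 | apply: addr_ge0 | apply: mulr_ge0 ].

Section Path.
Variables (R : realType) (d : nat) (f : 'rV[R]_d -> R) (beta : R).
Variables (wstar w1 : 'rV[R]_d) (eta gamma s0 s1 F D : R) (T : nat).
Variable h : nat -> 'rV[R]_d.

Definition gsum t : R := gamma ^+ 2 + \sum_(1 <= s < t.+1) enorm (h s) ^+ 2.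
Definition iterate t := ada_w eta gamma w1 h t.
Definition grad t := gradf f (iterate t).
Definition noise t := h t - grad t.
Definition subopt t := f (iterate t) - f wstar.
Definition dist t := enorm (iterate t - wstar).

(* Predictable surrogates of the step size, the first for the function values
   and the second for the distances. *)
Definition eta_val t :=
  eta / Num.sqrt (gsum t.-1 + (s0 ^+ 2 + (1 + s1 ^+ 2) * enorm (grad t) ^+ 2)).
Definition eta_dist t := eta / Num.sqrt (gsum t.-1 + enorm (grad t) ^+ 2).

Definition grad_bound := Num.sqrt (4 * beta * F).
(** Bounds the squared noise as long as the gap is at most [F]. The summand [gamma ^+ 2] makes it
    positive and [noise_ratio] at least 1. *)
Definition noise_var := s0 ^+ 2 + s1 ^+ 2 * (4 * beta * F) + gamma ^+ 2.
Definition noise_ratio := noise_var / gamma ^+ 2.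
(** Each [kappa] has two tasks: the truncated increment divided by it must be at most 1/2 in
    absolute value, and [kappa] times twice the square of that quotient must be payable by the terms
    at hand. *)
Definition kappa_val := 4 * eta * (s0 + (1 + s1) * grad_bound).
Definition kappa_dist := 4 * eta * D * noise_ratio.
Definition kappa_reg :=
  2 * D * (2 * s0 * Num.sqrt T%:R + beta * s1 * D) + 32 * beta * s1 ^+ 2 * D ^+ 2.

(* [dotv (dir t) (noise t)] is a martingale increment divided by its [kappa].
   [kappa_val] and [kappa_reg] may vanish, but then so does the increment, in
   agreement with [0^-1 = 0].  In [dir_grad] large gradients are discarded: for
   them [|g_t|^2 >= |xi_t|^2] holds without averaging. *)
Definition dir_val t : 'rV[R]_d :=
  if subopt t <= F then (- (eta_val t / kappa_val)) *: grad t else 0.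
Definition dir_grad t : 'rV[R]_d :=
  if (subopt t <= F) && (enorm (grad t) ^+ 2 <= 16 * noise_var)
  then (- (8 * noise_var)^-1) *: grad t else 0.
Definition dir_dist t : 'rV[R]_d :=
  if (subopt t <= F) && (dist t <= D)
  then (- (2 * eta_dist t / kappa_dist)) *: (iterate t - wstar) else 0.
Definition dir_reg t : 'rV[R]_d :=
  if dist t <= D then (- kappa_reg^-1) *: (iterate t - wstar) else 0.

Local Opaque gradf.

Hypotheses (cf : convex_fun f) (beta0 : 0 <= beta) (sf : smooth_fun beta f).
Hypothesis minf : forall w, f wstar <= f w.
Hypotheses (eta0 : 0 < eta) (gamma0 : 0 < gamma) (s00 : 0 <= s0) (s10 : 0 <= s1).
Hypothesis noise_le : forall t, (1 <= t <= T)%N ->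
  enorm (noise t) ^+ 2 <= s0 ^+ 2 + s1 ^+ 2 * enorm (grad t) ^+ 2.

Lemma gsum_gt0 t : 0 < gsum t.
Proof. by rewrite ltr_pwDl ?exprn_gt0// sumr_ge0// => s _; rewrite sqr_ge0. Qed.

Lemma gsum_ge t : gamma ^+ 2 <= gsum t.
Proof. by rewrite lerDl sumr_ge0// => s _; rewrite sqr_ge0. Qed.

Lemma gsumS t : gsum t.+1 = gsum t + enorm (h t.+1) ^+ 2.
Proof. by rewrite /gsum big_nat_recr//= addrA. Qed.

Lemma iterateS t : (0 < t)%N ->
  iterate t.+1 = iterate t - (eta / Num.sqrt (gsum t)) *: h t.
Proof. by case: t. Qed.

Lemma iterate1 : iterate 1 = w1. Proof. by []. Qed.

Lemma path_noiseK t : h t = grad t + noise t.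
Proof. by rewrite addrC subrK. Qed.

Lemma sqr_enorm_path t : enorm (h t) ^+ 2 =
  enorm (grad t) ^+ 2 + 2 * dotv (grad t) (noise t) + enorm (noise t) ^+ 2.
Proof.
rewrite {1}path_noiseK !sqr_enorm; move: (grad t) (noise t) => u v.
rewrite dotvDl !dotvDr (dotvC v u); ring.
Qed.

Lemma dotv_noise_le t : `|dotv (grad t) (noise t)| <= enorm (grad t) * enorm (noise t).
Proof. exact: dotv_le. Qed.

Lemma sqr_enorm_path_le t : enorm (h t) ^+ 2 <=
  2 * (enorm (grad t) ^+ 2 + enorm (noise t) ^+ 2).
Proof.
have := dotv_noise_le t; rewrite ler_norml => /andP[_].
have := sqr_ge0 (enorm (grad t) - enorm (noise t)).
rewrite sqr_enorm_path.
move: (enorm _) (enorm _) (dotv _ _) => x y z; rewrite !expr2.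
by move=> *; lra.
Qed.

Lemma subopt_ge0 t : 0 <= subopt t.
Proof. by rewrite subr_ge0. Qed.

Lemma sqr_grad_le t : enorm (grad t) ^+ 2 <= 4 * beta * subopt t.
Proof. exact: sqr_enorm_gradf_le. Qed.

Lemma subopt_le_dot t : subopt t <= dotv (grad t) (iterate t - wstar).
Proof.
have := convex_grad_le cf sf (iterate t) wstar.
rewrite -(opprB (iterate t) wstar) dotvNr -/(grad t) /subopt.
by move: (dotv _ _) (f _) (f _) => *; lra.
Qed.

(** Smoothness along one update, with [decorrelation_le] turning the true step size into
    [eta_val t]. Half of the gradient term survives and will pay for the quadratic variation. *)
Lemma descent_step t : (1 <= t <= T)%N ->
  subopt t.+1 <= subopt t - 2^-1 * eta_val t * enorm (grad t) ^+ 2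
    - eta_val t * dotv (grad t) (noise t)
    + (eta * s0 + 2 * eta * (1 + s1) * enorm (grad t) + beta * eta ^+ 2)
      * (enorm (h t) ^+ 2 / gsum t).
Proof.
case: t => // t tT.
have e0 := eta0.
have N := noise_le tT.
have Hh : enorm (h t.+1) ^+ 2 <= 2 * (s0 ^+ 2 + (1 + s1 ^+ 2) * enorm (grad t.+1) ^+ 2).
  apply: (le_trans (sqr_enorm_path_le _)); move: N.
  move: (enorm _ ^+ 2) (enorm _ ^+ 2) (s1 ^+ 2) (s0 ^+ 2) => *; lra.
have dec := decorrelation_le (gsum_gt0 t) (enorm_ge0 (h t.+1)) (enorm_ge0 (grad t.+1)) s00 s10 Hh.
rewrite -gsumS in dec.
have := smooth_le cf sf (iterate t.+1) (iterate t.+2).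
rewrite [iterate t.+2]iterateS// [_ - _ *: _ - _]addrC addKr dotvNr dotvZr enormN enormZ exprMn.
rewrite real_normK ?num_real// -/(grad t.+1) expr_div_n sqr_sqrtr ?(ltW (gsum_gt0 _))//.
rewrite /subopt.
have hd := dotv_le (grad t.+1) (h t.+1).
have hE : dotv (grad t.+1) (h t.+1) = enorm (grad t.+1) ^+ 2 + dotv (grad t.+1) (noise t.+1).
  by rewrite {1}path_noiseK dotvDr -sqr_enorm.
rewrite /eta_val /=.
move: dec hd hE; set B := Num.sqrt (gsum t + _); set A := Num.sqrt (gsum t.+1).
rewrite [iterate t.+2]iterateS//.
move: (f _) (f _) (f _) => fy fx fs.
move: (enorm (grad t.+1)) (enorm (h t.+1)) (dotv (grad t.+1) (noise t.+1)) (dotv _ (h _)).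
move=> nu al p r dec hd hE sm.
have dec2 := ler_wpM2l (ltW e0) dec.
have key : (B^-1 - A^-1) * r <= `|B^-1 - A^-1| * (nu * al).
  by apply: (le_trans (ler_norm _)); rewrite normrM ler_wpM2l.
have key2 := ler_wpM2l (ltW e0) key.
move: sm dec2 key2; rewrite hE.
move: (gsum t.+1)^-1 (B^-1) (A^-1) (`|_ - _|) => gi bi ai z.
rewrite !expr2 => *; lra.
Qed.

Lemma dist_step t : (1 <= t <= T)%N ->
  dist t.+1 ^+ 2 <= dist t ^+ 2 - 2 * eta_dist t * dotv (noise t) (iterate t - wstar)
    + eta * dist t * (enorm (h t) ^+ 2 / gsum t
        + enorm (noise t) ^+ 2 / (gsum t.-1 + enorm (grad t) ^+ 2))
    + eta ^+ 2 * (enorm (h t) ^+ 2 / gsum t).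
Proof.
case: t => // t tT.
have e0 := eta0.
have hze : `|enorm (h t.+1) - enorm (grad t.+1)| <= enorm (noise t.+1).
  have := enormD (grad t.+1) (noise t.+1); rewrite -path_noiseK.
  have := enormD (h t.+1) (- noise t.+1); rewrite enormN.
  have -> : h t.+1 - noise t.+1 = grad t.+1 by rewrite opprB addrCA subrr addr0.
  rewrite ler_norml; move: (enorm _) (enorm _) (enorm _) => *; lra.
have dec := decorrelation_dist_le (gsum_gt0 t) (enorm_ge0 (h t.+1)) (enorm_ge0 (grad t.+1)) hze.
rewrite -gsumS in dec.
have gd : 0 <= dotv (grad t.+1) (iterate t.+1 - wstar).
  by apply: le_trans (subopt_ge0 _) (subopt_le_dot _).
rewrite /dist /= iterateS// [iterate _ - _ - _]addrAC /eta_dist /=.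
have hd := dotv_le (h t.+1) (iterate t.+1 - wstar).
have hE : dotv (h t.+1) (iterate t.+1 - wstar) = dotv (grad t.+1) (iterate t.+1 - wstar)
   + dotv (noise t.+1) (iterate t.+1 - wstar).
  by rewrite {1}path_noiseK dotvDl.
move: dec gd hd hE; set B := Num.sqrt (gsum t + _); set A := Num.sqrt (gsum t.+1).
have A2 : A ^+ 2 = gsum t.+1 by rewrite sqr_sqrtr// ltW// gsum_gt0.
rewrite -{}A2.
have A0 : 0 < A by rewrite sqrtr_gt0 gsum_gt0.
have B0 : 0 < B by rewrite sqrtr_gt0 ltr_pwDl ?gsum_gt0 ?sqr_ge0.
move: (iterate t.+1 - wstar) => u dec gd hd hE.
rewrite [in leLHS]sqr_enorm.
have -> : dotv (u - (eta / A) *: h t.+1) (u - (eta / A) *: h t.+1) =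
   enorm u ^+ 2 - 2 * (eta / A) * dotv (h t.+1) u + eta ^+ 2 * (enorm (h t.+1) ^+ 2 / A ^+ 2).
  rewrite !(dotvDl, dotvDr, dotvNl, dotvNr, dotvZl, dotvZr) !sqr_enorm (dotvC u).
  by field; rewrite gt_eqF.
have key : 2 * ((B^-1 - A^-1) * dotv (h t.+1) u) <= enorm u * (enorm (h t.+1) ^+ 2 / A ^+ 2
        + enorm (noise t.+1) ^+ 2 / (gsum t + enorm (grad t.+1) ^+ 2)).
  apply: (@le_trans _ _ (enorm u * (2 * (`|B^-1 - A^-1| * enorm (h t.+1))))).
    have -> : enorm u * (2 * (`|B^-1 - A^-1| * enorm (h t.+1))) =
       2 * (`|B^-1 - A^-1| * (enorm (h t.+1) * enorm u)) by ring.
    by rewrite ler_pM2l//; apply: (le_trans (ler_norm _)); rewrite normrM ler_wpM2l.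
  by rewrite ler_wpM2l ?enorm_ge0.
have key2 := ler_wpM2l (ltW e0) key.
have b0 : 0 <= eta * B^-1 by rewrite mulr_ge0 ?invr_ge0 ?ltW.
have key3 := mulr_ge0 b0 gd.
move: key2 key3; rewrite hE.
move: (enorm (h t.+1) ^+ 2 / _) (enorm (noise t.+1) ^+ 2 / _) (enorm u) (B^-1) (A^-1).
by move: (dotv _ _) (dotv (grad _) _) => *; rewrite !expr2; lra.
Qed.

(** No update is longer than [eta], because [gsum t] contains the square of [h t]. This holds for
    every sequence [h], hence yields the deterministic bounds behind integrability and behind the
    size of [log_growth]. *)
Lemma dist_le_linear t : dist t <= enorm (w1 - wstar) + eta * t%:R.
Proof.
case: t => [|t]; first by rewrite /dist mulr0 addr0.
elim: t => [|t IH]; first by rewrite /dist iterate1 lerDl mulr1 ltW.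
rewrite {1}/dist iterateS// [iterate _ - _ - _]addrAC.
apply: (le_trans (enormD _ _)); rewrite enormN enormZ -/(dist t.+1).
rewrite [X in _ + eta * X](mulrS 1 t.+1) mulrDr mulr1 [eta + _]addrC addrA; apply: lerD => //.
have A0 : 0 < Num.sqrt (gsum t.+1) by rewrite sqrtr_gt0 gsum_gt0.
rewrite (ger0_norm (divr_ge0 (ltW eta0) (ltW A0))) mulrAC ler_pdivrMr// ler_pM2l//.
rewrite -[leLHS]ger0_norm ?enorm_ge0// -sqrtr_sqr; apply: ler_wsqrtr.
by rewrite gsumS lerDr ltW// gsum_gt0.
Qed.

Definition log_growth := ln (gsum T) - ln (gamma ^+ 2).

Lemma sum_path_ratio_le n : (n <= T)%N ->
  \sum_(1 <= s < n.+1) enorm (h s) ^+ 2 / gsum s <= log_growth.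
Proof.
move=> nT.
have g2 : 0 < gamma ^+ 2 by rewrite exprn_gt0.
apply: (le_trans (@sum_ratio_le_ln _ (fun s => enorm (h s) ^+ 2) _ n g2 (fun s => sqr_ge0 _))).
rewrite lerD2r ler_ln ?posrE ?gsum_gt0//.
rewrite lerD2l [leRHS](big_cat_nat_idem _ (n := n.+1))//= ?addr0//.
by rewrite lerDl sumr_ge0// => s _; rewrite sqr_ge0.
Qed.

Lemma log_growth_ge0 : 0 <= log_growth.
Proof. by have := sum_path_ratio_le (leq0n T); rewrite big_geq. Qed.

Lemma telescope_le (u v : nat -> R) n :
  (forall s, (1 <= s <= n)%N -> u s.+1 <= u s + v s) ->
  u n.+1 <= u 1%N + \sum_(1 <= s < n.+1) v s.
Proof.
elim: n => [|n IH] H; first by rewrite big_geq// addr0.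
rewrite big_nat_recr//= addrA; apply: (le_trans (H n.+1 _)); first by rewrite leqnn.
by rewrite lerD2r IH// => s /andP[s1' sn]; apply: H; rewrite s1' leqW.
Qed.

Lemma norm_div_le_half (x k : R) : 0 <= k -> `|x| <= k / 2 -> `|x / k| <= 2^-1.
Proof.
rewrite le_eqVlt => /predU1P[<-|k0] xk; first by rewrite invr0 mulr0 normr0.
rewrite normrM [X in _ * X]gtr0_norm ?invr_gt0// ler_pdivrMr//.
by rewrite mulrC.
Qed.

Lemma eta_val_ge0 t : 0 <= eta_val t.
Proof. by rewrite divr_ge0 ?sqrtr_ge0// ltW. Qed.

Lemma enorm_noise_le t : (1 <= t <= T)%N ->
  enorm (noise t) <= s0 + s1 * enorm (grad t).
Proof.
move=> /noise_le N; have nu0 := enorm_ge0 (grad t).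
rewrite -(@ler_pXn2r _ 2) ?nnegrE ?enorm_ge0 ?addr_ge0 ?mulr_ge0//.
apply: (le_trans N); have := mulr_ge0 s00 (mulr_ge0 s10 nu0).
by move: (enorm (grad t)) => nu; rewrite !expr2 => *; lra.
Qed.

Lemma eta_val_noise_le t : (1 <= t <= T)%N -> eta_val t * enorm (noise t) <= eta.
Proof.
move=> tT; rewrite /eta_val; set B := Num.sqrt _.
have B0 : 0 < B.
  rewrite sqrtr_gt0 ltr_pwDl ?gsum_gt0// addr_ge0 ?sqr_ge0//.
  by rewrite mulr_ge0 ?sqr_ge0// addr_ge0 ?sqr_ge0.
rewrite mulrAC ler_pdivrMr// ler_pM2l//.
rewrite -(@ler_pXn2r _ 2) ?nnegrE ?enorm_ge0 ?(ltW B0)//.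
rewrite [leRHS]sqr_sqrtr; last by move: B0; rewrite sqrtr_gt0 => /ltW.
apply: (le_trans (noise_le tT)).
have := ltW (gsum_gt0 t.-1); have := sqr_ge0 (enorm (grad t)).
by move: (gsum _) (_ ^+ 2) (s0 ^+ 2) (s1 ^+ 2) => *; lra.
Qed.

Lemma grad_bound_ge0 : 0 <= grad_bound. Proof. exact: sqrtr_ge0. Qed.

Lemma kappa_val_ge0 : 0 <= kappa_val.
Proof.
rewrite mulr_ge0 ?mulr_ge0 ?(ltW eta0)// addr_ge0// mulr_ge0 ?grad_bound_ge0//.
by rewrite addr_ge0.
Qed.

Lemma sqr_grad_le_F t : subopt t <= F -> enorm (grad t) ^+ 2 <= 4 * beta * F.
Proof.
by move=> tF; apply: (le_trans (sqr_grad_le t)); rewrite ler_wpM2l// mulr_ge0.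
Qed.

Lemma grad_le_bound t : subopt t <= F -> enorm (grad t) <= grad_bound.
Proof.
move=> /sqr_grad_le_F tF; rewrite -[enorm _]ger0_norm ?enorm_ge0// -sqrtr_sqr.
exact: ler_wsqrtr.
Qed.

Lemma noise_le_var t : (1 <= t <= T)%N -> subopt t <= F ->
  enorm (noise t) ^+ 2 <= noise_var.
Proof.
move=> tT tF; apply: (le_trans (noise_le tT)).
have := ler_wpM2l (sqr_ge0 s1) (sqr_grad_le_F tF); have := sqr_ge0 gamma.
rewrite /noise_var; move: (s1 ^+ 2 * _) (s1 ^+ 2 * _) (gamma ^+ 2) => *; lra.
Qed.

Lemma noise_var_gt0 : 0 <= F -> 0 < noise_var.
Proof.
move=> F0; rewrite ltr_wpDl ?exprn_gt0// addr_ge0 ?sqr_ge0//.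
by rewrite mulr_ge0 ?sqr_ge0// !mulr_ge0.
Qed.

Lemma dir_val_le t : (1 <= t <= T)%N -> `|dotv (dir_val t) (noise t)| <= 2^-1.
Proof.
move=> tT; rewrite /dir_val; case: ifPn => [tF|_]; last by rewrite dot0v normr0.
rewrite dotvZl mulNr normrN mulrAC.
apply: norm_div_le_half; first exact: kappa_val_ge0.
rewrite normrM (ger0_norm (eta_val_ge0 t)).
have h1 := ler_wpM2l (eta_val_ge0 t) (dotv_noise_le t).
have h2 := ler_wpM2r (enorm_ge0 (grad t)) (eta_val_noise_le tT).
have h3 := ler_wpM2l (ltW eta0) (grad_le_bound tF).
have h4 := mulr_ge0 (ltW eta0) (mulr_ge0 s10 grad_bound_ge0).
have h5 := mulr_ge0 (ltW eta0) s00.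
have h6 := mulr_ge0 (ltW eta0) grad_bound_ge0.
apply: (le_trans h1); move: h2 h3 h4 h5 h6; rewrite /kappa_val.
by move: (eta_val t) (enorm _) (enorm _) (grad_bound) => *; lra.
Qed.

(** * Function values and distances along a path with concentrated noise *)

Section Concentrated.
Variable l : R.
Hypothesis F0 : 0 <= F.

(** All prefixes are included, since the inductions consume one prefix for each time. Up to the
    choice of this event everything is deterministic. *)
Definition concentrated (Y : nat -> 'rV[R]_d) := forall n, (n <= T)%N ->
  \sum_(1 <= s < n.+1) (dotv (Y s) (noise s) - 2 * dotv (Y s) (noise s) ^+ 2) <= l.

(** [kappa_val] is at least 4 eta_val |xi|^2, because eta_val |xi| <= eta and |xi| <= s0 + s1
    [grad_bound]. By Cauchy-Schwarz the compensator 2 eta_val^2 <grad, xi>^2 / kappa_val is then at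
    most the reserved half eta_val |grad|^2 / 2. *)
Lemma dir_val_step t : (1 <= t <= T)%N -> subopt t <= F ->
  - (2^-1 * eta_val t * enorm (grad t) ^+ 2) - eta_val t * dotv (grad t) (noise t)
  <= kappa_val * (dotv (dir_val t) (noise t) - 2 * dotv (dir_val t) (noise t) ^+ 2).
Proof.
move=> tT tF; rewrite /dir_val tF dotvZl.
have pn := dotv_noise_le t.
have k0 := kappa_val_ge0.
have nN := grad_le_bound tF.
(* A vanishing [kappa_val] forces [grad_bound = 0], hence a zero gradient, and both sides are 0. *)
have [k00|kn0] := eqVneq kappa_val 0.
  have N0 : grad_bound = 0.
    have a1 := mulr_ge0 s10 grad_bound_ge0; have a2 := grad_bound_ge0.
    move: k00 => /eqP; rewrite mulf_eq0 mulf_eq0 gt_eqF// (gt_eqF eta0)/=.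
    by move: a1 a2 s00 => a1 a2 a3 /eqP a4; apply/eqP; rewrite eq_le a2 andbT; lra.
  have n0 : enorm (grad t) = 0.
    by apply/eqP; rewrite eq_le enorm_ge0 andbT -N0.
  have p0 : dotv (grad t) (noise t) = 0 by rewrite (enorm_eq0 n0) dot0v.
  by rewrite n0 p0 k00 expr0n/= !mulr0 mul0r oppr0 addr0.
have kp : 0 < kappa_val by rewrite lt_neqAle eq_sym kn0.
have ev0 := eta_val_ge0 t.
have h1 : 4 * (eta_val t * enorm (noise t) ^+ 2) <= kappa_val.
  have h2 := ler_wpM2r (enorm_ge0 (noise t)) (eta_val_noise_le tT).
  have h3 := ler_wpM2l (ltW eta0) (enorm_noise_le tT).
  have h4 := ler_wpM2l (ltW eta0) (ler_wpM2l s10 nN).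
  have h5 := mulr_ge0 (ltW eta0) grad_bound_ge0.
  rewrite /kappa_val; move: h2 h3 h4 h5.
  by move: (eta_val t) (enorm _) (enorm _) grad_bound => *; rewrite !expr2; lra.
have h2 : 4 * (eta_val t * dotv (grad t) (noise t) ^+ 2) <= kappa_val * enorm (grad t) ^+ 2.
  apply: (@le_trans _ _ (4 * (eta_val t * enorm (noise t) ^+ 2) * enorm (grad t) ^+ 2)).
    have : dotv (grad t) (noise t) ^+ 2 <= enorm (grad t) ^+ 2 * enorm (noise t) ^+ 2.
      by rewrite !sqr_enorm cauchy_schwarz.
    move=> /(ler_wpM2l ev0).
    by move: (eta_val t) (enorm _ ^+ 2) (enorm _ ^+ 2) (dotv _ _ ^+ 2) => *; lra.
  by rewrite ler_wpM2r ?sqr_ge0.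
have h3 : 2 * (eta_val t ^+ 2 * dotv (grad t) (noise t) ^+ 2) / kappa_val
   <= 2^-1 * eta_val t * enorm (grad t) ^+ 2.
  rewrite ler_pdivrMr//; have := ler_wpM2l ev0 h2.
  move: (eta_val t) kappa_val (enorm (grad t) ^+ 2) (dotv _ _ ^+ 2) => e k n p.
  by rewrite expr2 => *; lra.
move: h3; move: (enorm _ ^+ 2) (dotv _ _) (eta_val t) => n p e h3.
have -> : kappa_val * (- (e / kappa_val) * p - 2 * (- (e / kappa_val) * p) ^+ 2)
  = - (e * p) - 2 * (e ^+ 2 * p ^+ 2) / kappa_val.
  by field; rewrite gt_eqF.
by move: (_ / _) h3 => *; lra.
Qed.

Definition val_slope :=
  eta * s0 + 2 * eta * (1 + s1) * grad_bound + beta * eta ^+ 2.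

(** The inductive step for the values: while the gaps stay below [F] the truncation is inactive, and
    the bound obtained for time n + 1 does not depend on [n]. *)
Lemma subopt_sum_le n : concentrated dir_val -> (n <= T)%N ->
  (forall s, (1 <= s <= n)%N -> subopt s <= F) ->
  subopt n.+1 <= subopt 1 + kappa_val * l + val_slope * log_growth.
Proof.
move=> con nT sF.
pose V s := dotv (dir_val s) (noise s) - 2 * dotv (dir_val s) (noise s) ^+ 2.
have vs0 : 0 <= val_slope.
  by rewrite /val_slope; nonneg (ltW eta0) grad_bound_ge0.
have step s : (1 <= s <= n)%N ->
    subopt s.+1 <= subopt s + (kappa_val * V s + val_slope * (enorm (h s) ^+ 2 / gsum s)).
  move=> /andP[s1' sn].
  have sT : (1 <= s <= T)%N by rewrite s1' (leq_trans sn).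
  have sF' : subopt s <= F by apply: sF; rewrite s1'.
  have a1 := descent_step sT.
  have a2 := dir_val_step sT sF'.
  have rho0 : 0 <= enorm (h s) ^+ 2 / gsum s.
    by rewrite divr_ge0 ?sqr_ge0// ltW// gsum_gt0.
  have a3 : eta * s0 + 2 * eta * (1 + s1) * enorm (grad s) + beta * eta ^+ 2 <= val_slope.
    rewrite lerD2r lerD2l ler_wpM2l ?grad_le_bound//.
    by rewrite !mulr_ge0 ?addr_ge0// ltW.
  have a4 := ler_wpM2r rho0 a3.
  move: a1 a2 a4; rewrite -/(V s).
  move: (kappa_val * V s) (_ ^+ 2 / gsum s) (subopt s.+1) (subopt s) val_slope.
  by move: (dotv _ _) (eta_val s) (enorm (grad s)) => *; lra.
have := telescope_le step.
rewrite big_split/= -!mulr_sumr.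
have b1 := ler_wpM2l kappa_val_ge0 (con n nT).
have b2 := ler_wpM2l vs0 (sum_path_ratio_le nT).
move: b1 b2; rewrite -/V.
move: (\sum_(1 <= s < n.+1) _ / _) (\sum_(1 <= s < n.+1) _) => S1 S2.
by move: kappa_val val_slope log_growth (subopt _) (subopt n.+1) => *; lra.
Qed.

Lemma dir_grad_le t : (1 <= t <= T)%N -> `|dotv (dir_grad t) (noise t)| <= 2^-1.
Proof.
move=> tT; rewrite /dir_grad; case: ifPn => [/andP[tF tg]|_]; last by rewrite dot0v normr0.
rewrite dotvZl mulNr normrN mulrC.
have v0 := noise_var_gt0 F0.
apply: norm_div_le_half; first by rewrite mulr_ge0// ltW.
apply: (le_trans (dotv_noise_le t)).
have nv := noise_le_var tT tF.
have v8 : 0 <= 8 * noise_var / 2 by rewrite divr_ge0// mulr_ge0// ltW.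
rewrite -(@ler_pXn2r _ 2) ?nnegrE ?(mulr_ge0 (enorm_ge0 _) (enorm_ge0 _))//.
rewrite exprMn; apply: (le_trans (ler_pM (sqr_ge0 _) (sqr_ge0 _) tg nv)).
by move: noise_var v0 => v v0; rewrite expr2; lra.
Qed.

(** If |grad|^2 > 16 [noise_var], then 4 |xi| <= |grad| and the cross term is harmless. Otherwise
    the compensated increment equals -2 p - p^2 / (2 [noise_var]) with p = <grad, xi>, and p^2 /
    [noise_var] <= |grad|^2 pays for the last term. The threshold 16 also keeps |p| below 4
    [noise_var], half of the normalization. *)
Lemma dir_grad_step t : (1 <= t <= T)%N -> subopt t <= F ->
  enorm (noise t) ^+ 2
    - 16 * noise_var * (dotv (dir_grad t) (noise t) - 2 * dotv (dir_grad t) (noise t) ^+ 2)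
  <= enorm (h t) ^+ 2.
Proof.
move=> tT tF; rewrite /dir_grad tF /= sqr_enorm_path.
have v0 := noise_var_gt0 F0.
have nv := noise_le_var tT tF.
have pn := dotv_noise_le t.
case: ifPn => [tg|]; last first.
  rewrite -ltNge => tg; rewrite dot0v expr0n/= mulr0 subr0 mulr0 subr0.
  have : enorm (noise t) * 4 <= enorm (grad t).
    rewrite -(@ler_pXn2r _ 2) ?nnegrE ?mulr_ge0 ?enorm_ge0// exprMn.
    by move: (enorm _ ^+ 2) (enorm _ ^+ 2) noise_var nv tg => *; rewrite expr2; lra.
  move=> h1; have h2 := ler_wpM2l (enorm_ge0 (grad t)) h1.
  move: pn h2; rewrite ler_norml => /andP[].
  have := sqr_ge0 (enorm (grad t)).
  by move: (enorm (noise t)) (enorm (grad t)) (dotv _ _) => *; rewrite !expr2; lra.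
rewrite dotvZl.
have h1 : dotv (grad t) (noise t) ^+ 2 <= enorm (grad t) ^+ 2 * noise_var.
  apply: (@le_trans _ _ (enorm (grad t) ^+ 2 * enorm (noise t) ^+ 2)).
    by rewrite !sqr_enorm cauchy_schwarz.
  by rewrite ler_wpM2l// sqr_ge0.
have h2 : dotv (grad t) (noise t) ^+ 2 / noise_var <= enorm (grad t) ^+ 2.
  by rewrite ler_pdivrMr.
have h3 := sqr_ge0 (enorm (grad t)).
move: h2 h3; move: (enorm (noise t) ^+ 2) (enorm _ ^+ 2) (dotv _ _) => n b p h2 h3.
have -> : 16 * noise_var * (- (8 * noise_var)^-1 * p - 2 * (- (8 * noise_var)^-1 * p) ^+ 2)
  = - 2 * p - 2^-1 * (p ^+ 2 / noise_var) by field; rewrite gt_eqF.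
by move: (_ / _) h2 => *; lra.
Qed.

(** This lets the accumulated oracle answers in the denominators stand for the accumulated noise; it
    is the domination hypothesis of [sum_noise_ratio_le] with [K = 16 * l]. *)
Lemma noise_sum_le n : concentrated dir_grad -> (n <= T)%N ->
  (forall s, (1 <= s <= n)%N -> subopt s <= F) ->
  \sum_(1 <= s < n.+1) enorm (noise s) ^+ 2
    <= \sum_(1 <= s < n.+1) enorm (h s) ^+ 2 + 16 * noise_var * l.
Proof.
move=> con nT sF.
have v0 := noise_var_gt0 F0.
pose V s := dotv (dir_grad s) (noise s) - 2 * dotv (dir_grad s) (noise s) ^+ 2.
have : \sum_(1 <= s < n.+1) (enorm (noise s) ^+ 2 - 16 * noise_var * V s)
    <= \sum_(1 <= s < n.+1) enorm (h s) ^+ 2.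
  rewrite big_nat_cond [leRHS]big_nat_cond; apply: ler_sum => s.
  rewrite andbT ltnS => /andP[s1' sn].
  by apply: dir_grad_step; [rewrite s1' (leq_trans sn)|apply: sF; rewrite s1'].
rewrite sumrB -mulr_sumr.
have v16 : 0 <= 16 * noise_var by rewrite mulr_ge0// ltW.
have := ler_wpM2l v16 (con n nT); rewrite -/V.
move: (\sum_(1 <= s < n.+1) enorm (h s) ^+ 2) (\sum_(1 <= s < n.+1) enorm _ ^+ 2).
by move: (_ * _) (_ * _) => *; lra.
Qed.

Lemma noise_ratio_ge1 : 1 <= noise_ratio.
Proof.
rewrite ler_pdivlMr ?exprn_gt0// mul1r /noise_var lerDr addr_ge0 ?sqr_ge0//.
by rewrite mulr_ge0 ?sqr_ge0// !mulr_ge0.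
Qed.

Definition noise_ratio_sum :=
  2 * (1 + 2 * (16 * l) * noise_ratio) * ln (1 + T%:R).

Lemma sum_noise_grad_ratio_le n : concentrated dir_grad -> (n <= T)%N -> 1 <= 16 * l ->
  (forall s, (1 <= s <= n)%N -> subopt s <= F) ->
  \sum_(1 <= s < n.+1) enorm (noise s) ^+ 2 / (gsum s.-1 + enorm (grad s) ^+ 2)
    <= noise_ratio_sum.
Proof.
move=> con nT l1 sF.
have g2 : 0 < gamma ^+ 2 by rewrite exprn_gt0.
have gv : gamma ^+ 2 <= noise_var.
  by have := noise_ratio_ge1; rewrite ler_pdivlMr// mul1r.
apply: (le_trans (@sum_noise_ratio_le _ (fun s => enorm (grad s) ^+ 2)
  (fun s => enorm (noise s) ^+ 2) (fun s => gsum s.-1) noise_var (gamma ^+ 2) (16 * l) n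
  g2 gv l1 _ _ _ _ _)).
- by move=> s; exact: sqr_ge0.
- by move=> s; exact: sqr_ge0.
- by move=> s; exact: gsum_ge.
- move=> s /andP[s1' sn]; apply: noise_le_var; first by rewrite s1' (leq_trans sn).
  by apply: sF; rewrite s1'.
(* At time s + 1 the past noise runs up to [s], and so does the sum in [gsum s]: the indices match
   exactly. *)
- case=> // s /andP[_ sn].
  have h1 : \sum_(1 <= r < s.+1) enorm (noise r) ^+ 2 <=
      \sum_(1 <= r < s.+1) enorm (h r) ^+ 2 + 16 * noise_var * l.
    apply: noise_sum_le => //; first by rewrite (leq_trans (ltnW sn)).
    by move=> r /andP[r1 rs]; apply: sF; rewrite r1 (leq_trans rs)// ltnW.
  apply: (le_trans h1); rewrite /gsum /=; have := ltW g2.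
  by move: (\sum_(1 <= r < s.+1) _) (gamma ^+ 2) noise_var => *; lra.
rewrite /noise_ratio_sum -/noise_ratio.
have M1 := noise_ratio_ge1.
have l0 : 0 <= l by lra.
rewrite ler_wpM2l//; first by nonneg l0 (le_trans ler01 M1).
rewrite ler_ln ?posrE ?ltr_pwDl//.
by rewrite lerD2l ler_nat.
Qed.

Lemma sqr_eta_dist t : eta_dist t ^+ 2 = eta ^+ 2 / (gsum t.-1 + enorm (grad t) ^+ 2).
Proof.
by rewrite expr_div_n sqr_sqrtr// addr_ge0 ?sqr_ge0// ltW// gsum_gt0.
Qed.

Lemma kappa_dist_gt0 : 0 < D -> 0 < kappa_dist.
Proof.
move=> D0; apply: mulr_gt0; last exact: lt_le_trans noise_ratio_ge1.
by rewrite !mulr_gt0.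
Qed.

Lemma sqr_dotv_dist_le t : dist t <= D ->
  dotv (noise t) (iterate t - wstar) ^+ 2 <= enorm (noise t) ^+ 2 * D ^+ 2.
Proof.
move=> tD; apply: (@le_trans _ _ (enorm (noise t) ^+ 2 * dist t ^+ 2)).
  by rewrite !sqr_enorm cauchy_schwarz.
rewrite ler_wpM2l ?sqr_ge0// ler_pXn2r ?nnegrE ?enorm_ge0//.
exact: le_trans (enorm_ge0 _) tD.
Qed.

(** The squared increment is a fixed multiple of the noise ratio summed in [noise_ratio_sum]. Since
    that sum grows linearly in [noise_ratio], the factor [noise_ratio] in [kappa_dist] leaves a
    compensator of order [eta * D] times logarithms. *)
Lemma sqr_dir_dist t : (1 <= t <= T)%N -> 0 < D -> subopt t <= F -> dist t <= D ->
  dotv (dir_dist t) (noise t) ^+ 2 <=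
  (enorm (noise t) ^+ 2 / (gsum t.-1 + enorm (grad t) ^+ 2)) / (4 * noise_ratio ^+ 2).
Proof.
move=> tT D0 tF tD; rewrite /dir_dist tF tD /= dotvZl dotvC exprMn sqrrN expr_div_n.
rewrite [(2 * _) ^+ 2]exprMn sqr_eta_dist.
have := sqr_dotv_dist_le tD.
have M0 : 0 < noise_ratio by exact: lt_le_trans noise_ratio_ge1.
have G0 : 0 < gsum t.-1 + enorm (grad t) ^+ 2 by rewrite ltr_pwDl ?gsum_gt0 ?sqr_ge0.
rewrite /kappa_dist; move: (gsum _ + _) G0 (enorm _ ^+ 2) (dotv _ _ ^+ 2) => G G0 z p zp.
have -> : 2 ^+ 2 * (eta ^+ 2 / G) / (4 * eta * D * noise_ratio) ^+ 2 * p =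
   p * (4 * G * noise_ratio ^+ 2 * D ^+ 2)^-1.
  by field; rewrite !gt_eqF.
have -> : z / G / (4 * noise_ratio ^+ 2) = z * D ^+ 2 * (4 * G * noise_ratio ^+ 2 * D ^+ 2)^-1.
  by field; rewrite !gt_eqF.
by rewrite ler_wpM2r// invr_ge0; nonneg (ltW G0) (sqr_ge0 D).
Qed.

Lemma dir_dist_le t : (1 <= t <= T)%N -> 0 < D ->
  `|dotv (dir_dist t) (noise t)| <= 2^-1.
Proof.
move=> tT D0; case: (boolP ((subopt t <= F) && (dist t <= D))) => [/andP[tF tD]|nt]; last first.
  by rewrite /dir_dist (negbTE nt) dot0v normr0.
rewrite -(@ler_pXn2r _ 2) ?nnegrE// real_normK ?num_real//.
apply: (le_trans (sqr_dir_dist tT D0 tF tD)).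
have M1 := noise_ratio_ge1.
have M0 : 0 < noise_ratio by exact: lt_le_trans M1.
have g2 : 0 < gamma ^+ 2 by rewrite exprn_gt0.
have h1 : enorm (noise t) ^+ 2 / (gsum t.-1 + enorm (grad t) ^+ 2) <= noise_ratio.
  have G0 : 0 < gsum t.-1 + enorm (grad t) ^+ 2 by rewrite ltr_pwDl ?gsum_gt0 ?sqr_ge0.
  rewrite ler_pdivrMr//.
  apply: (le_trans (noise_le_var tT tF)).
  have h2 : noise_ratio * gamma ^+ 2 = noise_var by rewrite divfK// gt_eqF.
  by rewrite -h2 ler_pM2l// (le_trans (gsum_ge t.-1))// lerDl sqr_ge0.
have M4 : 0 < 4 * noise_ratio ^+ 2 by rewrite pmulr_rgt0// exprn_gt0.
rewrite ler_pdivrMr//; apply: (le_trans h1).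
have := ler_wpM2r (ltW M0) M1.
by move: noise_ratio => M; rewrite !expr2; lra.
Qed.

Lemma dist_sum_le n : concentrated dir_grad -> concentrated dir_dist -> (n <= T)%N ->
  1 <= 16 * l -> 0 < D ->
  (forall s, (1 <= s <= n)%N -> subopt s <= F) ->
  (forall s, (1 <= s <= n)%N -> dist s <= D) ->
  dist n.+1 ^+ 2 <= dist 1 ^+ 2
    + eta * D * (log_growth + noise_ratio_sum + 2 * noise_ratio_sum / noise_ratio
                 + 4 * noise_ratio * l)
    + eta ^+ 2 * log_growth.
Proof.
move=> cong con nT l1 D0 sF sD.
pose V s := dotv (dir_dist s) (noise s) - 2 * dotv (dir_dist s) (noise s) ^+ 2.
pose z s := enorm (noise s) ^+ 2 / (gsum s.-1 + enorm (grad s) ^+ 2).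
pose rho s := enorm (h s) ^+ 2 / gsum s.
have k0 := kappa_dist_gt0 D0.
have M0 : 0 < noise_ratio by exact: lt_le_trans noise_ratio_ge1.
(* Cost of the compensator per unit of [z]; it simplifies to 2 eta D / [noise_ratio]. *)
pose c := kappa_dist * (2 * (4 * noise_ratio ^+ 2)^-1).
have c0 : 0 <= c.
  apply: mulr_ge0; first exact: ltW.
  by apply: mulr_ge0 => //; rewrite invr_ge0; nonneg (ltW M0) (sqr_ge0 noise_ratio).
have step s : (1 <= s <= n)%N -> dist s.+1 ^+ 2 <= dist s ^+ 2 +
    (kappa_dist * V s + c * z s + eta * D * (rho s + z s) + eta ^+ 2 * rho s).
  move=> /andP[s1' sn].
  have sT : (1 <= s <= T)%N by rewrite s1' (leq_trans sn).
  have sF' : subopt s <= F by apply: sF; rewrite s1'.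
  have sD' : dist s <= D by apply: sD; rewrite s1'.
  have a1 := dist_step sT.
  have a2 := ler_wpM2l (ltW k0) (sqr_dir_dist sT D0 sF' sD').
  have VE : kappa_dist * dotv (dir_dist s) (noise s) =
      - (2 * eta_dist s * dotv (noise s) (iterate s - wstar)).
    by rewrite /dir_dist sF' sD' /= dotvZl dotvC; field; rewrite gt_eqF.
  have rho0 : 0 <= rho s by rewrite divr_ge0 ?sqr_ge0// ltW// gsum_gt0.
  have z0 : 0 <= z s.
    by rewrite divr_ge0 ?sqr_ge0// (addr_ge0 (ltW (gsum_gt0 _)) (sqr_ge0 _)).
  have a3 : eta * dist s * (rho s + z s) <= eta * D * (rho s + z s).
    by rewrite ler_wpM2r ?addr_ge0// ler_pM2l.
  apply: (le_trans a1); rewrite -/(rho s) -/(z s) -VE.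
  move: a2 a3; rewrite -/(z s) /V /c.
  move: (dotv (dir_dist s) _) (dist s) (z s) (rho s) kappa_dist ((4 * noise_ratio ^+ 2)^-1).
  by move=> *; lra.
have := telescope_le step.
have b1 : kappa_dist * \sum_(1 <= s < n.+1) V s <= kappa_dist * l.
  by rewrite ler_pM2l//; exact: con.
have b2 : \sum_(1 <= s < n.+1) rho s <= log_growth by exact: sum_path_ratio_le.
have b3 : \sum_(1 <= s < n.+1) z s <= noise_ratio_sum.
  exact: sum_noise_grad_ratio_le.
clear step; clearbody V rho z.
rewrite !big_split/= -!mulr_sumr big_split/=.
have eD : 0 <= eta * D by rewrite mulr_ge0// ltW.
have b4 := ler_wpM2l eD b2; have b5 := ler_wpM2l eD b3.
have b6 := ler_wpM2l c0 b3; have b7 := ler_wpM2l (sqr_ge0 eta) b2.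
have cE : c = 2 * eta * D / noise_ratio.
  by rewrite /c /kappa_dist; field; rewrite gt_eqF.
have kE : kappa_dist * l = eta * D * (4 * noise_ratio * l) by rewrite /kappa_dist; ring.
have cE2 : c * noise_ratio_sum = eta * D * (2 * noise_ratio_sum / noise_ratio).
  by rewrite cE; ring.
move: b1 b4 b5 b6 b7; rewrite kE cE2.
move: (\sum_(1 <= s < n.+1) z s) (\sum_(1 <= s < n.+1) V s) (\sum_(1 <= s < n.+1) rho s).
move: (2 * noise_ratio_sum / noise_ratio) (4 * noise_ratio * l) => X Y Sz SV Sr.
move: (dist n.+1 ^+ 2) (dist 1 ^+ 2) noise_ratio_sum (eta * D) kappa_dist log_growth.
by clear cE cE2 c0; clearbody c; move=> *; lra.
Qed.

(** * Regret along a path that stays in the ball of radius D *)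

Hypothesis D0 : 0 <= D.

Lemma kappa_reg_ge0 : 0 <= kappa_reg.
Proof.
rewrite /kappa_reg; nonneg (sqrtr_ge0 (T%:R : R)) beta0.
Qed.

Lemma grad_le_dist t : dist t <= D -> enorm (grad t) <= beta * D.
Proof.
move=> tD; apply: (le_trans (enorm_gradf_le cf beta0 sf minf _)).
by rewrite ler_wpM2l.
Qed.

Lemma dotv_noise_dist_le t : (1 <= t <= T)%N -> dist t <= D ->
  `|dotv (noise t) (iterate t - wstar)| <= kappa_reg / 2.
Proof.
move=> tT tD; apply: (le_trans (dotv_le _ _)); rewrite -/(dist t).
have h1 := enorm_noise_le tT.
have h2 := ler_wpM2l s10 (grad_le_dist tD).
have h3 := ler_pM (enorm_ge0 _) (enorm_ge0 _) (le_trans h1 (lerD (lexx s0) h2)) tD.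
apply: (le_trans h3).
have T1 : 1 <= Num.sqrt T%:R :> R.
  rewrite -[leLHS]sqrtr1 ler_wsqrtr// ler1n.
  by case/andP: tT => a b; exact: leq_trans b.
have h4 := ler_wpM2l (mulr_ge0 s00 D0) T1.
have h5 : 0 <= beta * s1 ^+ 2 * D ^+ 2 by nonneg beta0 s10.
have h6 := mulr_ge0 s00 D0.
rewrite /kappa_reg; move: (Num.sqrt _) h4 h5 => r; rewrite !expr2 => *; lra.
Qed.

Lemma dir_reg_le t : (1 <= t <= T)%N -> `|dotv (dir_reg t) (noise t)| <= 2^-1.
Proof.
move=> tT; rewrite /dir_reg; case: ifPn => [tD|_]; last by rewrite dot0v normr0.
rewrite dotvZl mulNr normrN mulrC dotvC.
by apply: norm_div_le_half; [exact: kappa_reg_ge0|exact: dotv_noise_dist_le].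
Qed.

Lemma kappa_dir_reg t : (1 <= t <= T)%N -> dist t <= D ->
  kappa_reg * dotv (dir_reg t) (noise t) = - dotv (noise t) (iterate t - wstar).
Proof.
move=> tT tD; rewrite /dir_reg tD dotvZl dotvC.
have [k0|kn0] := eqVneq kappa_reg 0; last by field.
have := dotv_noise_dist_le tT tD; rewrite k0 mul0r mul0r normr_le0 => /eqP ->.
by rewrite oppr0.
Qed.

(** The squared increments sum to at most T D^2 s0^2 + 4 beta s1^2 D^2 S, with S the sum of the
    gaps. Against this, the part 4 D s0 sqrt T of [kappa_reg] yields the first term on the right and
    the part 32 beta s1^2 D^2 yields S / 4. *)
Lemma sum_sqr_dir_reg_le n : (n <= T)%N -> (forall s, (1 <= s <= n)%N -> dist s <= D) ->
  kappa_reg * (2 * \sum_(1 <= s < n.+1) dotv (dir_reg s) (noise s) ^+ 2)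
  <= D * s0 * Num.sqrt T%:R / 2 + (\sum_(1 <= s < n.+1) subopt s) / 4.
Proof.
move=> nT sD.
have S0 : 0 <= \sum_(1 <= s < n.+1) subopt s by apply: sumr_ge0 => s _; exact: subopt_ge0.
have r0 := sqrtr_ge0 (T%:R : R).
have rhs0 : 0 <= D * s0 * Num.sqrt T%:R / 2 + (\sum_(1 <= s < n.+1) subopt s) / 4.
  by rewrite addr_ge0 ?divr_ge0// !mulr_ge0.
have k0 := kappa_reg_ge0.
have [->|kn0] := eqVneq kappa_reg 0; first by rewrite mul0r.
have kp : 0 < kappa_reg by rewrite lt_neqAle eq_sym kn0.
have step s : (1 <= s <= n)%N -> dotv (dir_reg s) (noise s) ^+ 2 <=
    (D ^+ 2 * s0 ^+ 2 + 4 * beta * s1 ^+ 2 * D ^+ 2 * subopt s) / kappa_reg ^+ 2.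
  move=> sn; have sT : (1 <= s <= T)%N by case/andP: sn => -> /= a; exact: leq_trans nT.
  rewrite /dir_reg sD// dotvZl exprMn sqrrN exprVn mulrC dotvC.
  rewrite ler_wpM2r ?invr_ge0 ?sqr_ge0//.
  apply: (le_trans (sqr_dotv_dist_le (sD s sn))).
  have a1 := ler_wpM2l (sqr_ge0 s1) (sqr_grad_le s).
  have a2 := ler_wpM2r (sqr_ge0 D) (le_trans (noise_le sT) (lerD (lexx _) a1)).
  apply: (le_trans a2).
  by move: (s1 ^+ 2) (s0 ^+ 2) (D ^+ 2) (subopt s) => *; lra.
have sum : \sum_(1 <= s < n.+1) dotv (dir_reg s) (noise s) ^+ 2 <=
    (T%:R * (D ^+ 2 * s0 ^+ 2) + 4 * beta * s1 ^+ 2 * D ^+ 2 * \sum_(1 <= s < n.+1) subopt s)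
      / kappa_reg ^+ 2.
  apply: (@le_trans _ _ (\sum_(1 <= s < n.+1)
    ((D ^+ 2 * s0 ^+ 2 + 4 * beta * s1 ^+ 2 * D ^+ 2 * subopt s) / kappa_reg ^+ 2))).
    rewrite big_nat_cond [leRHS]big_nat_cond; apply: ler_sum => s.
    by rewrite andbT ltnS => sn; exact: step.
  rewrite -mulr_suml ler_wpM2r ?invr_ge0 ?sqr_ge0// big_split/=.
  apply: lerD; last by rewrite mulr_sumr.
  rewrite sumr_const_nat subn1/= -[leLHS]mulr_natl ler_wpM2r ?ler_nat//.
  by rewrite mulr_ge0 ?sqr_ge0.
move: sum; set SV := \sum_(1 <= s < n.+1) dotv _ _ ^+ 2 => sum.
have sum2 := ler_wpM2l (mulr_ge0 (ler0n R 2) k0) sum.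
rewrite mulrCA mulrA; apply: (le_trans sum2).
set X := (_ + _) / _.
have -> : 2 * kappa_reg * X = 2 * (T%:R * (D ^+ 2 * s0 ^+ 2) + 4 * beta * s1 ^+ 2 * D ^+ 2 *
   \sum_(1 <= s < n.+1) subopt s) / kappa_reg by rewrite /X; field; rewrite gt_eqF.
rewrite ler_pdivrMr//.
have T2 : T%:R = Num.sqrt T%:R ^+ 2 :> R by rewrite sqr_sqrtr.
move: (\sum_(1 <= s < n.+1) _) S0 => S S0.
rewrite /kappa_reg; move: (Num.sqrt _) T2 r0 => r -> r0.
have p1 : 0 <= beta * s1 ^+ 2 * D ^+ 2 * (D * s0 * r) by nonneg r0 beta0.
have p2 : 0 <= D * (s0 * r * S) by nonneg r0 S0.
have p3 : 0 <= D ^+ 2 * (beta * s1 * S) by nonneg r0 beta0.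
have p4 : 0 <= D ^+ 2 * (beta * s1 * (D * s0 * r)) by nonneg r0 beta0.
move: p1 p2 p3 p4; rewrite !expr2 => *; lra.
Qed.

(** Summation by parts with increasing weights; the last term is kept so that the induction closes.
    The initial weight is the root of [gsum 0], that is [gamma], and becomes the contribution gamma
    d1^2 / eta to the regret. *)
Lemma abel_dist_le n : (forall s, (1 <= s <= n)%N -> dist s <= D) ->
  \sum_(1 <= s < n.+1) Num.sqrt (gsum s) * (dist s ^+ 2 - dist s.+1 ^+ 2)
  <= gamma * dist 1 ^+ 2 + D ^+ 2 * (Num.sqrt (gsum n) - gamma)
     - Num.sqrt (gsum n) * dist n.+1 ^+ 2.
Proof.
elim: n => [|n IH] sD.
  by rewrite /gsum !big_geq// addr0 sqrtr_sqr ger0_norm ?(ltW gamma0)// subrr mulr0 addr0 subrr.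
rewrite big_nat_recr//=.
have {}IH := IH (fun s sn => sD s (ltac:(by case/andP: sn => -> /= a; exact: leqW))).
have d2 : dist n.+1 ^+ 2 <= D ^+ 2.
  by rewrite ler_pXn2r ?nnegrE ?enorm_ge0// sD// leqnn.
have gn : 0 <= Num.sqrt (gsum n.+1) - Num.sqrt (gsum n).
  by rewrite subr_ge0 ler_wsqrtr// gsumS lerDl sqr_ge0.
have := ler_wpM2l gn d2; move: IH.
move: (\sum_(1 <= s < n.+1) _) (Num.sqrt (gsum n)) (Num.sqrt (gsum n.+1)) => S a b.
by move: (dist _ ^+ 2) (dist n.+2 ^+ 2) (dist n.+1 ^+ 2) (D ^+ 2) => *; lra.
Qed.

(** The distance recursion divided by twice the step size: the noise now multiplies
    [iterate t - wstar] alone, which is predictable, while the true step size remains only in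
    deterministic sums. *)
Lemma regret_step t : (1 <= t <= T)%N ->
  subopt t <= (2 * eta)^-1 * (Num.sqrt (gsum t) * (dist t ^+ 2 - dist t.+1 ^+ 2))
    + eta / 2 * (enorm (h t) ^+ 2 / Num.sqrt (gsum t))
    - dotv (noise t) (iterate t - wstar).
Proof.
case: t => // t tT.
have hE : dotv (h t.+1) (iterate t.+1 - wstar) = dotv (grad t.+1) (iterate t.+1 - wstar)
   + dotv (noise t.+1) (iterate t.+1 - wstar).
  by rewrite {1}path_noiseK dotvDl.
have sd := subopt_le_dot t.+1.
apply: (le_trans sd).
rewrite -[X in X <= _](addrK (dotv (noise t.+1) (iterate t.+1 - wstar))) -hE lerD2r.
have A0 : 0 < Num.sqrt (gsum t.+1) by rewrite sqrtr_gt0 gsum_gt0.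
rewrite {2}/dist /= [iterate t.+2]iterateS// [iterate _ - _ - _]addrAC /dist.
move: (Num.sqrt _) A0 (iterate t.+1 - wstar) => A A0 u.
rewrite !sqr_enorm !(dotvDl, dotvDr, dotvNl, dotvNr, dotvZl, dotvZr) (dotvC u).
move: (dotv _ _) (dotv _ _) (dotv _ _) => *.
rewrite le_eqVlt; apply/orP; left; apply/eqP; field.
by rewrite !gt_eqF.
Qed.

(** The sum S of the gaps bounds itself: the squared oracle answers sum to at most 2 T s0^2 + 8 beta
    (1 + s1^2) S, so the main inequality is quadratic in sqrt S and is solved by
    [regret_algebra]. *)
Lemma regret_le : concentrated dir_reg -> 0 <= l -> eta * l <= D -> eta <= D ->
  (forall s, (1 <= s <= T)%N -> dist s <= D) ->
  \sum_(1 <= s < T.+1) subopt s <= gamma * dist 1 ^+ 2 / eta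
    + 13 * (D ^+ 2 / eta + eta) * s0 * Num.sqrt T%:R
    + 86 * (beta * (1 + s1 ^+ 2)) * (D ^+ 2 / eta + eta) ^+ 2.
Proof.
move=> con l0 elD eD sD.
set S := \sum_(1 <= s < T.+1) subopt s.
have S0 : 0 <= S by apply: sumr_ge0 => s _; exact: subopt_ge0.
pose V s := dotv (dir_reg s) (noise s).
pose A := \sum_(1 <= s < T.+1) enorm (h s) ^+ 2.
have A0 : 0 <= A by apply: sumr_ge0 => s _; exact: sqr_ge0.
have b0 : 0 <= beta * (1 + s1 ^+ 2) by nonneg beta0 s10.
have e0 := eta0; have k0 := kappa_reg_ge0.
have e2 : 0 < (2 * eta)^-1 by rewrite invr_gt0 mulr_gt0.
have ub : S <= (2 * eta)^-1 *
      (\sum_(1 <= s < T.+1) Num.sqrt (gsum s) * (dist s ^+ 2 - dist s.+1 ^+ 2))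
    + eta / 2 * (\sum_(1 <= s < T.+1) enorm (h s) ^+ 2 / Num.sqrt (gsum s))
    + kappa_reg * \sum_(1 <= s < T.+1) V s.
  apply: (@le_trans _ _ (\sum_(1 <= s < T.+1)
      ((2 * eta)^-1 * (Num.sqrt (gsum s) * (dist s ^+ 2 - dist s.+1 ^+ 2))
       + eta / 2 * (enorm (h s) ^+ 2 / Num.sqrt (gsum s)) + kappa_reg * V s))); last first.
    by rewrite !big_split/= !mulr_sumr.
  rewrite /S big_nat_cond [leRHS]big_nat_cond.
  apply: ler_sum => s; rewrite andbT ltnS => sT.
  by rewrite kappa_dir_reg ?sD//; exact: regret_step.
have gA : Num.sqrt (gsum T) - gamma <= Num.sqrt A.
  rewrite lerBlDl /gsum -/A; apply: (le_trans (sqrtD_le (sqr_ge0 _) A0)).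
  by rewrite sqrtr_sqr ger0_norm// ltW.
have u1 : \sum_(1 <= s < T.+1) Num.sqrt (gsum s) * (dist s ^+ 2 - dist s.+1 ^+ 2)
    <= gamma * dist 1 ^+ 2 + D ^+ 2 * Num.sqrt A.
  apply: (le_trans (abel_dist_le sD)).
  have := ler_wpM2l (sqr_ge0 D) gA.
  have := mulr_ge0 (sqrtr_ge0 (gsum T)) (sqr_ge0 (dist T.+1)).
  move: (Num.sqrt (gsum T)) (Num.sqrt A) (dist T.+1 ^+ 2) (D ^+ 2) (dist 1 ^+ 2).
  by move=> *; lra.
have u2 : \sum_(1 <= s < T.+1) enorm (h s) ^+ 2 / Num.sqrt (gsum s) <= 2 * Num.sqrt A.
  have := @sum_sqrt_ratio_le _ (fun s => enorm (h s) ^+ 2) (gamma ^+ 2) T (sqr_ge0 _)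
    (fun s => sqr_ge0 _).
  rewrite sqrtr_sqr ger0_norm ?(ltW gamma0)// -/(gsum T) => u2; apply: (le_trans u2).
  by rewrite ler_pM2l.
have u3 : kappa_reg * \sum_(1 <= s < T.+1) V s <=
    kappa_reg * l + (D * s0 * Num.sqrt T%:R / 2 + S / 4).
  apply: le_trans (lerD (lexx _) (sum_sqr_dir_reg_le (leqnn T) sD)).
  rewrite -mulrDr ler_wpM2l//; have := con T (leqnn T).
  rewrite sumrB -mulr_sumr -/V.
  by move: (\sum_(1 <= s < T.+1) _) (\sum_(1 <= s < T.+1) _) => *; lra.
have r0 := sqrtr_ge0 (T%:R : R).
have T2 : T%:R = Num.sqrt T%:R ^+ 2 :> R by rewrite sqr_sqrtr.
have x2 : S = Num.sqrt S ^+ 2 by rewrite sqr_sqrtr.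
have y2 : beta * (1 + s1 ^+ 2) = Num.sqrt (beta * (1 + s1 ^+ 2)) ^+ 2 by rewrite sqr_sqrtr.
have x0 := sqrtr_ge0 S; have y0 := sqrtr_ge0 (beta * (1 + s1 ^+ 2)).
have A_le : A <= 2 * (T%:R * s0 ^+ 2) + 8 * (beta * (1 + s1 ^+ 2)) * S.
  apply: (@le_trans _ _ (\sum_(1 <= s < T.+1)
      (2 * s0 ^+ 2 + 8 * (beta * (1 + s1 ^+ 2)) * subopt s))).
    rewrite /A big_nat_cond [leRHS]big_nat_cond; apply: ler_sum => s.
    rewrite andbT ltnS => sT; apply: (le_trans (sqr_enorm_path_le s)).
    have a1 := noise_le sT.
    have s2 : 0 <= 1 + s1 ^+ 2 by nonneg s10 s10.
    have a2 := ler_wpM2l s2 (sqr_grad_le s).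
    move: a1 a2; move: (enorm _ ^+ 2) (enorm _ ^+ 2) (subopt s) (s1 ^+ 2) (s0 ^+ 2).
    by move=> *; lra.
  rewrite big_split/=; apply: lerD; last by rewrite mulr_sumr.
  by rewrite sumr_const_nat subn1/= -[leLHS]mulr_natl mulrCA.
have sA : Num.sqrt A <=
    2 * s0 * Num.sqrt T%:R + 3 * (Num.sqrt (beta * (1 + s1 ^+ 2)) * Num.sqrt S).
  have p0 : 0 <= 2 * s0 * Num.sqrt T%:R + 3 * (Num.sqrt (beta * (1 + s1 ^+ 2)) * Num.sqrt S).
    by apply: addr_ge0; rewrite !mulr_ge0.
  rewrite -[leRHS](ger0_norm p0) -sqrtr_sqr; apply: ler_wsqrtr; apply: (le_trans A_le).
  rewrite {1}T2 {1}x2 {1}y2; exact: path_sum_algebra.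
have main : S <= (2 * eta)^-1 * (gamma * dist 1 ^+ 2 + D ^+ 2 * Num.sqrt A)
    + eta / 2 * (2 * Num.sqrt A)
    + (kappa_reg * l + (D * s0 * Num.sqrt T%:R / 2 + S / 4)).
  apply: (le_trans ub); apply: lerD => //; apply: lerD.
    by rewrite ler_pM2l.
  by rewrite ler_pM2l// divr_gt0.
have := @regret_algebra _ beta s0 s1 eta D l (Num.sqrt T%:R) (Num.sqrt S)
  (Num.sqrt (beta * (1 + s1 ^+ 2))) (Num.sqrt A) (gamma * dist 1 ^+ 2).
by rewrite -x2; apply=> //; exact: sqrtr_ge0.
Qed.

End Concentrated.

End Path.

(** * Measurability and concentration of the iterates *)

Section AdaMeasurability.
Variables (R : realType) (d : nat) (f : 'rV[R]_d -> R) (beta : R).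
Variables (wstar w1 : 'rV[R]_d) (eta gamma s0 s1 F D : R) (T : nat).
Variables (dO : measure_display) (Omega : measurableType dO).
Variables (g : nat -> Omega -> 'rV[R]_d) (t : nat).

Local Opaque gradf.

Hypotheses (beta0 : 0 <= beta) (sf : smooth_fun beta f) (gamma0 : 0 < gamma).
Hypothesis mg : forall s i, (1 <= s < t)%N -> measurable_fun setT (fun x => g s x 0 i).

(** [Omega] is an arbitrary measurable space here. Taken with the sigma-algebra of g_1, ..., g_{n-1}
    and [t = n], the lemmas below express adaptedness; taken with the full one, plain
    measurability. *)
Definition measurable_row (u : Omega -> 'rV[R]_d) :=
  forall i, measurable_fun setT (fun x => u x 0 i).

Lemma measurable_dotv u v : measurable_row u -> measurable_row v ->
  measurable_fun setT (fun x => dotv (u x) (v x)).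
Proof. by move=> mu mv; apply: measurable_sum => i; exact: measurable_funM. Qed.

Lemma measurable_enorm_sqr u : measurable_row u ->
  measurable_fun setT (fun x => enorm (u x) ^+ 2).
Proof. by move=> mu; under eq_fun do rewrite sqr_enorm; exact: measurable_dotv. Qed.

Lemma measurable_sqrt (u : Omega -> R) : measurable_fun setT u ->
  measurable_fun setT (fun x => Num.sqrt (u x)).
Proof.
move=> mu; apply: (measurableT_comp _ mu).
by apply: continuous_measurable_fun; exact: sqrt_continuous.
Qed.

Lemma measurable_inv_sqrt (u : Omega -> R) : measurable_fun setT u ->
  (forall x, 0 <= u x) ->
  measurable_fun setT (fun x => (Num.sqrt (gamma ^+ 2 + u x))^-1).
Proof.
move=> mu u0.
(* The absolute value makes the outer function continuous on all of [R], as its denominator never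
   vanishes. *)
have -> : (fun x => (Num.sqrt (gamma ^+ 2 + u x))^-1) =
    (fun r : R => (Num.sqrt (gamma ^+ 2 + `|r|))^-1) \o u.
  by apply/funext => x /=; rewrite ger0_norm.
apply: measurableT_comp mu; apply: continuous_measurable_fun => r.
apply: cvgV.
  by rewrite gt_eqF// sqrtr_gt0 ltr_pwDl// exprn_gt0.
apply: (continuous_cvg _ (@sqrt_continuous _ _)).
by apply: cvgD; [exact: cvg_cst|exact: norm_continuous].
Qed.

Lemma measurable_rowZ (a : Omega -> R) u : measurable_fun setT a -> measurable_row u ->
  measurable_row (fun x => a x *: u x).
Proof. by move=> ma mu i; under eq_fun do rewrite mxE; exact: measurable_funM. Qed.

Lemma measurable_rowB u v : measurable_row u -> measurable_row v ->
  measurable_row (fun x => u x - v x).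
Proof. by move=> mu mv i; under eq_fun do rewrite !mxE; exact: measurable_funB. Qed.

Lemma measurable_row_cst c : measurable_row (fun=> c).
Proof. by move=> i; exact: measurable_cst. Qed.

Lemma measurable_row_if (b : Omega -> bool) u :
  measurable_fun setT b -> measurable_row u ->
  measurable_row (fun x => if b x then u x else 0).
Proof.
move=> mb mu i.
have -> : (fun x => (if b x then u x else 0) 0 i) = (fun x => if b x then u x 0 i else 0).
  by apply/funext => x; case: ifP => // _; rewrite mxE.
by apply: measurable_fun_ifT => //; exact: measurable_cst.
Qed.

Let I x := iterate w1 eta gamma (g^~ x).
Let sumg x s := \sum_(1 <= r < s.+1) enorm (g r x) ^+ 2.

Lemma measurable_sumg s : (s < t)%N -> measurable_fun setT (fun x => sumg x s).
Proof.
move=> st; apply: measurable_sum_nat => r /andP[r1 rs].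
by apply: measurable_enorm_sqr => i; apply: mg; rewrite r1 (leq_ltn_trans rs).
Qed.

Lemma sumg_ge0 x s : 0 <= sumg x s.
Proof. by apply: sumr_ge0 => r _; exact: sqr_ge0. Qed.

(** The iterate of index [s] uses the answers of index below [s] only, so [s = t] is allowed
    although just the answers before [t] are measurable. *)
Lemma measurable_iterate s : (s <= t)%N -> measurable_row (fun x => I x s).
Proof.
case: s => [|s]; first by move=> _; exact: measurable_row_cst.
elim: s => [|s IH] st; first exact: measurable_row_cst.
have -> : (fun x => I x s.+2) = (fun x => I x s.+1 -
   (eta * (Num.sqrt (gamma ^+ 2 + sumg x s.+1))^-1) *: g s.+1 x) by [].
apply: measurable_rowB; first by apply: IH; exact: ltnW.
apply: measurable_rowZ; last by move=> i; exact: mg.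
apply: measurable_funM; first exact: measurable_cst.
by apply: measurable_inv_sqrt => [|x]; [exact: measurable_sumg|exact: sumg_ge0].
Qed.

Lemma measurable_gradf_iterate s : (s <= t)%N ->
  measurable_row (fun x => grad f w1 eta gamma (g^~ x) s).
Proof.
move=> st i.
exact: (@measurable_continuous_rV _ _ _ _ (fun v => gradf f v 0 i) (fun x => I x s)
  (continuous_gradf beta0 sf (i := i)) (measurable_iterate st)).
Qed.

Lemma measurable_subopt s : (s <= t)%N ->
  measurable_fun setT (fun x => subopt f wstar w1 eta gamma (g^~ x) s).
Proof.
move=> st; apply: measurable_funB; last exact: measurable_cst.
apply: (@measurable_continuous_rV _ _ _ _ f (fun x => I x s) _ (measurable_iterate st)) => x.
exact/differentiable_continuous/sf.1.
Qed.

Lemma measurable_dist s : (s <= t)%N ->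
  measurable_fun setT (fun x => dist wstar w1 eta gamma (g^~ x) s).
Proof.
move=> st; apply: measurable_sqrt.
have := measurable_rowB (measurable_iterate st) (measurable_row_cst wstar).
by move=> m; exact: measurable_dotv.
Qed.

Lemma measurable_dir_val s : (1 <= s <= t)%N ->
  measurable_row (fun x => dir_val f beta wstar w1 eta gamma s0 s1 F (g^~ x) s).
Proof.
case: s => // s /= st.
apply: measurable_row_if.
  apply: measurable_fun_ler; [exact: measurable_subopt|exact: measurable_cst].
apply: measurable_rowZ; last exact: measurable_gradf_iterate.
have mG := measurable_enorm_sqr (measurable_gradf_iterate st).
have -> : (fun x => - (eta_val f w1 eta gamma s0 s1 (g^~ x) s.+1 /
     kappa_val beta eta s0 s1 F)) =
   (fun x => - (eta / kappa_val beta eta s0 s1 F) *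
     (Num.sqrt (gamma ^+ 2 + (sumg x s + (s0 ^+ 2 + (1 + s1 ^+ 2) *
        enorm (grad f w1 eta gamma (g^~ x) s.+1) ^+ 2))))^-1).
  by apply/funext => x; rewrite /eta_val /= /gsum -addrA -/(sumg x s) mulrAC mulNr.
apply: measurable_funM; first exact: measurable_cst.
apply: measurable_inv_sqrt => [|x]; last first.
  by nonneg (sumg_ge0 x s) (sumg_ge0 x s).
apply: measurable_funD; first exact: measurable_sumg.
apply: measurable_funD; first exact: measurable_cst.
by apply: measurable_funM => //; exact: measurable_cst.
Qed.

Lemma measurable_dir_grad s : (1 <= s <= t)%N ->
  measurable_row (fun x => dir_grad f beta wstar w1 eta gamma s0 s1 F (g^~ x) s).
Proof.
move=> /andP[_ st].
have mG := measurable_enorm_sqr (measurable_gradf_iterate st).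
apply: measurable_row_if.
  apply: measurable_and; apply: measurable_fun_ler => //; exact: measurable_subopt.
by apply: measurable_rowZ; [exact: measurable_cst|exact: measurable_gradf_iterate].
Qed.

Lemma measurable_dir_dist s : (1 <= s <= t)%N ->
  measurable_row (fun x => dir_dist f beta wstar w1 eta gamma s0 s1 F D (g^~ x) s).
Proof.
case: s => // s /= st.
have mG := measurable_enorm_sqr (measurable_gradf_iterate st).
apply: measurable_row_if.
  by apply: measurable_and; apply: measurable_fun_ler => //;
    [exact: measurable_subopt|exact: measurable_dist].
apply: measurable_rowZ; last first.
  by apply: measurable_rowB; [exact: measurable_iterate|exact: measurable_row_cst].
have -> : (fun x => - (2 * eta_dist f w1 eta gamma (g^~ x) s.+1 /
     kappa_dist beta eta gamma s0 s1 F D)) =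
   (fun x => - (2 * eta / kappa_dist beta eta gamma s0 s1 F D) *
     (Num.sqrt (gamma ^+ 2 + (sumg x s + enorm (grad f w1 eta gamma (g^~ x) s.+1) ^+ 2)))^-1).
  by apply/funext => x; rewrite /eta_dist /= /gsum -addrA -/(sumg x s) mulrA mulrAC mulNr.
apply: measurable_funM; first exact: measurable_cst.
apply: measurable_inv_sqrt => [|x]; last by nonneg (sumg_ge0 x s) (sumg_ge0 x s).
by apply: measurable_funD => //; exact: measurable_sumg.
Qed.

Lemma measurable_dir_reg s : (1 <= s <= t)%N ->
  measurable_row (fun x => dir_reg beta wstar w1 eta gamma s0 s1 D T (g^~ x) s).
Proof.
move=> /andP[_ st]; apply: measurable_row_if.
  by apply: measurable_fun_ler => //; exact: measurable_dist.
apply: measurable_rowZ; first exact: measurable_cst.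
by apply: measurable_rowB; [exact: measurable_iterate|exact: measurable_row_cst].
Qed.

End AdaMeasurability.

Section DirectionBounds.
Variables (R : realType) (d : nat) (f : 'rV[R]_d -> R) (beta : R).
Variables (wstar w1 : 'rV[R]_d) (eta gamma s0 s1 F D : R) (T t : nat).
Hypotheses (cf : convex_fun f) (beta0 : 0 <= beta) (sf : smooth_fun beta f).
Hypothesis minf : forall w, f wstar <= f w.
Hypotheses (eta0 : 0 < eta) (gamma0 : 0 < gamma).

Local Opaque gradf.

Lemma coord_if_le (b : bool) (c A B : R) (u : 'rV[R]_d) i :
  `|c| <= A -> enorm u <= B -> `|(if b then c *: u else 0) 0 i| <= A * B.
Proof.
move=> cA uB.
apply: (@le_trans _ _ (`|c| * enorm u)); last by apply: ler_pM => //; exact: enorm_ge0.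
apply: (le_trans (coord_le_enorm _ _)); case: b; first by rewrite enormZ.
by rewrite enorm0 mulr_ge0// enorm_ge0.
Qed.

Lemma step_size_le (h : nat -> 'rV[R]_d) (u : R) : 0 <= u ->
  `|eta / Num.sqrt (gsum gamma h t.-1 + u)| <= eta / gamma.
Proof.
move=> u0; have g : gamma <= Num.sqrt (gsum gamma h t.-1 + u).
  rewrite -{1}(ger0_norm (ltW gamma0)) -sqrtr_sqr ler_wsqrtr//.
  by apply: (le_trans (gsum_ge gamma h t.-1)); rewrite lerDl.
have p : 0 < Num.sqrt (gsum gamma h t.-1 + u) by exact: lt_le_trans g.
rewrite ger0_norm; last by rewrite divr_ge0// ltW.
by rewrite ler_pM2l// lef_pV2 ?posrE.
Qed.

Lemma grad_le_linear (h : nat -> 'rV[R]_d) :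
  enorm (grad f w1 eta gamma h t) <= beta * (enorm (w1 - wstar) + eta * t%:R).
Proof.
apply: (le_trans (enorm_gradf_le cf beta0 sf minf _)); rewrite ler_wpM2l//.
exact: dist_le_linear.
Qed.

Lemma dir_val_bounded : exists B : R, forall (h : nat -> 'rV[R]_d) i,
  `|dir_val f beta wstar w1 eta gamma s0 s1 F h t 0 i| <= B.
Proof.
(* The bound is left to unification; it depends on [t] but not on [h], and no noise bound along [h]
   is assumed. *)
eexists => h i; apply: coord_if_le; last exact: grad_le_linear.
rewrite normrN normrM; apply: (ler_pM _ _ (step_size_le h _) (lexx _)) => //.
by rewrite addr_ge0 ?sqr_ge0// mulr_ge0 ?sqr_ge0// addr_ge0 ?sqr_ge0.
Qed.

Lemma dir_grad_bounded : exists B : R, forall (h : nat -> 'rV[R]_d) i,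
  `|dir_grad f beta wstar w1 eta gamma s0 s1 F h t 0 i| <= B.
Proof. by eexists => h i; apply: coord_if_le (lexx _) _; exact: grad_le_linear. Qed.

Lemma dir_dist_bounded : exists B : R, forall (h : nat -> 'rV[R]_d) i,
  `|dir_dist f beta wstar w1 eta gamma s0 s1 F D h t 0 i| <= B.
Proof.
eexists => h i; apply: coord_if_le; last exact: dist_le_linear.
rewrite normrN normrM; apply: (ler_pM _ _ _ (lexx _)) => //.
rewrite normrM; apply: (ler_pM _ _ (lexx _) (step_size_le h _)) => //.
exact: sqr_ge0.
Qed.

Lemma dir_reg_bounded : exists B : R, forall (h : nat -> 'rV[R]_d) i,
  `|dir_reg beta wstar w1 eta gamma s0 s1 D T h t 0 i| <= B.
Proof. by eexists => h i; apply: coord_if_le (lexx _) _; exact: dist_le_linear. Qed.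

End DirectionBounds.

(** * Concentration of a predictable direction paired with the noise *)

Section AdaConcentration.
Variables (R : realType) (d : nat) (f : 'rV[R]_d -> R) (beta : R).
Variables (wstar w1 : 'rV[R]_d) (eta gamma : R) (T : nat).
Variables (dO : measure_display) (Omega : measurableType dO).
Variables (P : probability Omega R) (g : nat -> Omega -> 'rV[R]_d).

Local Opaque gradf.

Hypotheses (cf : convex_fun f) (beta0 : 0 <= beta) (sf : smooth_fun beta f).
Hypothesis minf : forall w, f wstar <= f w.
Hypotheses (eta0 : 0 < eta) (gamma0 : 0 < gamma).
Hypothesis mg : forall t i, (1 <= t <= T)%N -> measurable_fun setT (fun x => g t x 0 i).
Hypothesis ig : forall t i, (1 <= t <= T)%N ->
  P.-integrable setT (fun x => (g t x 0 i)%:E).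
Hypothesis ug : forall t i A, (1 <= t <= T)%N -> <<s past_sets g t >> A ->
  (\int[P]_(x in A) (g t x 0 i)%:E =
   \int[P]_(x in A) (grad f w1 eta gamma (g^~ x) t 0 i)%:E)%E.

Let xi t x := noise f w1 eta gamma (g^~ x) t.

Lemma noise_coord t x i :
  xi t x 0 i = g t x 0 i - grad f w1 eta gamma (g^~ x) t 0 i.
Proof. by rewrite /xi /noise; move: (grad _ _ _ _ _ _) => u; rewrite !mxE. Qed.

Lemma past_sets_measurable t A : (1 <= t <= T)%N -> <<s past_sets g t >> A -> measurable A.
Proof.
move=> /andP[_ tT].
have := @smallest_sub _ (sigma_algebra setT) (past_sets g t) measurable.
apply; first exact: sigma_algebra_measurable.
move=> _ [s [i [B [/andP[s1 st] mB ->]]]].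
have sT : (1 <= s <= T)%N by rewrite s1 (leq_trans (ltnW st)).
by have := mg i sT measurableT mB; rewrite setTI.
Qed.

Lemma past_sets_coord t s i : (1 <= s < t)%N ->
  measurable_fun (setT : set (g_sigma_algebraType (past_sets g t))) (fun x => g s x 0 i).
Proof.
move=> st _ B mB; rewrite setTI; apply: sub_sigma_algebra.
by exists s, i, B; split.
Qed.

Lemma grad_coord_le x t i : `|grad f w1 eta gamma (g^~ x) t 0 i| <=
  beta * (enorm (w1 - wstar) + eta * t%:R).
Proof.
apply: (le_trans (coord_le_enorm _ _)).
apply: (le_trans (enorm_gradf_le cf beta0 sf minf _)); rewrite ler_wpM2l//.
exact: dist_le_linear.
Qed.

Lemma measurable_grad_Omega t i : (1 <= t <= T)%N ->
  measurable_fun setT (fun x => grad f w1 eta gamma (g^~ x) t 0 i).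
Proof.
move=> /andP[t1 tT].
apply: (@measurable_gradf_iterate _ _ _ _ _ _ _ _ _ _ t beta0 sf gamma0 _ t) => //.
by move=> s j /andP[s1 st]; apply: mg; rewrite s1 (leq_trans (ltnW st)).
Qed.

Lemma integrable_noise t i : (1 <= t <= T)%N ->
  P.-integrable setT (fun x => (xi t x 0 i)%:E).
Proof.
move=> tT.
have i2 := integrable_bounded P (measurable_grad_Omega i tT) (fun x => grad_coord_le x t i).
have := integrableB measurableT (ig i tT) i2; apply: eq_integrable => // x _.
by rewrite noise_coord EFinB.
Qed.

Lemma integral_noise t i (W : Omega -> R) (B : R) : (1 <= t <= T)%N ->
  measurable_fun (setT : set (g_sigma_algebraType (past_sets g t))) W ->
  (forall x, `|W x| <= B) ->
  (\int[P]_x (W x * xi t x 0 i)%:E = 0)%E.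
Proof.
move=> tT mW WB.
apply: (integral_adapted_eq0 (fun A => @past_sets_measurable t A tT) _ _ mW WB).
  exact: integrable_noise.
move=> A sA; have mA := past_sets_measurable tT sA.
have i2 := integrable_bounded P (measurable_grad_Omega i tT) (fun x => grad_coord_le x t i).
have i1 := ig i tT.
have j1 := integrableS measurableT mA (@subsetT _ A) i1.
have j2 := integrableS measurableT mA (@subsetT _ A) i2.
transitivity (\int[P]_(x in A) ((g t x 0 i)%:E - (grad f w1 eta gamma (g^~ x) t 0 i)%:E))%E.
  by apply: eq_integral => x _; rewrite noise_coord EFinB.
have fin := integrable_fin_num mA j2.
by rewrite (integralB mA j1 j2) (ug i tT sA); exact: subee fin.
Qed.

(** The noise bound holds only almost surely, whereas the product argument wants increments bounded
    by 1/2 everywhere. Clipping provides this and alters the increments on a null set only. *)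
Definition clip (z : R) := Num.max (- 2^-1) (Num.min 2^-1 z).

Lemma clip_le z : `|clip z| <= 2^-1.
Proof.
rewrite ler_norml /clip le_max lexx /= ge_max ge_min lexx /= andbT.
by lra.
Qed.

Lemma clip_id z : `|z| <= 2^-1 -> clip z = z.
Proof.
rewrite ler_norml => /andP[zl zu]; rewrite /clip.
by rewrite (min_idPr zu) (max_idPr zl).
Qed.

Variable Y : nat -> Omega -> 'rV[R]_d.
Hypothesis aY : forall n s i, (1 <= n <= T)%N -> (1 <= s <= n)%N ->
  measurable_fun (setT : set (g_sigma_algebraType (past_sets g n))) (fun x => Y s x 0 i).
Hypothesis bY : forall s, (1 <= s <= T)%N -> exists B, forall x i, `|Y s x 0 i| <= B.
Hypothesis hY : forall s, (1 <= s <= T)%N ->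
  {ae P, forall x, `|dotv (Y s x) (xi s x)| <= 2^-1}.

Let V s x := if (1 <= s <= T)%N then clip (dotv (Y s x) (xi s x)) else 0.

(** The exceptional set is defined by the clipped increments, hence measurable; on a path whose
    increments are bounded by 1/2, clipping is inactive. *)
Lemma ada_concentration (l : R) n : (n <= T)%N ->
  exists N : set Omega, [/\ measurable N, (P N <= (expR (- l))%:E)%E &
    forall x, ~ N x -> (forall s, (1 <= s <= n)%N -> `|dotv (Y s x) (xi s x)| <= 2^-1) ->
      \sum_(1 <= s < n.+1) (dotv (Y s x) (xi s x) - 2 * dotv (Y s x) (xi s x) ^+ 2) <= l].
Proof.
move=> nT.
have mclip : measurable_fun setT clip.
  by apply: measurable_maxr; [exact: measurable_cst|apply: measurable_minr].
have mxi t i : (1 <= t <= T)%N -> measurable_fun setT (fun x => xi t x 0 i).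
  by move=> tT; exact/measurable_EFinP/(measurable_int _ (integrable_noise i tT)).
have mY t i : (1 <= t <= T)%N -> measurable_fun setT (fun x => Y t x 0 i).
  move=> tT; apply: (measurable_sub_sigma (fun A => @past_sets_measurable t A tT)).
  by apply: aY => //; case/andP: tT => ->; rewrite leqnn.
have mX t : (1 <= t <= T)%N -> measurable_fun setT (fun x => dotv (Y t x) (xi t x)).
  by move=> tT; apply: measurable_dotv => i; [exact: mY|exact: mxi].
have mV t : (1 <= t <= T)%N -> measurable_fun setT (V t).
  by move=> tT; rewrite /V tT; exact: measurableT_comp mclip (mX t tT).
have bV t x : `|V t x| <= 2^-1.
  by rewrite /V; case: ifP => _; [exact: clip_le|rewrite normr0].
have aV m s : (1 <= m <= T)%N -> (1 <= s < m)%N ->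
    measurable_fun (setT : set (g_sigma_algebraType (past_sets g m))) (V s).
  move=> mT /andP[s1 sm].
  have sT : (1 <= s <= T)%N.
    by rewrite s1 (leq_trans (ltnW sm))//; case/andP: mT.
  rewrite /V sT; apply: (measurableT_comp mclip).
  apply: measurable_dotv => i; first by apply: aY => //; rewrite s1 ltnW.
  apply: measurable_rowB; first by move=> j; apply: past_sets_coord; rewrite s1.
  apply: (@measurable_gradf_iterate _ _ _ _ _ _ _ _ _ _ m beta0 sf gamma0 _ s (ltnW sm)).
  by move=> r j rm; exact: past_sets_coord.
have oV m (W : Omega -> R) (B : R) : (1 <= m <= T)%N ->
    measurable_fun (setT : set (g_sigma_algebraType (past_sets g m))) W ->
    (forall x, `|W x| <= B) -> (\int[P]_x (W x * V m x)%:E = 0)%E.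
  move=> mT mW WB.
  have mW' := measurable_sub_sigma (fun A => @past_sets_measurable m A mT) mW.
  have [BY hBY] := bY mT.
  have mm : (1 <= m <= m)%N by case/andP: mT => ->; rewrite leqnn.
  have WY i x : `|W x * Y m x 0 i| <= B * BY by rewrite normrM ler_pM.
  (* Almost everywhere the clipped increment is the inner product itself. Its coordinates are
     separately orthogonal to the past, with the bounded predictable multipliers
     [W x * Y m x 0 i]. *)
  transitivity (\int[P]_x (\sum_(i < d) (W x * Y m x 0 i * xi m x 0 i)%:E)%R)%E.
    apply: ae_eq_integral => //.
    - by apply/measurable_EFinP; apply: measurable_funM => //; exact: mV.
    - apply: emeasurable_sum => i; apply/measurable_EFinP.
      by apply: measurable_funM; [apply: measurable_funM => //; exact: mY|exact: mxi].
    apply: filterS (hY mT) => x hx _.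
    rewrite /V mT clip_id// sumEFin; congr EFin; rewrite mulr_sumr.
    by apply: eq_bigr => i _; rewrite mulrA.
  rewrite integral_sum//.
    rewrite big1// => i _; apply: (integral_noise i mT _ (WY i)).
    by apply: measurable_funM => //; exact: aY.
  move=> i; apply: (integrable_bM (integrable_noise i mT) _ (WY i)).
  by apply: measurable_funM => //; exact: mY.
have pc := product_concentration mV bV aV oV l nT.
exists [set x | (l < \sum_(1 <= s < n.+1) (V s x - 2 * V s x ^+ 2))%R]; split => //.
  have mS : measurable_fun setT (fun x => \sum_(1 <= s < n.+1) (V s x - 2 * V s x ^+ 2)).
    apply: measurable_sum_nat => s /andP[s1 sn].
    have mVs : measurable_fun setT (V s) by apply: mV; rewrite s1 (leq_trans sn).
    apply: measurable_funB => //; apply: measurable_funM => //.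
    exact: measurable_funX.
  have := measurable_fun_ltr (@measurable_cst _ _ _ _ setT l) mS.
  move=> /(_ measurableT [set true] I).
  by rewrite setTI.
move=> x /negP; rewrite -leNgt => h hx.
apply: le_trans h; rewrite le_eqVlt; apply/orP; left; apply/eqP.
rewrite big_nat_cond [RHS]big_nat_cond; apply: eq_bigr => s.
rewrite andbT ltnS => /andP[s1 sn].
by rewrite /V s1 (leq_trans sn nT)/= clip_id// hx// s1.
Qed.

(** A union bound over the prefixes: each length from 1 to [T] costs [expR (- l)], while length 0
    only requires [0 <= l]. *)
Lemma ada_concentration_union (l : R) : 0 <= l ->
  exists N : set Omega, [/\ measurable N, (P N <= (T%:R * expR (- l))%:E)%E &
    forall x, ~ N x -> (forall s, (1 <= s <= T)%N -> `|dotv (Y s x) (xi s x)| <= 2^-1) ->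
      concentrated f w1 eta gamma T (g^~ x) l (Y^~ x)].
Proof.
move=> l0.
suff main m : (m <= T)%N -> exists N : set Omega,
    [/\ measurable N, (P N <= (m%:R * expR (- l))%:E)%E &
    forall x, ~ N x -> (forall s, (1 <= s <= T)%N -> `|dotv (Y s x) (xi s x)| <= 2^-1) ->
      forall n, (n <= m)%N ->
      \sum_(1 <= s < n.+1) (dotv (Y s x) (xi s x) - 2 * dotv (Y s x) (xi s x) ^+ 2) <= l].
  exact: main (leqnn T).
elim: m => [|m IH] mT.
  exists set0; split => //; first by rewrite measure0 mul0r.
  by move=> x _ _ n; rewrite leqn0 => /eqP ->; rewrite big_geq.
have [N1 [mN1 PN1 hN1]] := IH (ltnW mT).
have [N2 [mN2 PN2 hN2]] := ada_concentration l mT.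
exists (N1 `|` N2); split.
- exact: measurableU.
- apply: (le_trans (measureU2 _ mN1 mN2)).
  by rewrite -natr1 mulrDl mul1r EFinD; exact: leeD.
move=> x /not_orP[x1 x2] hx n; rewrite leq_eqVlt => /predU1P[->|nm]; last exact: hN1.
by apply: hN2 => // s /andP[s1 sm]; apply: hx; rewrite s1 (leq_trans sm).
Qed.

End AdaConcentration.

(** * Choice of the constants *)

Section Constants.
Variable R : realType.

(** F = x^2 occurs on the left through [grad_bound], linear in x. AM-GM returns F / 2, and what is
    left is at most 5 B^2 times the bracket in F, whence the factor 10. With l <= 3 L and Gam <= 17
    L, the worst coefficient 4 l + 2 Gam is at most 46 L. *)
Lemma val_algebra (beta eta s0 s1 q1 l Gam L E F : R) :
  0 <= beta -> 0 < eta -> 0 <= s0 -> 0 <= s1 -> 0 <= q1 ->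
  0 <= l <= 3 * L -> 0 <= Gam <= 17 * L -> 1 <= L -> 10 * (46 * L) ^+ 2 <= E ->
  F = E * (q1 + eta * s0 + eta ^+ 2 * beta * s1 ^+ 2 + eta ^+ 2 * beta) ->
  q1 + kappa_val beta eta s0 s1 F * l + val_slope beta eta s0 s1 F * Gam <= F.
Proof.
move=> b0 e0 s00 s10 q10 /andP[l0 lL] /andP[G0 GL] L1 EB FE.
set B := 46 * L in EB.
have B1 : 1 <= B by rewrite /B; lra.
set Phi := q1 + _ + _ + _ in FE.
have P0 : 0 <= Phi by rewrite /Phi; nonneg (ltW e0) b0.
have E0 : 0 <= E by apply: le_trans EB; rewrite mulr_ge0 ?sqr_ge0.
have F0 : 0 <= F by rewrite FE mulr_ge0.
have NE : grad_bound beta F = 2 * (Num.sqrt beta * Num.sqrt F).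
  rewrite /grad_bound -mulrA sqrtrM// sqrtrM//; congr (_ * _).
  have -> : 4 = 2 ^+ 2 :> R by rewrite expr2; lra.
  by rewrite sqrtr_sqr ger0_norm.
rewrite /kappa_val /val_slope NE.
have x0 := sqrtr_ge0 F; have y0 := sqrtr_ge0 beta.
have x2 : F = Num.sqrt F ^+ 2 by rewrite sqr_sqrtr.
have y2 : beta = Num.sqrt beta ^+ 2 by rewrite sqr_sqrtr.
have main : 10 * B ^+ 2 * Phi <= F by rewrite FE ler_wpM2r.
move: (Num.sqrt F) (Num.sqrt beta) x0 y0 x2 y2 => x y x0 y0 x2 y2.
have h1 : 4 * l + Gam <= B by rewrite /B; lra.
have h2 : 4 * l + 2 * Gam <= B by rewrite /B; lra.
have h3 : Gam <= B by rewrite /B; lra.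
clearbody B.
have BB : B <= B ^+ 2 by rewrite expr2 ler_peMl// (le_trans ler01).
have k1 := ler_wpM2l (mulr_ge0 (ltW e0) s00) h1.
have zp : 0 <= eta * (1 + s1) * (2 * (y * x)) by nonneg (ltW e0) x0.
have k2 := ler_wpM2l zp h2.
have bp : 0 <= beta * eta ^+ 2 by nonneg (ltW e0) b0.
have k3 := ler_wpM2l bp h3.
have k4 := sqr_ge0 (x - 2 * y * (eta * (1 + s1) * B)).
have sq : (1 + s1) ^+ 2 <= 2 * (1 + s1 ^+ 2).
  by have := sqr_ge0 (1 - s1); rewrite !expr2 => *; lra.
have k5 : y ^+ 2 * (eta * (1 + s1) * B) ^+ 2 <= beta * eta ^+ 2 * B ^+ 2 * (2 * (1 + s1 ^+ 2)).
  rewrite -y2 !exprMn.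
  have c0 : 0 <= beta * eta ^+ 2 * B ^+ 2 by nonneg (sqr_ge0 B) b0.
  have := ler_wpM2l c0 sq; move: ((1 + s1) ^+ 2) (eta ^+ 2) (B ^+ 2) (1 + s1 ^+ 2) => *; lra.
have k6 := ler_wpM2l (mulr_ge0 (ltW e0) s00) BB.
have k7 := ler_wpM2l bp BB.
have B21 : 1 <= B ^+ 2 by exact: le_trans BB.
have k8 := ler_wpM2l q10 B21.
have k9 : 0 <= eta * s0 * B ^+ 2 by nonneg (ltW e0) (sqr_ge0 B).
have k10 : 0 <= q1 * B ^+ 2 by nonneg (ltW e0) (sqr_ge0 B).
have k11 : 0 <= beta * eta ^+ 2 * B ^+ 2 * s1 ^+ 2 by nonneg bp (sqr_ge0 B).
have k12 : 0 <= beta * eta ^+ 2 * B ^+ 2 by nonneg bp (sqr_ge0 B).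
move: main k4 k5; rewrite /Phi {1 2}x2.
set z := eta * (1 + s1) * B => main k4 k5.
have k4' : 2 * (y * x * z) <= x ^+ 2 / 2 + 2 * (y ^+ 2 * z ^+ 2).
  by move: k4; rewrite !expr2; lra.
have k2' : eta * (1 + s1) * (2 * (y * x)) * (4 * l + 2 * Gam) <= 2 * (y * x * z).
  by apply: (le_trans k2); rewrite /z; lra.
move: k1 k2' k3 k4' k5 k6 k7 k8 k9 k10 k11 k12 main; clear.
move: (y ^+ 2 * z ^+ 2) (x ^+ 2) (y * x * z) => p q r.
move: (B ^+ 2) (eta ^+ 2) (s1 ^+ 2) => *; lra.
Qed.

(** The terms linear in [D] are at most eta D W M with W = 611 L^2 and M the noise ratio. AM-GM
    returns D^2 / 2, leaving eta^2 W^2 M^2 / 2 <= 24 eta^2 W^2 Psi; doubling this together with d1^2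
    + 17 L eta^2 explains the lower bound on [E]. *)
Lemma dist_algebra (beta eta gamma s0 s1 F d1 D l Gam L E Psi : R) (T : nat) :
  0 <= beta -> 0 <= F -> 0 < eta -> 0 < gamma -> 0 <= D ->
  0 <= l <= 3 * L -> 0 <= Gam <= 17 * L -> 0 <= ln (1 + T%:R : R) <= L -> 1 <= L ->
  48 * (611 * L ^+ 2) ^+ 2 + 34 * L + 2 <= E ->
  Psi = 1 + s1 ^+ 2 + gamma ^- 2 * (s0 ^+ 2 + beta * s1 ^+ 2 * F)
        + gamma ^- 4 * (s0 ^+ 4 + beta ^+ 2 * s1 ^+ 4 * F ^+ 2) ->
  D ^+ 2 = E * (d1 ^+ 2 + eta ^+ 2 * Psi) ->
  d1 ^+ 2 + eta * D * (Gam + noise_ratio_sum beta gamma s0 s1 F T l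
      + 2 * noise_ratio_sum beta gamma s0 s1 F T l / noise_ratio beta gamma s0 s1 F
      + 4 * noise_ratio beta gamma s0 s1 F * l) + eta ^+ 2 * Gam <= D ^+ 2.
Proof.
move=> b0 F0 e0 g0 D0 /andP[l0 lL] /andP[G0 GL] /andP[n0 nL] L1 EB PsiE DE.
have M1 : 1 <= noise_ratio beta gamma s0 s1 F by exact: noise_ratio_ge1.
have g2 : 0 < gamma ^+ 2 by rewrite exprn_gt0.
(* M is a sum 1 + u + 4 v, so M^2 <= 3 (1 + u^2 + 16 v^2); the last coefficient gives 48. The fourth
   powers in [Psi] are u^2 and v^2. *)
have M2 : noise_ratio beta gamma s0 s1 F ^+ 2 <= 48 * Psi.
  have -> : noise_ratio beta gamma s0 s1 F =
      1 + gamma ^- 2 * s0 ^+ 2 + 4 * (gamma ^- 2 * (beta * s1 ^+ 2 * F)).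
    by rewrite /noise_ratio /noise_var; field; rewrite gt_eqF.
  rewrite PsiE.
  have -> : gamma ^- 4 * (s0 ^+ 4 + beta ^+ 2 * s1 ^+ 4 * F ^+ 2) =
      (gamma ^- 2 * s0 ^+ 2) ^+ 2 + (gamma ^- 2 * (beta * s1 ^+ 2 * F)) ^+ 2.
    by field; rewrite gt_eqF.
  rewrite [gamma ^- 2 * (s0 ^+ 2 + _)]mulrDr.
  have u0 : 0 <= gamma ^- 2 * s0 ^+ 2 by rewrite mulr_ge0 ?invr_ge0 ?sqr_ge0// ltW.
  have v0 : 0 <= gamma ^- 2 * (beta * s1 ^+ 2 * F).
    by rewrite mulr_ge0 ?invr_ge0 ?(ltW g2)//; nonneg b0 F0.
  move: (sqr_ge0 s1) u0 v0.
  move: (s1 ^+ 2) (gamma ^- 2 * s0 ^+ 2) (gamma ^- 2 * (beta * s1 ^+ 2 * F)).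
  move=> w u v w0 u0 v0.
  have := sqr_ge0 (1 - u); have := sqr_ge0 (1 - 4 * v); have := sqr_ge0 (u - 4 * v).
  have := sqr_ge0 u; have := sqr_ge0 v.
  by rewrite !expr2 => *; lra.
have Psi1 : 1 <= Psi.
  have i2 : 0 <= gamma ^- 2 by rewrite invr_ge0 ltW.
  have i4 : 0 <= gamma ^- 4 by rewrite invr_ge0 ltW// exprn_gt0.
  rewrite PsiE -!addrA lerDl.
  have s4 : 0 <= s1 ^+ 4 by rewrite exprn_even_ge0.
  have s04 : 0 <= s0 ^+ 4 by rewrite exprn_even_ge0.
  by nonneg i2 i4.
rewrite /noise_ratio_sum; move: (noise_ratio _ _ _ _ _) M1 M2 => M M1 M2.
move: (ln _) n0 nL => n n0 nL.
have M0 : 0 < M by exact: lt_le_trans M1.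
have L0 : 0 <= L by exact: le_trans L1.
have LL : L <= L ^+ 2 by rewrite expr2 ler_peMl.
have lM : l * M <= 3 * L * M by rewrite ler_wpM2r// ltW.
have LM : M <= L * M by rewrite ler_peMl// ltW.
have q0 : 0 <= 2 * (1 + 2 * (16 * l) * M) by nonneg l0 (ltW M0).
have Q1 : 2 * (1 + 2 * (16 * l) * M) * n <= 194 * (L ^+ 2 * M).
  apply: (@le_trans _ _ (194 * (L * M) * L)); last by rewrite expr2; lra.
  apply: ler_pM => //; lra.
set Q := 2 * (1 + _) * n in Q1 *.
have Q2 : 2 * Q / M <= 388 * (L ^+ 2 * M).
  rewrite ler_pdivrMr//.
  have Q0 : 0 <= L ^+ 2 * M by nonneg (ltW M0) L0.
  have := ler_wpM2r Q0 M1; lra.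
have L2M : L ^+ 2 <= L ^+ 2 * M by rewrite ler_peMr// sqr_ge0.
have LML : L * M <= L ^+ 2 * M by rewrite ler_wpM2r// ltW.
have H : Gam + Q + 2 * Q / M + 4 * M * l <= 611 * L ^+ 2 * M.
  by move: (2 * Q / M) Q2 => X Q2; lra.
have H2 := ler_wpM2l (mulr_ge0 (ltW e0) D0) H.
have H3 := sqr_ge0 (D - eta * (611 * L ^+ 2 * M)).
have e2 : 0 <= eta ^+ 2 by exact: sqr_ge0.
have K0 : 0 <= eta ^+ 2 * (611 * L ^+ 2) ^+ 2 by rewrite mulr_ge0 ?sqr_ge0.
have H4 := ler_wpM2l K0 M2.
have P0 : 0 <= d1 ^+ 2 + eta ^+ 2 * Psi.
  by rewrite addr_ge0 ?sqr_ge0// mulr_ge0// (le_trans ler01).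
have H5 := ler_wpM2r P0 EB; rewrite -DE in H5.
have H6 := ler_wpM2l e2 GL.
have ep : eta ^+ 2 <= eta ^+ 2 * Psi by rewrite ler_peMr.
have H7 := ler_wpM2r L0 ep.
have d0 : 0 <= d1 ^+ 2 by exact: sqr_ge0.
have H8 : 0 <= (611 * L ^+ 2) ^+ 2 * d1 ^+ 2 by rewrite mulr_ge0 ?sqr_ge0.
have H9 : 0 <= L * d1 ^+ 2 by rewrite mulr_ge0.
have H10 : 0 <= eta ^+ 2 * Psi by exact: le_trans ep.
have H3' : 2 * (eta * D * (611 * L ^+ 2 * M)) <=
    D ^+ 2 + eta ^+ 2 * (611 * L ^+ 2) ^+ 2 * M ^+ 2.
  by move: H3; move: (611 * L ^+ 2) => W; rewrite !expr2; lra.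
move: H2 H3' H4 H5 H6 H7 H8 H9 H10; move: (611 * L ^+ 2) (eta * D) => W ed.
move: (Gam + Q + _ + _) (M ^+ 2) (D ^+ 2) (d1 ^+ 2) d0 (eta ^+ 2) (W ^+ 2) => *; lra.
Qed.

Lemma le_of_sqr (x y : R) : 0 <= x -> 0 <= y -> x ^+ 2 <= y ^+ 2 -> x <= y.
Proof. by move=> x0 y0; rewrite ler_pXn2r ?nnegrE. Qed.

Lemma ln2_itv : 0 < ln (2 : R) <= 1.
Proof.
apply/andP; split; first by rewrite ln_gt0// ltr1n.
by apply: (le_trans (ln_le_sub1 _)) => //; lra.
Qed.

Lemma ln_le_log2 (x : R) : 1 <= x -> ln x <= log2 x.
Proof.
move=> x1; have /andP[l0 l1] := ln2_itv; rewrite /log2 ler_pdivlMr//.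
by rewrite ler_piMr// ln_ge0.
Qed.

Lemma log2_ge1 (x : R) : 2 <= x -> 1 <= log2 x.
Proof.
move=> x2; have /andP[l0 l1] := ln2_itv; rewrite /log2 ler_pdivlMr// mul1r.
by rewrite ler_ln ?posrE// (lt_le_trans _ x2).
Qed.

Lemma ln_expr_le_log2 (x y : R) n : 1 <= x -> 0 < y -> y <= x ^+ n ->
  ln y <= n%:R * log2 x.
Proof.
move=> x1 y0 yx; have x0 : 0 < x by exact: lt_le_trans x1.
apply: (@le_trans _ _ (n%:R * ln x)); last by rewrite ler_wpM2l// ln_le_log2.
by rewrite mulr_natl -lnXn// ler_ln ?posrE// exprn_gt0.
Qed.

End Constants.

(** * Propagation of both radii along a good path *)

Section PathBounds.
Variables (R : realType) (d : nat) (f : 'rV[R]_d -> R) (beta : R).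
Variables (wstar w1 : 'rV[R]_d) (eta gamma s0 s1 : R) (T : nat).
Variable h : nat -> 'rV[R]_d.

Local Opaque gradf.

Hypotheses (cf : convex_fun f) (beta0 : 0 <= beta) (sf : smooth_fun beta f).
Hypothesis minf : forall w, f wstar <= f w.
Hypotheses (eta0 : 0 < eta) (gamma0 : 0 < gamma) (s00 : 0 <= s0) (s10 : 0 <= s1).
Hypothesis noise_le : forall t, (1 <= t <= T)%N ->
  enorm (noise f w1 eta gamma h t) ^+ 2
    <= s0 ^+ 2 + s1 ^+ 2 * enorm (grad f w1 eta gamma h t) ^+ 2.

(** Power counting, each factor 2 absorbed by one more power of x: distances are at most x^3,
    gradients x^4, squared answers x^13 and their sum x^14. Comparison with gamma^2 costs x^2, and
    adding gamma^2 itself one more power: 17 in all. *)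
Lemma log_growth_le (x : R) : 2 <= x -> T%:R <= x -> eta <= x -> gamma^-1 <= x ->
  beta <= x -> s0 <= x -> s1 <= x -> enorm (w1 - wstar) <= x ->
  log_growth gamma T h <= 17 * log2 x.
Proof.
move=> x2 Tx ex gx bx s0x s1x dx.
have x0 : 0 <= x by exact: le_trans x2.
have dbl n : 2 * x ^+ n <= x ^+ n.+1 by rewrite exprS ler_wpM2r// exprn_ge0.
have nu t : (1 <= t <= T)%N -> enorm (grad f w1 eta gamma h t) <= x ^+ 4.
  move=> /andP[_ tT]; apply: (le_trans (enorm_gradf_le cf beta0 sf minf _)).
  have d2 : dist wstar w1 eta gamma h t <= x ^+ 3.
    apply: (le_trans (dist_le_linear wstar w1 h eta0 gamma0 t)).
    apply: le_trans (dbl 2%N).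
    have tx : t%:R <= x by apply: le_trans Tx; rewrite ler_nat.
    have := ler_pM (ltW eta0) (ler0n R t) ex tx.
    have := ler_wpM2r x0 x2; move: (enorm _) dx => *; rewrite expr2; lra.
  by rewrite [x ^+ 4]exprS; apply: ler_pM => //; exact: enorm_ge0.
have ha t : (1 <= t <= T)%N -> enorm (h t) ^+ 2 <= x ^+ 13.
  move=> tT; apply: (le_trans (sqr_enorm_path_le f w1 eta gamma h t)).
  have n8 : enorm (grad f w1 eta gamma h t) ^+ 2 <= x ^+ 8.
    by rewrite (exprM x 4 2) ler_pXn2r ?nnegrE ?exprn_ge0 ?enorm_ge0// nu.
  have s3 : 1 + s1 ^+ 2 <= x ^+ 3.
    have := ler_pM s10 s10 s1x s1x; have := ler_wpM2r x0 x2; have := dbl 2%N.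
    by rewrite -!expr2; move: (x ^+ 3) (s1 ^+ 2) => *; lra.
  have s02 : s0 ^+ 2 <= x ^+ 11.
    apply: (@le_trans _ _ (x ^+ 2)); first by rewrite ler_pXn2r ?nnegrE.
    by rewrite ler_weXn2l// (le_trans _ x2)// ler1n.
  have m : (1 + s1 ^+ 2) * enorm (grad f w1 eta gamma h t) ^+ 2 <= x ^+ 11.
    by rewrite (exprD x 3 8); apply: ler_pM => //; rewrite ?sqr_ge0// addr_ge0// sqr_ge0.
  have := noise_le tT; have := dbl 11%N; have := dbl 12%N; move: m s02.
  move: (s1 ^+ 2) (enorm _ ^+ 2) (enorm (grad _ _ _ _ _ _) ^+ 2).
  by move: (x ^+ 11) (x ^+ 12) (x ^+ 13) (s0 ^+ 2) => *; lra.
have gs : gsum gamma h T <= gamma ^+ 2 * x ^+ 17.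
  have S : \sum_(1 <= s < T.+1) enorm (h s) ^+ 2 <= x ^+ 14.
    apply: (@le_trans _ _ (\sum_(1 <= s < T.+1) x ^+ 13)).
      rewrite big_nat_cond [leRHS]big_nat_cond; apply: ler_sum => s.
      by rewrite andbT ltnS => sT; exact: ha.
    rewrite sumr_const_nat subn1/= -[leLHS]mulr_natl (exprS x 13).
    by rewrite ler_wpM2r// exprn_ge0.
  have g1 : 1 <= gamma ^+ 2 * x ^+ 2.
    rewrite -exprMn exprn_ege1//.
    by move: gx; rewrite -[gamma^-1]mulr1 ler_pdivrMl.
  have x1 n : 1 <= x ^+ n by rewrite exprn_ege1// (le_trans _ x2)// ler1n.
  have a1 : x ^+ 14 <= gamma ^+ 2 * x ^+ 16.
    rewrite (exprD x 2 14) mulrA ler_peMl//; exact: le_trans (x1 _).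
  have a2 : gamma ^+ 2 <= gamma ^+ 2 * x ^+ 16 by rewrite ler_peMr ?sqr_ge0.
  have a3 := ler_wpM2l (sqr_ge0 gamma) (dbl 16%N).
  rewrite /gsum; move: S a1 a2 a3; move: (\sum_(1 <= s < T.+1) _) => S.
  by move: (gamma ^+ 2) (x ^+ 14) (x ^+ 16) (x ^+ 17) => *; lra.
have g2 : 0 < gamma ^+ 2 by rewrite exprn_gt0.
rewrite /log_growth -ln_div ?posrE ?gsum_gt0//.
apply: (@ln_expr_le_log2 _ x _ 17).
- by apply: le_trans x2; rewrite ler1n.
- by rewrite divr_gt0 ?gsum_gt0.
- by rewrite ler_pdivrMr// mulrC.
Qed.

Variables (delta : R) (C : nat).
Hypothesis T0 : (0 < T)%N.
Hypothesis delta01 : 0 < delta < 4^-1.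
Hypothesis C_ge : 10 ^+ 8 <= C%:R :> R.

Let q1 := f w1 - f wstar.
Let d1 := enorm (w1 - wstar).
Let X := 2 + T%:R + delta^-1 + eta + eta^-1 + gamma + gamma^-1
  + beta + s0 + s1 + d1 + q1.
Let L := log2 X.
Let Phi := q1 + eta * s0 + eta ^+ 2 * beta * s1 ^+ 2 + eta ^+ 2 * beta.
Let F := C%:R * L ^+ 4 * Phi.
Let Psi := 1 + s1 ^+ 2 + gamma ^- 2 * (s0 ^+ 2 + beta * s1 ^+ 2 * F)
  + gamma ^- 4 * (s0 ^+ 4 + beta ^+ 2 * s1 ^+ 4 * F ^+ 2).
Let D := Num.sqrt (C%:R * L ^+ 4 * (d1 ^+ 2 + eta ^+ 2 * Psi)).
Let l := ln (4 * T%:R / delta).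

Let T1 : 1 <= T%:R :> R. Proof. by rewrite ler1n. Qed.

Let X_facts : [/\ 4 <= X, T%:R + 1 <= X, delta^-1 <= X, eta <= X & gamma^-1 <= X]
  /\ [/\ beta <= X, s0 <= X, s1 <= X & d1 <= X].
Proof.
have /andP[dl0 dl4] := delta01.
have di : 4 <= delta^-1.
  by rewrite -[4]invrK lef_pV2 ?posrE ?invr_gt0// ltW.
have q0 : 0 <= q1 by rewrite subr_ge0.
have d0 : 0 <= d1 by exact: enorm_ge0.
have ei : 0 <= eta^-1 by rewrite invr_ge0 ltW.
have gi : 0 <= gamma^-1 by rewrite invr_ge0 ltW.
have b0 := beta0; have a0 := s00; have c0 := s10; have e0 := eta0; have g0 := gamma0.
have t0 := T1; rewrite /X.
move: (T%:R) (delta^-1) (eta^-1) (gamma^-1) d1 q1 di q0 d0 ei gi t0.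
by move=> *; split; split; lra.
Qed.

Let L_ge1 : 1 <= L.
Proof. by have [[h4 _ _ _ _] _] := X_facts; apply: log2_ge1; lra. Qed.

Let L4 : L ^+ 2 <= L ^+ 4 /\ L <= L ^+ 4.
Proof.
have L1 := L_ge1; split; first by rewrite ler_weXn2l.
by rewrite -[leLHS]expr1 ler_weXn2l.
Qed.

(** The upper bound is 4 T / delta <= X^3. For the lower one, [delta < 4^-1] gives 4 T / delta >=
    16, so l >= 1 - 1/16; this provides the [K >= 1] with [K = 16 * l] of the noise estimate. *)
Let l_itv : 0 <= l <= 3 * L /\ 1 <= 16 * l.
Proof.
have /andP[dl0 dl4] := delta01.
have [[h4 hT hd _ _] _] := X_facts.
have di : 4 <= delta^-1 by rewrite -[4]invrK lef_pV2 ?posrE ?invr_gt0// ltW.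
have y16 : 16 <= 4 * T%:R / delta.
  have t4 : 4 <= 4 * T%:R :> R by have t1 := T1; lra.
  have := ler_pM (ler0n R 4) (ler0n R 4) t4 di.
  by move: (_ / _) => y; lra.
have y0 : 0 < 4 * T%:R / delta by rewrite (lt_le_trans _ y16).
have X1 : 1 <= X by lra.
have lu : l <= 3 * L.
  apply: (@ln_expr_le_log2 _ X _ 3) => //.
  rewrite exprS expr2 mulrA; apply: ler_pM => //; rewrite ?mulr_ge0 ?invr_ge0 ?(ltW dl0)//.
  by apply: ler_pM => //; lra.
have ll : 1 <= 16 * l.
  have yi0 : 0 < (4 * T%:R / delta)^-1 by rewrite invr_gt0.
  have := ln_le_sub1 yi0; rewrite lnV ?posrE// -/l.
  have : (4 * T%:R / delta)^-1 <= 16^-1 by rewrite lef_pV2 ?posrE.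
  by move: (_^-1) (l) => *; lra.
by split=> //; rewrite lu andbT; lra.
Qed.

(** All demands on the constant in front of both radii. The second one is the largest: it fixes the
    power L^4, and 48 * 611^2 is below 2 * 10^7. *)
Let E_ge : 10 * (46 * L) ^+ 2 <= C%:R * L ^+ 4 /\
  48 * (611 * L ^+ 2) ^+ 2 + 34 * L + 2 <= C%:R * L ^+ 4 /\
  (3 * L) ^+ 2 <= C%:R * L ^+ 4 /\ 1 <= C%:R * L ^+ 4.
Proof.
have L1 := L_ge1; have [L2 L3] := L4.
have L41 : 1 <= L ^+ 4 by rewrite exprn_ege1.
have L40 : 0 <= L ^+ 4 by exact: le_trans L41.
have := ler_wpM2r L40 C_ge.
have -> : (46 * L) ^+ 2 = 46 ^+ 2 * L ^+ 2 by rewrite exprMn.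
have -> : (3 * L) ^+ 2 = 3 ^+ 2 * L ^+ 2 by rewrite exprMn.
have -> : (611 * L ^+ 2) ^+ 2 = 611 ^+ 2 * L ^+ 4 by rewrite exprMn -exprM.
move: L1 L2 L3 L41; move: (C%:R * L ^+ 4) => Y; move: (L ^+ 2) (L ^+ 4) (L) => *.
by split; [lra|split; [lra|split; lra]].
Qed.

Hypothesis c1 : concentrated f w1 eta gamma T h l
  (dir_val f beta wstar w1 eta gamma s0 s1 F h).
Hypothesis c2 : concentrated f w1 eta gamma T h l
  (dir_grad f beta wstar w1 eta gamma s0 s1 F h).
Hypothesis c3 : concentrated f w1 eta gamma T h l
  (dir_dist f beta wstar w1 eta gamma s0 s1 F D h).
Hypothesis c4 : concentrated f w1 eta gamma T h l
  (dir_reg beta wstar w1 eta gamma s0 s1 D T h).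

Let Gam_itv : 0 <= log_growth gamma T h <= 17 * L.
Proof.
rewrite log_growth_ge0//=.
have [[h4 hT hd he hg] [hb hs0 hs1 hd1]] := X_facts.
by apply: log_growth_le => //; lra.
Qed.

Lemma value_radius_ge0 : 0 <= F.
Proof.
have q0 : 0 <= q1 by rewrite subr_ge0.
have [_ [_ [_ E1]]] := E_ge.
rewrite /F mulr_ge0 ?(le_trans ler01 E1)// /Phi.
by nonneg (ltW eta0) q0.
Qed.

(** Strong induction, since the martingale sum requires the bound at all earlier times for its
    truncation to be inactive. The last update leads to time T + 1, so the range includes it. *)
Lemma path_subopt_le t : (1 <= t <= T.+1)%N -> subopt f wstar w1 eta gamma h t <= F.
Proof.
elim/ltn_ind: t => [[//|[|t]]] IH /= tT.
  have q0 : 0 <= q1 by rewrite subr_ge0.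
  have [_ [_ [_ E1]]] := E_ge.
  have P0 : q1 <= Phi.
    have p1 : 0 <= eta * s0 by nonneg (ltW eta0) q0.
    have p2 : 0 <= eta ^+ 2 * beta * s1 ^+ 2 by nonneg beta0 q0.
    have p3 : 0 <= eta ^+ 2 * beta by nonneg beta0 q0.
    rewrite /Phi; move: (q1) (eta * s0) (eta ^+ 2 * beta) (_ * s1 ^+ 2) p1 p2 p3.
    by move=> *; lra.
  apply: (le_trans P0); rewrite /F ler_peMl//; exact: le_trans P0.
have q0 : 0 <= q1 by rewrite subr_ge0.
apply: (@le_trans _ _ (q1 + kappa_val beta eta s0 s1 F * l
  + val_slope beta eta s0 s1 F * log_growth gamma T h)).
  apply: (subopt_sum_le cf beta0 sf minf eta0 gamma0 s00 s10 noise_le c1) => //.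
  by move=> s /andP[s1' st]; apply: IH; rewrite ?s1' //= (leq_trans st)// ltnW.
have [lb _] := l_itv; have [E1 _] := E_ge.
exact: val_algebra Gam_itv L_ge1 E1 _.
Qed.

Let Psi_ge1 : 1 <= Psi.
Proof.
have F0 := value_radius_ge0.
have g2 : 0 <= gamma ^- 2 by rewrite invr_ge0 exprn_ge0// ltW.
have g4 : 0 <= gamma ^- 4 by rewrite invr_ge0 exprn_ge0// ltW.
have s4 : 0 <= s1 ^+ 4 by rewrite exprn_ge0.
have s04 : 0 <= s0 ^+ 4 by rewrite exprn_ge0.
by rewrite /Psi -!addrA lerDl; nonneg g2 g4.
Qed.

Let E_ge0 : 0 <= C%:R * L ^+ 4.
Proof. by have [_ [_ [_ E1]]] := E_ge; exact: le_trans E1. Qed.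

Let eta_sqr_le : eta ^+ 2 <= d1 ^+ 2 + eta ^+ 2 * Psi.
Proof.
apply: (@le_trans _ _ (eta ^+ 2 * Psi)); last by rewrite lerDr sqr_ge0.
by rewrite ler_peMr ?sqr_ge0// Psi_ge1.
Qed.

Let D2 : D ^+ 2 = C%:R * L ^+ 4 * (d1 ^+ 2 + eta ^+ 2 * Psi).
Proof.
apply: sqr_sqrtr; apply: mulr_ge0; first exact: E_ge0.
exact: le_trans (sqr_ge0 eta) eta_sqr_le.
Qed.

Let D_ge0 : 0 <= D. Proof. exact: sqrtr_ge0. Qed.

(** Used in the regret to absorb [eta * l], through [l <= 3 * L], and [eta] itself. *)
Let eta_le_D : (3 * L) * eta <= D.
Proof.
have L1 := L_ge1.
have L0 : 0 <= 3 * L by lra.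
apply: le_of_sqr D_ge0 _; first by rewrite mulr_ge0// ltW.
rewrite D2 exprMn.
have [_ [_ [E3 _]]] := E_ge.
by apply: ler_pM; rewrite ?sqr_ge0//; exact: eta_sqr_le.
Qed.

Lemma dist_radius_gt0 : 0 < D.
Proof.
apply: lt_le_trans eta_le_D; rewrite mulr_gt0//.
by have L1 := L_ge1; lra.
Qed.

(** The function values are already controlled at all times, so only the truncation at [D] is
    propagated by induction. *)
Lemma path_dist_le t : (1 <= t <= T.+1)%N -> dist wstar w1 eta gamma h t <= D.
Proof.
elim/ltn_ind: t => [[//|[|t]]] IH /= tT.
  rewrite /dist iterate1 -/d1; apply: le_of_sqr (enorm_ge0 _) D_ge0 _; rewrite D2.
  have [_ [_ [_ E1]]] := E_ge.
  have p : d1 ^+ 2 <= d1 ^+ 2 + eta ^+ 2 * Psi.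
    by rewrite lerDl mulr_ge0 ?sqr_ge0// (le_trans ler01 Psi_ge1).
  by apply: (le_trans p); rewrite ler_peMl// (le_trans (sqr_ge0 d1)).
apply: le_of_sqr (enorm_ge0 _) D_ge0 _.
have [lb l1] := l_itv; have [_ [E2 _]] := E_ge.
apply: (le_trans (dist_sum_le cf beta0 sf minf eta0 gamma0 noise_le value_radius_ge0
  c2 c3 _ l1 dist_radius_gt0 _ _)) => //.
- by move=> s /andP[s1' st]; apply: path_subopt_le; rewrite s1' (leq_trans st)// ltnW.
- by move=> s /andP[s1' st]; apply: IH; rewrite ?s1' //= (leq_trans st)// ltnW.
have lnT : 0 <= ln (1 + T%:R : R) <= L.
  have t1 := T1; rewrite ln_ge0 ?lerDl//=.
  have [[h4 hT _ _ _] _] := X_facts.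
  apply: (le_trans _ (ln_le_log2 _)); last by lra.
  by rewrite ler_ln ?posrE; lra.
exact: (dist_algebra beta0 value_radius_ge0 eta0 gamma0 D_ge0 lb Gam_itv lnT L_ge1 E2 erefl D2).
Qed.

(** Jensen's inequality for the average and [regret_le] divided by [T]; [C] exceeds the constants 13
    and 86 found there. *)
Lemma path_value_le :
  f (T%:R^-1 *: \sum_(1 <= t < T.+1) iterate w1 eta gamma h t) - f wstar <=
    C%:R * ((D ^+ 2 / eta + eta) + D * Num.sqrt (log2 delta^-1)) * s0 / Num.sqrt T%:R
    + C%:R * (gamma * d1 ^+ 2 / eta
        + beta * (1 + s1 ^+ 2) * (D ^+ 2 / eta + eta) ^+ 2
        + beta * s1 ^+ 2 * D ^+ 2 * log2 delta^-1) / T%:R.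
Proof.
have [/andP[l0 lL] l1] := l_itv; have eD := eta_le_D; have L1 := L_ge1; have e0 := eta0.
have e1 : eta * l <= D by apply: le_trans eD; rewrite mulrC ler_pM2r.
have e2 : eta <= D by apply: le_trans eD; rewrite ler_peMl ?(ltW e0)//; lra.
have sD s : (1 <= s <= T)%N -> dist wstar w1 eta gamma h s <= D.
  by move=> /andP[s1' sT]; apply: path_dist_le; rewrite s1' leqW.
have reg := regret_le cf beta0 sf minf eta0 gamma0 s00 s10 noise_le D_ge0 c4 l0 e1 e2 sD.
have avg : f (T%:R^-1 *: \sum_(1 <= t < T.+1) iterate w1 eta gamma h t) - f wstar <=
    T%:R^-1 * \sum_(1 <= s < T.+1) subopt f wstar w1 eta gamma h s.
  have := convex_avg_le cf (iterate w1 eta gamma h) T.-1; rewrite prednK// => av.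
  rewrite sumrB sumr_const_nat subn1/= -[f wstar *+ T]mulr_natl mulrBr mulKf ?lerD2r//.
  by rewrite pnatr_eq0 -lt0n.
apply: (le_trans avg).
have Tp : 0 < T%:R :> R by rewrite ltr0n.
have Ti : 0 < T%:R^-1 :> R by rewrite invr_gt0.
apply: (le_trans (ler_wpM2l (ltW Ti) reg)).
have r0 : 0 < Num.sqrt T%:R :> R by rewrite sqrtr_gt0.
have TE : T%:R^-1 = (Num.sqrt T%:R)^-1 * (Num.sqrt T%:R)^-1 :> R.
  by rewrite -invfM -expr2 sqr_sqrtr.
have lg0 : 0 <= log2 delta^-1.
  have /andP[dl0 dl4] := delta01.
  have di : 4 <= delta^-1 by rewrite -[4]invrK lef_pV2 ?posrE ?invr_gt0// ltW.
  by apply: le_trans (log2_ge1 _) => //; lra.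
have C86 : 86 <= C%:R :> R.
  by apply: le_trans C_ge; rewrite !exprS expr0; lra.
have rE : T%:R^-1 * Num.sqrt T%:R = (Num.sqrt T%:R)^-1 :> R.
  by rewrite TE -mulrA mulVf ?mulr1// gt_eqF.
rewrite mulrDr mulrDr -addrA.
set U := D ^+ 2 / eta + eta.
have U0 : 0 <= U by rewrite /U addr_ge0 ?divr_ge0 ?sqr_ge0// ltW.
have A1 : T%:R^-1 * (13 * U * s0 * Num.sqrt T%:R) <=
    C%:R * (U + D * Num.sqrt (log2 delta^-1)) * s0 / Num.sqrt T%:R.
  have -> : T%:R^-1 * (13 * U * s0 * Num.sqrt T%:R) = 13 * U * s0 / Num.sqrt T%:R.
    by rewrite mulrCA rE.
  rewrite ler_wpM2r ?invr_ge0 ?(ltW r0)// ler_wpM2r//.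
  apply: ler_pM => //; first by lra.
  by rewrite lerDl mulr_ge0 ?D_ge0 ?sqrtr_ge0.
have A2 : T%:R^-1 * (gamma * dist wstar w1 eta gamma h 1 ^+ 2 / eta)
    + T%:R^-1 * (86 * (beta * (1 + s1 ^+ 2)) * U ^+ 2) <=
    C%:R * (gamma * d1 ^+ 2 / eta + beta * (1 + s1 ^+ 2) * U ^+ 2
        + beta * s1 ^+ 2 * D ^+ 2 * log2 delta^-1) / T%:R.
  rewrite -mulrDr [leRHS]mulrC ler_pM2l// /dist iterate1 -/d1.
  have p1 : 0 <= gamma * d1 ^+ 2 / eta.
    by apply: divr_ge0; [nonneg (ltW gamma0) U0|exact: ltW].
  have p2 : 0 <= beta * (1 + s1 ^+ 2) * U ^+ 2 by nonneg beta0 U0.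
  have p3 : 0 <= beta * s1 ^+ 2 * D ^+ 2 * log2 delta^-1 by nonneg beta0 lg0.
  have m1 := ler_wpM2r p1 C86; have m2 := ler_wpM2r p2 C86; have m3 := ler_wpM2r p3 C86.
  rewrite -[86 * _ * U ^+ 2]mulrA; move: p1 p2 p3 m1 m2 m3.
  move: (gamma * d1 ^+ 2 / eta) (beta * (1 + s1 ^+ 2) * U ^+ 2).
  by move: (beta * s1 ^+ 2 * D ^+ 2 * log2 delta^-1) (C%:R : R) => *; lra.
rewrite addrCA; exact: lerD.
Qed.

End PathBounds.

Theorem theorem2 :
  (* absolute constants: C for O(.), and C, k for O~(.) = O(. * log^k) *)
  exists (C k : nat),
  forall (R : realType) (d : nat) (f : 'rV[R]_d -> R) (beta : R)
    (wstar w1 : 'rV[R]_d) (eta gamma sigma0 sigma1 delta : R) (T : nat)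
    (dO : measure_display) (Omega : measurableType dO)
    (P : probability Omega R) (g : nat -> Omega -> 'rV[R]_d),
  convex_fun f -> 0 <= beta -> smooth_fun beta f ->
  (forall w, f wstar <= f w) ->
  0 < eta -> 0 < gamma -> 0 <= sigma0 -> 0 <= sigma1 ->
  (0 < T)%N ->
  0 < delta < 4^-1 ->
  (* the oracle answers are random variables *)
  (forall (t : nat) (i : 'I_d), (1 <= t <= T)%N ->
     measurable_fun setT (fun x => (g t x) 0 i)) ->
  (forall (t : nat) (i : 'I_d), (1 <= t <= T)%N ->
     P.-integrable setT (fun x => ((g t x) 0 i)%:E)) ->
  (* unbiasedness: E[g_t | g_1, ..., g_{t-1}] = grad f(w_t) *)
  (forall (t : nat) (i : 'I_d) (A : set Omega), (1 <= t <= T)%N ->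
     <<s past_sets g t >> A ->
     (\int[P]_(x in A) ((g t x) 0 i)%:E =
      \int[P]_(x in A) ((gradf f (ada_w eta gamma w1 (g^~ x) t)) 0 i)%:E)%E) ->
  (* bounded affine noise, with probability one *)
  (forall t : nat, (1 <= t <= T)%N ->
     {ae P, forall x,
       let wt := ada_w eta gamma w1 (g^~ x) t in
       enorm (g t x - gradf f wt) ^+ 2 <=
         sigma0 ^+ 2 + sigma1 ^+ 2 * enorm (gradf f wt) ^+ 2}) ->
  let fstar := f wstar in
  let d1 := enorm (w1 - wstar) in
  let L := log2 (2 + T%:R + delta^-1 + eta + eta^-1 + gamma + gamma^-1
                 + beta + sigma0 + sigma1 + d1 + (f w1 - fstar)) in
  let F := C%:R * L ^+ k *
           (f w1 - fstar + eta * sigma0 + eta ^+ 2 * beta * sigma1 ^+ 2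
            + eta ^+ 2 * beta) in
  let D2 := C%:R * L ^+ k *
    (d1 ^+ 2 + eta ^+ 2 *
       (1 + sigma1 ^+ 2
        + gamma ^- 2 * (sigma0 ^+ 2 + beta * sigma1 ^+ 2 * F)
        + gamma ^- 4 * (sigma0 ^+ 4 + beta ^+ 2 * sigma1 ^+ 4 * F ^+ 2))) in
  let D := Num.sqrt D2 in
  let lg := log2 delta^-1 in
  exists A : set Omega, [/\ measurable A, (P A >= (1 - delta)%:E)%E &
    forall x, A x ->
      let w := ada_w eta gamma w1 (g^~ x) in
      f (T%:R^-1 *: \sum_(1 <= t < T.+1) w t) - fstar <=
        C%:R * ((D ^+ 2 / eta + eta) + D * Num.sqrt lg) * sigma0 / Num.sqrt T%:R
        + C%:R * (gamma * d1 ^+ 2 / eta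
               + beta * (1 + sigma1 ^+ 2) * (D ^+ 2 / eta + eta) ^+ 2
               + beta * sigma1 ^+ 2 * D ^+ 2 * lg) / T%:R
      /\ (forall t : nat, (1 <= t <= T.+1)%N -> enorm (w t - wstar) <= D)].
Proof.
(* Both witnesses are dictated by the square of 611 L^2 in the condition on D^2. *)
exists (10 ^ 8)%N, 4%N => R d f beta wstar w1 eta gamma s0 s1 delta T dO Omega P g.
have : 10 ^+ 8 <= (10 ^ 8)%N%:R :> R by rewrite natrX.
(* The unary numeral is made abstract at once; only its lower bound is kept. *)
move: (10 ^ 8)%N => C C_ge cf beta0 sf minf eta0 gamma0 s00 s10 T0 delta01 mg ig ug ng.
move=> fstar d1 L F D2 D lg.
have F0 : 0 <= F by exact: (value_radius_ge0 w1 beta0 minf eta0 gamma0 s00 s10 T0 delta01 C_ge).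
have D0 : 0 < D by exact: (dist_radius_gt0 w1 beta0 minf eta0 gamma0 s00 s10 T0 delta01 C_ge).
have /andP[dl0 dl4] := delta01.
have T1 : 1 <= T%:R :> R by rewrite ler1n.
(* Four martingales with [T] prefixes each: 4 T e^{-l} = delta. *)
pose l := ln (4 * T%:R / delta).
have y0 : 0 < 4 * T%:R / delta by rewrite divr_gt0// mulr_gt0// ltr0n.
have l0 : 0 <= l.
  rewrite ln_ge0// ler_pdivlMr// mul1r; move: (T%:R) T1 => z; lra.
pose noise_ok x := forall t, (1 <= t <= T)%N ->
  enorm (noise f w1 eta gamma (g^~ x) t) ^+ 2 <=
    s0 ^+ 2 + s1 ^+ 2 * enorm (grad f w1 eta gamma (g^~ x) t) ^+ 2.
(* The almost sure noise bounds for all times are merged into one event, so that one null set [N0]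
   serves the whole path. *)
have ok : {ae P, forall x, noise_ok x}.
  apply: ae_foralln => t; case: (boolP (1 <= t <= T)%N) => tT.
    by apply: filterS (ng t tT) => x.
  by apply: aeW => x.
have mp n : forall s i, (1 <= s < n)%N ->
    measurable_fun (setT : set (g_sigma_algebraType (past_sets g n))) (fun x => g s x 0 i).
  by move=> s i; exact: past_sets_coord.
have conc := ada_concentration_union cf beta0 sf minf eta0 gamma0 mg ig ug.
have [N1 [mN1 PN1 hN1]] := conc
  (fun s x => dir_val f beta wstar w1 eta gamma s0 s1 F (g^~ x) s)
  (fun n s i _ sn => measurable_dir_val wstar w1 eta s0 s1 F beta0 sf gamma0 (mp n) sn i)
  (fun s _ => let: ex_intro B hB := dir_val_bounded w1 s0 s1 F s cf beta0 sf minf eta0 gamma0 in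
     ex_intro _ B (fun x => hB (g^~ x)))
  (fun s sT => filterS (fun x nx => dir_val_le F cf beta0 sf minf eta0 gamma0 s00 s10 nx sT) ok)
  l l0.
have [N2 [mN2 PN2 hN2]] := conc
  (fun s x => dir_grad f beta wstar w1 eta gamma s0 s1 F (g^~ x) s)
  (fun n s i _ sn => measurable_dir_grad wstar w1 eta s0 s1 F beta0 sf gamma0 (mp n) sn i)
  (fun s _ => let: ex_intro B hB := dir_grad_bounded w1 s0 s1 F s cf beta0 sf minf eta0 gamma0 in
     ex_intro _ B (fun x => hB (g^~ x)))
  (fun s sT => filterS (fun x nx => dir_grad_le cf beta0 sf minf gamma0 nx F0 sT) ok)
  l l0.
have [N3 [mN3 PN3 hN3]] := conc
  (fun s x => dir_dist f beta wstar w1 eta gamma s0 s1 F D (g^~ x) s)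
  (fun n s i _ sn => measurable_dir_dist wstar w1 eta s0 s1 F D beta0 sf gamma0 (mp n) sn i)
  (fun s _ => let: ex_intro B hB := dir_dist_bounded f beta wstar w1 s0 s1 F D s eta0 gamma0 in
     ex_intro _ B (fun x => hB (g^~ x)))
  (fun s sT => filterS (fun x nx => dir_dist_le cf beta0 sf minf eta0 gamma0 nx F0 sT D0) ok)
  l l0.
have [N4 [mN4 PN4 hN4]] := conc
  (fun s x => dir_reg beta wstar w1 eta gamma s0 s1 D T (g^~ x) s)
  (fun n s i _ sn => measurable_dir_reg beta wstar w1 eta s0 s1 D T gamma0 (mp n) sn i)
  (fun s _ => let: ex_intro B hB := dir_reg_bounded beta wstar w1 s0 s1 D T s eta0 gamma0 in
     ex_intro _ B (fun x => hB (g^~ x)))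
  (fun s sT => filterS (fun x nx => dir_reg_le cf beta0 sf minf s00 s10 nx (ltW D0) sT) ok)
  l l0.
have [N0 [mN0 PN0 hN0]] := ok.
have el : T%:R * expR (- l) = delta / 4.
  rewrite expRN lnK ?posrE//; field.
  by rewrite !gt_eqF// ltr0n.
rewrite !el in PN1 PN2 PN3 PN4.
(* Total mass at most 0 + 4 (delta / 4); outside this set the path is treated deterministically. *)
pose bad := N0 `|` (N1 `|` N2 `|` (N3 `|` N4)).
have mbad : measurable bad by do ![apply: measurableU].
exists (~` bad); split; first exact: measurableC.
  rewrite probability_setC//.
  have Pbad : (P bad <= delta%:E)%E.
    have m12 := measurableU _ _ mN1 mN2; have m34 := measurableU _ _ mN3 mN4.
    have P0 : (P N0 <= 0)%E by rewrite PN0.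
    apply: (le_trans (measureU2 _ mN0 (measurableU _ _ m12 m34))).
    apply: (le_trans (leeD P0 (measureU2 _ m12 m34))).
    apply: (le_trans (leeD (lexx _) (leeD (measureU2 _ mN1 mN2) (measureU2 _ mN3 mN4)))).
    apply: (le_trans (leeD (lexx _) (leeD (leeD PN1 PN2) (leeD PN3 PN4)))).
    by rewrite add0e -!EFinD lee_fin; lra.
  by rewrite EFinB leeB.
move=> x /not_orP[x0 /not_orP[/not_orP[x1 x2] /not_orP[x3 x4]]] w.
have nx : noise_ok x by apply: contrapT => nx; apply: x0; apply: hN0.
have c1 := hN1 x x1 (fun s sT => dir_val_le F cf beta0 sf minf eta0 gamma0 s00 s10 nx sT).
have c2 := hN2 x x2 (fun s sT => dir_grad_le cf beta0 sf minf gamma0 nx F0 sT).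
have c3 := hN3 x x3 (fun s sT => dir_dist_le cf beta0 sf minf eta0 gamma0 nx F0 sT D0).
have c4 := hN4 x x4 (fun s sT => dir_reg_le cf beta0 sf minf s00 s10 nx (ltW D0) sT).
split.
  exact: (path_value_le cf beta0 sf minf eta0 gamma0 s00 s10 nx T0 delta01 C_ge c1 c2 c3 c4).
move=> t tT.
exact: (path_dist_le cf beta0 sf minf eta0 gamma0 s00 s10 nx T0 delta01 C_ge c1 c2 c3 tT).
Qed.
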